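(* Let $n\ge 3$ and $0\le k\le n$ be integers and let $\mu,\nu\in\Pi_{k,n}$. (i) For every $\lambda\in\Pi_{k,n}$, the quantum Kostka number $K_{\nu/d/\mu,\lambda}$, with $d=(|\lambda|+|\mu|-|\nu|)/n$, satisfies $$K_{\nu/d/\mu,\lambda}=|\Gamma_\lambda(\mu,\nu)|=|B_\lambda(\mu,\nu)| .$$ (ii) The total number $|\Gamma(\mu,\nu)|$ of dimer configurations on the cylinder subject only to the boundary conditions $b^{in}=b^\mu$ and $b^{out}=b^\nu$ is $$|\Gamma(\mu,\nu)|=\sum_{\alpha}|\Gamma_\alpha(\mu,\nu)|=\sum_{\lambda\in\Pi_{k,n}}K_{\nu/d/\mu,\lambda}\,\frac{\ell(\lambda)!}{\prod_{i\ge1}m_i(\lambda)!}\binom{k}{\ell(\lambda)} ,$$ where the first sum is over all $\alpha=(\alpha_1,\dots,\alpha_k)$ with integers $0\le\alpha_i\le n-k$, in the second sum $d=(|\lambda|+|\mu|-|\nu|)/n$ depends on $\lambda$, $\ell(\lambda)$ is the number of nonzero parts of $\lambda$ and $m_i(\lambda)$ is the multiplicity of $i$ in $\lambda$.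
   Context: Partitions and binary strings. $\Pi_{k,n}$ is the set of partitions $\mu=(\mu_1\ge\dots\ge\mu_k\ge 0)$ with $\mu_1\le n-k$; $|\mu|=\sum_i\mu_i$. It is identified with the set of binary strings $b=b_n\cdots b_2b_1$ of length $n$ with exactly $k$ one-letters via $\mu\mapsto b^\mu$, where $b^\mu_j=1$ if and only if $j\in\{\mu_{k+1-i}+i : 1\le i\le k\}$. $\mu'\in\Pi_{n-k,n}$ is the conjugate partition, and $b^{\mu'}$ is its string (with $n-k$ one-letters). Quantum Kostka numbers. The small quantum cohomology ring of the Grassmannian of $k$-planes in $\mathbb{C}^n$ is $$qH^*(\mathrm{Gr}_k(\mathbb{C}^n))\cong\mathbb{Z}[q][e_1,\dots,e_k]/\langle h_{n-k+1},\dots,h_{n-1},h_n+q(-1)^k\rangle,\qquad h_r=\det(e_{1-i+j})_{1\le i,j\le r},$$ with $e_0=1$ and $e_j=0$ for $j<0$ or $j>k$ (and $h_0=1$, $h_r=0$ for $r<0$). The Schubert classes $\sigma_\lambda=\det(h_{\lambda_i-i+j})_{1\le i,j\le k}$, $\lambda\in\Pi_{k,n}$, form a $\mathbb{Z}[q]$-basis (for $k=0$ the ring is taken to be $\mathbb{Z}[q]$ with basis $\sigma_\emptyset=1$). For $\lambda,\mu\in\Pi_{k,n}$ the quantum Kostka numbers are defined by the expansion of the product in this ring $$\sigma_\mu * h_{\lambda_1}*\cdots*h_{\lambda_k}=\sum_{\nu\in\Pi_{k,n}}q^dK_{\nu/d/\mu,\lambda}\,\sigma_\nu,\qquad d=\frac{|\lambda|+|\mu|-|\nu|}{n},$$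 with $K_{\nu/d/\mu,\lambda}=0$ if $d$ is not a nonnegative integer. Lattice. The honeycomb lattice on the cylinder with circumference $n$ and height $k$ has rows $t=1,\dots,k$ (numbered from bottom to top); row $t$ is a zigzag cycle of $2n$ vertices $D_{t,j},U_{t,j}$ with $j\in\mathbb{Z}/n\mathbb{Z}$ (representatives $1,\dots,n$). The edges are: edges joining $D_{t,j}$ and $U_{t,j}$; ''horizontal'' edges joining $U_{t,j}$ and $D_{t,j+1}$; vertical edges joining $U_{t,j}$ and $D_{t+1,j}$ for $1\le t\le k-1$; and, in addition, for each $j$ a bottom edge labelled $j$ attached only to $D_{1,j}$ and a top edge labelled $j$ attached only to $U_{k,j}$. Dimers. A dimer configuration (perfect matching) is a set of edges (bottom and top edges may be selected) such that every vertex $D_{t,j},U_{t,j}$ lies on exactly one selected edge. It has boundary conditions $b^{in}=b^\mu$, $b^{out}=b^\nu$ if the bottom edge $j$ is selected iff $b^\mu_j=1$ and the top edge $j$ is selected iff $b^\nu_j=1$. $\Gamma_\alpha(\mu,\nu)$ is the set of dimer configurations with these boundary conditions and exactly $\alpha_t$ selected horizontal edges in row $t$, $t=1,\dots,k$; $\Gamma(\mu,\nu)=\bigcup_\alpha\Gamma_\alpha(\mu,\nu)$ over all $\alpha$ with $0\le\alpha_t\le n-k$. (For $k=0$ there is just the empty matching.) Crystals. For $0\le r\le n$, $B_r$ is the (single column Kirillov-Reshetikhin) crystal of type $\widehat{\mathfrak{sl}}_n$ whose vertices are the binary strings $b=b_n\cdots b_1$ with $r$ one-letters, with Kashiwara operators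 indexed by $i\in\mathbb{Z}/n\mathbb{Z}$ (positions mod $n$): $f_i(b)$ is obtained by moving the one-letter from position $i$ to position $i+1$ if $b_i=1,b_{i+1}=0$, and $f_i(b)=\emptyset$ otherwise; $e_i$ is the partial inverse of $f_i$. In any crystal put $\varepsilon_i(b)=\max\{p\ge0:e_i^p(b)\ne\emptyset\}$ and $\varphi_i(b)=\max\{p\ge 0:f_i^p(b)\neq\emptyset\}$. The tensor product $B\otimes B'$ has vertex set $B\times B'$ and $$e_i(b_1\otimes b_2)=\begin{cases}e_i(b_1)\otimes b_2,&\varepsilon_i(b_1)>\varphi_i(b_2)\\ b_1\otimes e_i(b_2),&\text{else}\end{cases}\qquad f_i(b_1\otimes b_2)=\begin{cases}f_i(b_1)\otimes b_2,&\varepsilon_i(b_1)\ge\varphi_i(b_2)\\ b_1\otimes f_i(b_2),&\text{else}\end{cases}$$ with $b\otimes\emptyset=\emptyset\otimes b=\emptyset$. Put $B_\lambda=B_{\lambda_1}\otimes\cdots\otimes B_{\lambda_k}$. The combinatorial $R$-matrix $R_\lambda:B_{n-k}\otimes B_\lambda\to B_\lambda\otimes B_{n-k}$ is the unique bijection commuting with all $e_i,f_i$, $i\in\mathbb{Z}/n\mathbb{Z}$ (with $\emptyset\mapsto\emptyset$). The map $\Omega:B_\lambda\to B_\lambda$ is $\Omega(b^{(1)}\otimes\cdots\otimes b^{(k)})=\Omega(b^{(1)})\otimes\cdots\otimes\Omega(b^{(k)})$, where on a single string $\Omega(b_n\cdots b_1)=b_{n-1}\cdots b_1b_n$, i.e.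 $\Omega(b)_i=b_{i-1}$ (indices mod $n$). Finally $$B_\lambda(\mu,\nu)=\{b\in B_\lambda : R_\lambda(b^{\mu'}\otimes\Omega(b))=b\otimes b^{\nu'}\}.$$ *)

(* Defs.v *)
(* Everything indexed from 1 in the mathematics is indexed from 0 here: rows,
   positions, parts and the index i of e_i, f_i are ordinals, and Z/nZ is 'I_n
   with its cyclic successor ordS and predecessor ord_pred. *)
From HB Require Import structures.
From Stdlib Require Import ClassicalEpsilon.
From mathcomp Require Import all_boot all_order all_algebra.
From mathcomp Require Import mpoly.

Set Implicit Arguments.
Unset Strict Implicit.
Unset Printing Implicit Defensive.

Import GRing.Theory.

Local Open Scope nat_scope.

(** * Partitions in a k x (n - k) box and their binary strings *)

Definition part (k n : nat) :=
  {m : {ffun 'I_k -> 'I_(n - k).+1} |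
    [forall i : 'I_k, forall j : 'I_k, (i <= j) ==> (m j <= m i)]}.

Definition pt k n (mu : part k n) (i : 'I_k) : nat := val mu i.

Definition psize k n (mu : part k n) : nat := \sum_(i < k) pt mu i.

Definition plen k n (mu : part k n) : nat := #|[set i | 0 < pt mu i]|.

Definition pmult k n (mu : part k n) (v : nat) : nat :=
  #|[set i | pt mu i == v]|.

Lemma conj_bound k n (hkn : k <= n) (mu : part k n) (j : 'I_(n - k)) :
  #|[set i | j < pt mu i]| < (n - (n - k)).+1.
Proof. by rewrite subKn // ltnS (leq_trans (max_card _)) ?card_ord. Qed.

Lemma conj_sorted k n (hkn : k <= n) (mu : part k n) :
  let m := [ffun j => Ordinal (conj_bound hkn mu j)] in
  [forall i : 'I_(n - k), forall j : 'I_(n - k), (i <= j) ==> (m j <= m i)].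
Proof.
apply/forallP => i; apply/forallP => j; apply/implyP => leij; rewrite !ffunE /=.
by apply/subset_leq_card/subsetP => x; rewrite !inE; apply: leq_ltn_trans.
Qed.

Definition conj_part k n (hkn : k <= n) (mu : part k n) : part (n - k) n :=
  Sub [ffun j => Ordinal (conj_bound hkn mu j)] (conj_sorted hkn mu).

Definition bstring n := {ffun 'I_n -> bool}.

(* With i counted from 0, mu_{k+1-i} is the part of index [rev_ord i]. *)
Definition pbits k n (mu : part k n) : bstring n :=
  [ffun j : 'I_n => [exists i : 'I_k, j == pt mu (rev_ord i) + i :> nat]].

(** * Quantum cohomology of the Grassmannian *)

Section QuantumCohomology.

Local Open Scope ring_scope.

Variables k n : nat.

(* Z[q][e_1, ..., e_k] with q = 'X and e_{i+1} = 'X_i *)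
Definition qpoly := {mpoly {poly int}[k]}.

Definition esym (m : int) : qpoly :=
  match m with
  | Posz 0 => 1
  | Posz m'.+1 => if insub m' is Some i then 'X_(i : 'I_k) else 0
  | Negz _ => 0
  end.

Definition hsym (m : int) : qpoly :=
  match m with
  | Posz r => \det (\matrix_(i < r, j < r) esym (1 - i%:Z + j%:Z))
  | Negz _ => 0
  end.

(* For k = 0 the ring is Z[q] itself, so there are no relations. *)
Definition qH_relations : seq qpoly :=
  if k is 0 then [::] else
  rcons [seq hsym r%:Z | r <- iota (n - k).+1 k.-1]
        (hsym n%:Z + ('X : {poly int}) *: (-1) ^+ k).

(* Equality in the quotient by the ideal generated by the relations *)
Definition eq_qH (P Q : qpoly) : Prop :=
  exists c : 'I_(size qH_relations) -> qpoly,
    P - Q = \sum_i c i * qH_relations`_i.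

Definition schubert (la : part k n) : qpoly :=
  \det (\matrix_(i < k, j < k) hsym ((pt la i)%:Z - i%:Z + j%:Z)).

(* d = (|la| + |mu| - |nu|) / n is a nonnegative integer. *)
Definition qdeg_ok (nu mu la : part k n) : bool :=
  ((psize nu <= psize la + psize mu) &&
   (n %| psize la + psize mu - psize nu))%N.

Definition qdeg (nu mu la : part k n) : nat :=
  ((psize la + psize mu - psize nu) %/ n)%N.

Definition is_quantum_expansion (mu la : part k n) (K : part k n -> int) :
    Prop :=
  (forall nu, ~~ qdeg_ok nu mu la -> K nu = 0) /\
  eq_qH (schubert mu * \prod_(i < k) hsym (pt la i)%:Z)
        (\sum_(nu : part k n)
           ((K nu)%:P * 'X^(qdeg nu mu la) : {poly int}) *: schubert nu).

(* [qKostka nu mu la] is K_{nu/d/mu,la}, where d is determined by nu, mu, la.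
   The Schubert classes being a basis, exactly one K satisfies
   [is_quantum_expansion mu la]. *)
Definition qKostka (nu mu la : part k n) : int :=
  epsilon (inhabits (fun _ : part k n => 0)) (is_quantum_expansion mu la) nu.

End QuantumCohomology.

(** * Dimers on the honeycomb lattice on the cylinder *)

(* [EdgeDU t j] joins D_{t,j} and U_{t,j}; [EdgeH t j] joins U_{t,j} and
   D_{t,j+1}; [EdgeV s j] runs from U in row s - 1 to D in row s (rows counted
   from 0), so that s = 0 gives the bottom edge j and s = k the top edge j. *)
Inductive edge (k n : nat) :=
  | EdgeDU of 'I_k & 'I_n
  | EdgeH of 'I_k & 'I_n
  | EdgeV of 'I_k.+1 & 'I_n.

Definition edge_code k n (e : edge k n) :
    'I_k * 'I_n + 'I_k * 'I_n + 'I_k.+1 * 'I_n :=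
  match e with
  | EdgeDU t j => inl (inl (t, j))
  | EdgeH t j => inl (inr (t, j))
  | EdgeV s j => inr (s, j)
  end.

Definition edge_decode k n (c : 'I_k * 'I_n + 'I_k * 'I_n + 'I_k.+1 * 'I_n) :
    edge k n :=
  match c with
  | inl (inl (t, j)) => EdgeDU t j
  | inl (inr (t, j)) => EdgeH t j
  | inr (s, j) => EdgeV s j
  end.

Lemma edge_codeK k n : cancel (@edge_code k n) (@edge_decode k n).
Proof. by case. Qed.

HB.instance Definition _ k n :=
  Finite.copy (edge k n) (can_type (@edge_codeK k n)).

Definition at_D k n (t : 'I_k) (j : 'I_n) (e : edge k n) : bool :=
  match e with
  | EdgeDU s i => (s == t) && (i == j)
  | EdgeH s i => (s == t) && (ordS i == j)
  | EdgeV s i => (s == t :> nat) && (i == j)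
  end.

Definition at_U k n (t : 'I_k) (j : 'I_n) (e : edge k n) : bool :=
  match e with
  | EdgeDU s i => (s == t) && (i == j)
  | EdgeH s i => (s == t) && (i == j)
  | EdgeV s i => (s == t.+1 :> nat) && (i == j)
  end.

Definition perfect_matching k n (M : {set edge k n}) : bool :=
  [forall t : 'I_k, forall j : 'I_n,
     (#|[set e in M | at_D t j e]| == 1) && (#|[set e in M | at_U t j e]| == 1)].

Definition boundary_dimers k n (mu nu : part k n) : {set {set edge k n}} :=
  [set M | [&& perfect_matching M,
               [forall j, (EdgeV ord0 j \in M) == pbits mu j]
             & [forall j, (EdgeV ord_max j \in M) == pbits nu j]]].

Definition Gamma_row k n (a : 'I_k -> nat) (mu nu : part k n) :
    {set {set edge k n}} :=
  [set M in boundary_dimers mu nu |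
     [forall t, #|[set j | EdgeH t j \in M]| == a t]].

Definition Gamma k n (mu nu : part k n) : {set {set edge k n}} :=
  \bigcup_(a : {ffun 'I_k -> 'I_(n - k).+1}) Gamma_row (fun t => a t : nat) mu nu.

(** * Crystals *)

(* Vertices with Kashiwara operators; [None] is the value "empty set". *)
Record crystal (n : nat) := Crystal {
  vert :> finType;
  ke : 'I_n -> vert -> option vert;
  kf : 'I_n -> vert -> option vert }.

(* The longest string starting at b.  The bound on p loses nothing as long as
   no iterate of g returns to an earlier vertex. *)
Definition string_length (T : finType) (g : T -> option T) (b : T) : nat :=
  \max_(p < #|T|.+1 | iter p (obind g) (Some b) != None) p.

Definition keps n (B : crystal n) (i : 'I_n) (b : B) : nat :=
  string_length (ke i) b.

Definition kphi n (B : crystal n) (i : 'I_n) (b : B) : nat :=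
  string_length (kf i) b.

Definition tensor n (B1 B2 : crystal n) : crystal n :=
  @Crystal n (B1 * B2)%type
    (fun i b =>
       if keps i b.1 > kphi i b.2
       then omap (fun c => (c, b.2)) (ke i b.1)
       else omap (fun c => (b.1, c)) (ke i b.2))
    (fun i b =>
       if keps i b.1 >= kphi i b.2
       then omap (fun c => (c, b.2)) (kf i b.1)
       else omap (fun c => (b.1, c)) (kf i b.2)).

Definition trivial_crystal n : crystal n :=
  @Crystal n unit (fun _ _ => None) (fun _ _ => None).

Definition column_string (n r : nat) :=
  {b : bstring n | #|[set j | b j]| == r}.

(* The [insub] always succeeds, since moving a letter preserves their number. *)
Definition column_f n r (i : 'I_n) (b : column_string n r) :
    option (column_string n r) :=
  if val b i && ~~ val b (ordS i)
  then insub [ffun j => if j == i then false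
                        else if j == ordS i then true else val b j]
       : option (column_string n r)
  else None.

Definition column_e n r (i : 'I_n) (b : column_string n r) :
    option (column_string n r) :=
  [pick c | column_f i c == Some b].

Definition column (n r : nat) : crystal n :=
  @Crystal n (column_string n r) (@column_e n r) (@column_f n r).

Fixpoint columns (n : nat) (rs : seq nat) : crystal n :=
  if rs is r :: rs' then tensor (column n r) (columns n rs')
  else trivial_crystal n.

Definition Bcrystal k n (la : part k n) : crystal n :=
  columns n [seq pt la i | i : 'I_k].

Lemma card_rotate n (b : bstring n) :
  #|[set j | [ffun i => b (ord_pred i)] j]| = #|[set j | b j]|.
Proof.
rewrite -(card_imset _ (@ord_pred_inj n)); congr #|pred_of_set _|.
apply/setP => x; rewrite inE; apply/imsetP/idP => [[y]|bx].
  by rewrite inE ffunE => by_ ->.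
by exists (ordS x); rewrite ?inE ?ffunE ordSK.
Qed.

Lemma rotate_subproof n r (b : column_string n r) :
  #|[set j | [ffun i => val b (ord_pred i)] j]| == r.
Proof. by rewrite card_rotate (valP b). Qed.

Definition rotate n r (b : column n r) : column n r :=
  Sub [ffun i => val b (ord_pred i)] (rotate_subproof b).

Fixpoint Omega (n : nat) (rs : seq nat) : columns n rs -> columns n rs :=
  match rs with
  | [::] => id
  | _ :: _ => fun b => (rotate b.1, Omega b.2)
  end.

Definition is_combinatorial_R n (B1 B2 : crystal n)
    (R : tensor B1 B2 -> tensor B2 B1) : Prop :=
  bijective R /\
  forall (i : 'I_n) (b : tensor B1 B2),
    omap R (ke i b) = ke i (R b) /\ omap R (kf i b) = kf i (R b).

(* For the crystals considered here there is exactly one such bijection. *)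
Definition combinatorial_R n (B1 B2 : crystal n) :
    tensor B1 B2 -> tensor B2 B1 :=
  epsilon (inhabits (fun b : tensor B1 B2 => (b.2, b.1) : tensor B2 B1))
          (@is_combinatorial_R n B1 B2).

Lemma card_pbits k n (hkn : k <= n) (mu : part k n) :
  #|[set j | pbits mu j]| == k.
Proof.
have hb (i : 'I_k) : pt mu (rev_ord i) + i < n.
  have := ltn_ord (val mu (rev_ord i)); have := ltn_ord i.
  rewrite ltnS => ltik le_mu; rewrite -addnS.
  by apply: leq_trans (leq_add le_mu ltik) _; rewrite subnK.
pose g (i : 'I_k) := Ordinal (hb i).
have pt_anti (i j : 'I_k) : i <= j -> pt mu j <= pt mu i.
  by move: (valP mu) => /forallP/(_ i)/forallP/(_ j)/implyP.
have g_lt (i j : 'I_k) : i < j -> g i < g j.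
  move=> ltij; rewrite /= -addnS leq_add //.
  by apply: pt_anti; rewrite /= leq_sub2l // ltnS ltnW.
have g_inj : injective g.
  move=> i j gij; apply: val_inj; case: (ltngtP i j) => // /g_lt;
  by rewrite gij ltnn.
suff -> : [set j | pbits mu j] = g @: [set: 'I_k].
  by rewrite card_imset // cardsT card_ord.
apply/setP => j; rewrite inE ffunE; apply/existsP/imsetP => [[i /eqP ji]|[i _ ->]].
  by exists i; rewrite ?inE //; apply: val_inj.
by exists i.
Qed.

(* b^{mu'} as a vertex of B_{n-k} *)
Definition conj_vertex k n (hkn : k <= n) (mu : part k n) : column n (n - k) :=
  Sub (pbits (conj_part hkn mu)) (card_pbits (leq_subr k n) (conj_part hkn mu)).

Definition Bset k n (hkn : k <= n) (la mu nu : part k n) :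
    {set Bcrystal la} :=
  [set b | @combinatorial_R n (column n (n - k)) (Bcrystal la)
             (conj_vertex hkn mu, Omega b)
           == (b, conj_vertex hkn nu)].

(* Main.v *)
(* All three numbers count the same chains of strings: [paths al b b'] is the
   number of ways to go from b to b' by rows of dimers with al_t horizontal
   edges in row t.  A row moves some of the zeros of b down by one position,
   cyclically, so that no two of them collide.

   Quantum cohomology.  Write sigma_mu, up to sign, as the n x n determinant D
   whose rows are the unit vectors of the zeros of b^mu and the k vectors
   (h_(i-a))_i.  Multiply by 1 - tP, P being the cyclic shift twisted by
   (-1)^(k+1) q.  On the last k rows this is multiplication by a companion
   matrix of determinant 1 - e_1 t + e_2 t^2 - ..., that is, by the inverse of
   the generating series of the h_r, while the first rows show the zeros hopping
   (collisions make two rows equal): this is the quantum Pieri rule.  That the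
   sigma_nu are independent is seen at q = 1, by evaluating at the points whose
   coordinates are distinct solutions of x^n = (-1)^(k+1): sigma_nu becomes a
   quotient of alternants, and these are independent by orthogonality of
   characters of Z/n.

   Crystals.  Every tensor product of columns contains, for each j in Z/n, a
   single element g_j with eps_i(g_j) <= delta_ij for all i, and every element
   is raised to g_j by operators e_i.  Hence a map commuting with all e_i and f_i
   is bijective and unique, and the R-matrix is whatever such map one can write
   down.  For two columns of heights r >= s it is given by a carrier walking
   around the circle, and it sends c (x) Omega(s) to s (x) c' exactly when the
   letters s of c can hop by one position to give c'.  Since b^{mu'} is the
   reversed complement of b^mu, these hops are the rows of dimers. *)
From HB Require Import structures.
Require Import Defs.
From mathcomp Require Import all_boot all_order all_algebra.
From mathcomp Require Import generic_quotient ring_quotient.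
From mathcomp Require Import perm mpoly algC cyclotomic zify ring.
From Stdlib Require Import ClassicalEpsilon.

Set Implicit Arguments.
Unset Strict Implicit.
Unset Printing Implicit Defensive.

(** * Crystals and their tensor products *)

(** Part (ii) counts dimers for every order of the row contents, while a Kostka number sees only the
    underlying partition. That [paths] is invariant under permuting its first argument is not
    evident on the paths. It is taken from the commutativity of the quantum product: the iterated
    Pieri rule is proved for arbitrary sequences, and two orders of the same factors then have the
    same expansion because the Schubert classes are independent. Putting q = 1 in the proof of
    independence loses nothing, since in an expansion each sigma_nu comes with a single power of q,
    fixed by nu. Evaluation at the same points shows that the quotient ring is nonzero, which its
    construction requires. On the crystal side, the R-matrix is only given as some choice of a
    bijection commuting with the operators. The rigidity of such maps is therefore proved first, for
    abstract crystals in a form that passes to tensor products, and checked on single columns. *)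

Section StringLength.

Variables (T : finType) (g : T -> option T) (len : T -> nat).
Hypothesis g_none : forall x, (g x == None) = (len x == 0).
Hypothesis g_some : forall x y, g x = Some y -> len x = (len y).+1.

Lemma iter_obind_None p : iter p (obind g) None = None.
Proof. by elim: p => //= p ->. Qed.

Lemma iter_len p x :
  if iter p (obind g) (Some x) is Some y then len y + p = len x
  else len x < p.
Proof.
elim: p x => [|p IH] x; first by rewrite /= addn0.
rewrite iterSr /=; case E: (g x) => [y|] /=.
  by have := IH y; rewrite (g_some E); case: (iter _ _ _) => [z|]; lia.
rewrite iter_obind_None.
by have := g_none x; rewrite E eqxx => /esym/eqP ->.
Qed.

(** The iterates of [g] from x have lengths len x, len x - 1, ..., 0 and so are distinct; hence the
    bound on p in [string_length] does not cut the string. *)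
Lemma len_lt_card x : len x <= #|T|.
Proof.
pose h (p : 'I_(len x).+1) := odflt x (iter p (obind g) (Some x)).
have h_inj : injective h.
  move=> p q; rewrite /h => E; apply: val_inj; move: E.
  have := iter_len p x; have := iter_len q x.
  case: (iter _ _ _) => [y|]; last by have := ltn_ord q; lia.
  case: (iter _ _ _) => [z|]; last by have := ltn_ord p; lia.
  by move=> /= Hy Hz E; subst z; rewrite /=; lia.
by have := leq_card h h_inj; rewrite card_ord; lia.
Qed.

Lemma string_lengthE x : string_length g x = len x.
Proof.
apply/eqP; rewrite eqn_leq; apply/andP; split.
  apply/bigmax_leqP => p Hp; move: Hp; have := iter_len p x.
  by case: (iter _ _ _) => // y; lia.
have lt : len x < #|T|.+1 by rewrite ltnS len_lt_card.
apply: (@leq_bigmax_cond _ _ (fun p : 'I_#|T|.+1 => p : nat) (Ordinal lt)) => /=.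
by have := iter_len (len x) x; case: (iter _ _ _) => //; lia.
Qed.

End StringLength.

Lemma omap_None (S U : eqType) (f : S -> U) (o : option S) :
  (omap f o == None) = (o == None).
Proof. by case: o. Qed.

Section Regular.

Variable n : nat.
Implicit Types B : crystal n.

(** The axioms of a crystal that the tensor rule relies on; no weight function is recorded. *)
Record regular B : Prop := Regular {
  reg_ef : forall i (x y : B), ke i x = Some y <-> kf i y = Some x;
  reg_e0 : forall i (x : B), (ke i x == None) = (keps i x == 0);
  reg_f0 : forall i (x : B), (kf i x == None) = (kphi i x == 0);
  reg_eps : forall i (x y : B), ke i x = Some y -> keps i x = (keps i y).+1;
  reg_phi : forall i (x y : B), ke i x = Some y -> kphi i y = (kphi i x).+1 }.

(** Any pair of functions with the right recursion must be the pair of string lengths. This computes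
    [keps] and [kphi] without touching the maxima that define them. *)
Lemma regular_intro B (ep ph : 'I_n -> B -> nat) :
  (forall i (x y : B), ke i x = Some y <-> kf i y = Some x) ->
  (forall i (x : B), (ke i x == None) = (ep i x == 0)) ->
  (forall i (x : B), (kf i x == None) = (ph i x == 0)) ->
  (forall i (x y : B), ke i x = Some y ->
     ep i x = (ep i y).+1 /\ ph i y = (ph i x).+1) ->
  [/\ regular B, forall i (x : B), keps i x = ep i x
    & forall i (x : B), kphi i x = ph i x].
Proof.
move=> ef e0 f0 ep_ph.
have epE i (x : B) : keps i x = ep i x.
  by apply: string_lengthE => [y|y z /ep_ph[]]; first exact: e0.
have phE i (x : B) : kphi i x = ph i x.
  by apply: string_lengthE => [y|y z /ef/ep_ph[]]; first exact: f0.
split=> //; split=> // i x; rewrite ?epE ?phE //.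
  by move=> y /ep_ph[]; rewrite epE.
by move=> y /ep_ph[]; rewrite phE.
Qed.

Section Tensor.

Variables B1 B2 : crystal n.
Hypotheses (reg1 : regular B1) (reg2 : regular B2).

Lemma tensor_e_Some i (x y : tensor B1 B2) :
  ke i x = Some y <->
  (kphi i x.2 < keps i x.1 /\ ke i x.1 = Some y.1 /\ x.2 = y.2) \/
  (keps i x.1 <= kphi i x.2 /\ ke i x.2 = Some y.2 /\ x.1 = y.1).
Proof.
case: x y => [x1 x2] [y1 y2] /=; case: ltnP => h; split.
- by case: (ke i x1) => //= a [<- <-]; left.
- by case=> [[_ [-> ->]]|[h' _]] //; move: h'; rewrite leqNgt h.
- by case: (ke i x2) => //= a [<- <-]; right.
- by case=> [[h' _]|[_ [-> ->]]] //; move: h'; rewrite ltnNge h.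
Qed.

Lemma tensor_f_Some i (x y : tensor B1 B2) :
  kf i x = Some y <->
  (kphi i x.2 <= keps i x.1 /\ kf i x.1 = Some y.1 /\ x.2 = y.2) \/
  (keps i x.1 < kphi i x.2 /\ kf i x.2 = Some y.2 /\ x.1 = y.1).
Proof.
case: x y => [x1 x2] [y1 y2] /=; case: leqP => h; split.
- by case: (kf i x1) => //= a [<- <-]; left.
- by case=> [[_ [-> ->]]|[h' _]] //; move: h'; rewrite ltnNge h.
- by case: (kf i x2) => //= a [<- <-]; right.
- by case=> [[h' _]|[_ [-> ->]]] //; move: h'; rewrite leqNgt h.
Qed.

(** The signature rule: eps of the left factor cancels against phi of the right one, and truncated
    subtraction keeps what is left over. *)
Lemma tensor_regular_all :
  [/\ regular (tensor B1 B2),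
      forall i (x : tensor B1 B2),
        keps i x = keps i x.2 + (keps i x.1 - kphi i x.2)
    & forall i (x : tensor B1 B2),
        kphi i x = kphi i x.1 + (kphi i x.2 - keps i x.1)].
Proof.
apply: regular_intro.
- move=> i [x1 x2] [y1 y2]; rewrite tensor_e_Some tensor_f_Some /=; split.
    case=> [[h [E e2]]|[h [E e1]]]; [subst y2; left|subst y1; right].
      by split; [have := reg_eps reg1 E; lia | rewrite -(reg_ef reg1)].
    by split; [have := reg_phi reg2 E; lia | rewrite -(reg_ef reg2)].
  case=> [[h [E e2]]|[h [E e1]]]; [subst y2; left|subst y1; right].
    move/(reg_ef reg1): E => E.
    by split=> //; have := reg_eps reg1 E; lia.
  move/(reg_ef reg2): E => E.
  by split=> //; have := reg_phi reg2 E; lia.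
- move=> i x /=; case: ltnP => h; rewrite omap_None.
    by rewrite (reg_e0 reg1); lia.
  by rewrite (reg_e0 reg2); lia.
- move=> i x /=; case: leqP => h; rewrite omap_None.
    by rewrite (reg_f0 reg1); lia.
  by rewrite (reg_f0 reg2); lia.
- move=> i [x1 x2] [y1 y2]; rewrite tensor_e_Some /=.
  case=> [[h [E e2]]|[h [E e1]]]; [subst y2|subst y1].
    by move: (reg_eps reg1 E) (reg_phi reg1 E) h; lia.
  by move: (reg_eps reg2 E) (reg_phi reg2 E) h; lia.
Qed.

Lemma tensor_regular : regular (tensor B1 B2).
Proof. by case: tensor_regular_all. Qed.

Lemma tensor_keps i (x : tensor B1 B2) :
  keps i x = keps i x.2 + (keps i x.1 - kphi i x.2).
Proof. by case: tensor_regular_all. Qed.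

Lemma tensor_kphi i (x : tensor B1 B2) :
  kphi i x = kphi i x.1 + (kphi i x.2 - keps i x.1).
Proof. by case: tensor_regular_all. Qed.

End Tensor.

Definition strict B B' (f : B -> B') : Prop :=
  forall (i : 'I_n) (x : B),
    omap f (ke i x) = ke i (f x) /\ omap f (kf i x) = kf i (f x).

Section Strict.

Variables (B B' : crystal n) (f : B -> B').
Hypotheses (reg : regular B) (reg' : regular B') (fS : strict f).

Lemma strict_keps i x : keps i (f x) = keps i x.
Proof.
move En: (keps i x) => m; elim: m x En => [|m IH] x /eqP Ex.
  by apply/eqP; rewrite -(reg_e0 reg') -(fS i x).1; move: Ex; rewrite -(reg_e0 reg) => /eqP->.
have := (fS i x).1; case E: (ke i x) => [y|] /=.
  move=> /esym/(reg_eps reg')->; rewrite IH //.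
  by have := reg_eps reg E; lia.
by have := reg_e0 reg i x; rewrite E (eqP Ex).
Qed.

Lemma strict_kphi i x : kphi i (f x) = kphi i x.
Proof.
move En: (kphi i x) => m; elim: m x En => [|m IH] x /eqP Ex.
  by apply/eqP; rewrite -(reg_f0 reg') -(fS i x).2; move: Ex; rewrite -(reg_f0 reg) => /eqP->.
have := (fS i x).2; case E: (kf i x) => [y|] /=.
  move=> /esym/(reg_ef reg')/(reg_phi reg')->; rewrite IH //.
  by move: E => /(reg_ef reg)/(reg_phi reg); lia.
by have := reg_f0 reg i x; rewrite E (eqP Ex).
Qed.

End Strict.

Lemma strict_comp B1 B2 B3 (f : B1 -> B2) (g : B2 -> B3) :
  strict f -> strict g -> strict (g \o f).
Proof.
move=> fS gS i x; split.
  by rewrite -[RHS](gS i (f x)).1 -(fS i x).1; case: ke.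
by rewrite -[RHS](gS i (f x)).2 -(fS i x).2; case: kf.
Qed.

Lemma strict_tensorl B1 B1' B2 (f : B1 -> B1') :
  regular B1 -> regular B1' -> strict f ->
  strict (fun x : tensor B1 B2 => (f x.1, x.2) : tensor B1' B2).
Proof.
move=> r1 r1' fS i [x y] /=; rewrite (strict_keps r1 r1' fS).
split; case: ifP => _; rewrite -1?(fS i x).1 -1?(fS i x).2.
- by case: (ke i x).
- by case: (ke i y).
- by case: (kf i x).
- by case: (kf i y).
Qed.

Lemma strict_tensorr B1 B2 B2' (f : B2 -> B2') :
  regular B2 -> regular B2' -> strict f ->
  strict (fun x : tensor B1 B2 => (x.1, f x.2) : tensor B1 B2').
Proof.
move=> r2 r2' fS i [x y] /=; rewrite (strict_kphi r2 r2' fS).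
split; case: ifP => _; rewrite -1?(fS i y).1 -1?(fS i y).2.
- by case: (ke i x).
- by case: (ke i y).
- by case: (kf i x).
- by case: (kf i y).
Qed.

Lemma strict_assoc B1 B2 B3 :
  regular B1 -> regular B2 -> regular B3 ->
  strict (fun x : tensor B1 (tensor B2 B3) =>
            ((x.1, x.2.1), x.2.2) : tensor (tensor B1 B2) B3).
Proof.
move=> r1 r2 r3 i [x [y z]]; split.
  rewrite /= (tensor_kphi r2 r3) (tensor_keps r1 r2) /=.
  case: (ltnP (kphi i z) (keps i y)) => hyz.
    rewrite (_ : kphi i z < _); last lia.
    rewrite (_ : kphi i z - keps i y = 0); last lia.
    rewrite addn0; case: ltnP => hxy; first by case: (ke i x).
    by case: (ke i y).
  case: (ltnP (_ + _) _) => hx.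
    by rewrite ifT ?ifT; [case: (ke i x) | lia | lia].
  by rewrite ifF; [case: (ke i z) | lia].
rewrite /= (tensor_kphi r2 r3) (tensor_keps r1 r2) /=.
case: (leqP (kphi i z) (keps i y)) => hyz.
  rewrite (_ : kphi i z <= _); last lia.
  rewrite (_ : kphi i z - keps i y = 0); last lia.
  rewrite addn0; case: leqP => hxy; first by case: (kf i x).
  by case: (kf i y).
case: (leqP (_ + _) _) => hx.
  by rewrite ifT ?ifT; [case: (kf i x) | lia | lia].
by rewrite ifF; [case: (kf i z) | lia].
Qed.

Lemma strict_assoc' B1 B2 B3 :
  regular B1 -> regular B2 -> regular B3 ->
  strict (fun x : tensor (tensor B1 B2) B3 =>
            (x.1.1, (x.1.2, x.2)) : tensor B1 (tensor B2 B3)).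
Proof.
move=> r1 r2 r3 i [[x y] z].
have [/= <- <-] := strict_assoc r1 r2 r3 i (x, (y, z)).
by split; [case: (if _ then _ else _) => [[? []]|]
          |case: (if _ then _ else _) => [[? []]|]].
Qed.

Lemma trivial_regular_all :
  [/\ regular (trivial_crystal n),
      forall i (x : trivial_crystal n), keps i x = 0
    & forall i (x : trivial_crystal n), kphi i x = 0].
Proof. exact: regular_intro. Qed.

Lemma strict_trivialC (B : crystal n) :
  regular B ->
  strict (fun x : tensor B (trivial_crystal n) =>
            (tt, x.1) : tensor (trivial_crystal n) B).
Proof.
move=> rB i [x []] /=.
have [_ e0 f0] := trivial_regular_all.
rewrite e0 f0; split; last first.
  rewrite leqn0 -(reg_f0 rB); by case E: (kf i x).
rewrite ltn0 lt0n -(reg_e0 rB); by case E: (ke i x).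
Qed.

End Regular.

(** * Minimal elements and the rigidity of strict maps *)

Section Grounded.

Variable n : nat.
Implicit Types B : crystal n.

(** The steps are the arrows of B (x) u that act on B, where u is a highest weight vector of the
    fundamental weight Lambda_j: there phi_i(u) is 1 for i = j and 0 otherwise, and e_i acts on the
    left factor when eps_i exceeds it. *)
Inductive raises B (j : 'I_n) (z : B) : B -> Prop :=
  | raises_refl : raises j z z
  | raises_step (i : 'I_n) x y : (i == j) < keps i x -> ke i x = Some y ->
      raises j z y -> raises j z x.

Lemma raises_trans B j (x y z : B) : raises j y x -> raises j z y -> raises j z x.
Proof. by elim=> // i u v lt_u Euv _ IH /IH; apply: raises_step Euv. Qed.

(** The map [sh] records where phi of the minimal element sits, which is the index that a factor
    further to the left will see. The flag v is false for crystals without arrows, such as columns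
    of height 0 or n. *)
Definition grounded B (v : bool) (g : 'I_n -> B) (sh : 'I_n -> 'I_n) : Prop :=
  [/\ forall j x, raises j (g j) x,
      forall j x, (forall i, keps i x <= (i == j)) -> x = g j,
      forall i j, keps i (g j) = v && (i == j),
      forall i j, kphi i (g j) = v && (i == sh j)
    & ~~ v -> forall j, sh j = j].

(** Raise the right factor to g2 j first. Its phi is then concentrated at sh2 j, so the left factor
    behaves as if it stood alone with index sh2 j. *)
Lemma grounded_tensor B1 B2 v1 g1 sh1 v2 g2 sh2 :
  regular B1 -> regular B2 ->
  @grounded B1 v1 g1 sh1 -> @grounded B2 v2 g2 sh2 ->
  @grounded (tensor B1 B2) (v1 || v2)
    (fun j => (g1 (sh2 j), g2 j)) (sh1 \o sh2).
Proof.
move=> r1 r2 [conn1 uniq1 eps1 phi1 sh1_id] [conn2 uniq2 eps2 phi2 sh2_id].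
have epsT i (y : B1) (z : B2) :
  keps i ((y, z) : tensor B1 B2) = keps i z + (keps i y - kphi i z) := tensor_keps r1 r2 i (y, z).
have phiT i (y : B1) (z : B2) :
  kphi i ((y, z) : tensor B1 B2) = kphi i y + (kphi i z - keps i y) := tensor_kphi r1 r2 i (y, z).
split.
- move=> j [y z].
  have raise_left z1 : z1 = g2 j -> forall y0,
      raises (sh2 j) (g1 (sh2 j)) y0 ->
      raises j ((g1 (sh2 j), g2 j) : tensor B1 B2) (y0, z1).
    move=> -> y0; elim=> [|i x y' ltx Exy _ IH]; first exact: raises_refl.
    have lt_x : kphi i (g2 j) < keps i x.
      by rewrite phi2; case: v2 {sh2_id eps2 phi2}; lia.
    apply: (raises_step (i := i) _ _ IH); last by apply/tensor_e_Some; left.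
    rewrite epsT eps2 phi2.
    by case: v2 sh2_id ltx {eps2 phi2 lt_x} => /= [_|/(_ isT) ->] ltx; lia.
  suff {y z} raise_right (z z0 : B2) : raises j z0 z -> forall y, exists y0,
      raises j ((y0, z0) : tensor B1 B2) (y, z).
    have [y1 Hy1] := raise_right z _ (conn2 j z) y.
    by apply: raises_trans Hy1 _; apply: raise_left.
  elim=> {z} [|i x z ltx Exz _ IH] y; first by exists y; apply: raises_refl.
  (* As long as eps_i(y) exceeds phi_i(x), e_i acts on the left factor and lowers eps_i(y); after
     finitely many steps it reaches the right factor. *)
  move En: (keps i y) => m; elim: m y En => [|m IHm] y En.
    have [y0 Hy0] := IH y; exists y0.
    apply: (raises_step (i := i) _ _ Hy0); first by rewrite epsT; lia.
    by apply/tensor_e_Some; right; rewrite En.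
  have [lt_y|le_y] := ltnP (kphi i x) (keps i y); last first.
    have [y0 Hy0] := IH y; exists y0.
    apply: (raises_step (i := i) _ _ Hy0); first by rewrite epsT; lia.
    by apply/tensor_e_Some; right.
  case E: (ke i y) => [y'|]; last by have := reg_e0 r1 i y; rewrite E En.
  have [|y0 Hy0] := IHm y'; first by have := reg_eps r1 E; lia.
  exists y0; apply: (raises_step (i := i) _ _ Hy0); first by rewrite epsT; lia.
  by apply/tensor_e_Some; left.
- move=> j [y z] Hx.
  have Ez : z = g2 j.
    by apply: uniq2 => i; have := Hx i; rewrite epsT; lia.
  subst z; congr pair; apply: uniq1 => i.
  have := Hx i; rewrite epsT eps2 phi2.
  by case: v2 sh2_id {eps2 phi2 Hx} => /= [_|/(_ isT) ->]; lia.
- move=> i j; rewrite epsT eps1 eps2 phi2.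
  by case: v2 sh2_id {eps2 phi2} => /= [_|/(_ isT) ->]; case: v1 {sh1_id eps1 phi1}; lia.
- move=> i j; rewrite phiT eps1 phi1 phi2 /=.
  case: v2 sh2_id {eps2 phi2} => /= [_|/(_ isT) ->];
  case: v1 sh1_id {eps1 phi1} => /= [_|/(_ isT) E]; rewrite ?E; lia.
- by rewrite negb_or => /andP[/sh1_id id1 /sh2_id id2] j; rewrite /= id2 id1.
Qed.

Variables (B B' : crystal n) (v v' : bool) (g : 'I_n -> B) (g' : 'I_n -> B').
Variables (sh sh' : 'I_n -> 'I_n).
Hypotheses (rB : regular B) (rB' : regular B').
Hypotheses (gB : grounded v g sh) (gB' : grounded v' g' sh').

Lemma strict_ground (f : B -> B') : strict f -> forall j, f (g j) = g' j.
Proof.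
move=> fS j; case: gB gB' => _ _ eps_g _ _ [_ uniq' _ _ _].
by apply: uniq' => i; rewrite (strict_keps rB rB' fS) eps_g; case: v; lia.
Qed.

(** The two maps agree at g j. Going back down a raising path, f_i recovers x from e_i x, so they
    agree everywhere. *)
Lemma strict_uniq (f f' : B -> B') (j : 'I_n) :
  strict f -> strict f' -> f =1 f'.
Proof.
move=> fS fS' x; case: gB => /(_ j x) conn _ _ _ _.
elim: conn => {x} [|i x y _ Exy _ IH]; first by rewrite !strict_ground.
have := (fS i x).1; have := (fS' i x).1; rewrite Exy /= IH => /esym Ex' /esym Ex.
by move: Ex => /(reg_ef rB'); move: Ex' => /(reg_ef rB') -> [].
Qed.

(** If x and x' have the same image, every e_i that raises x also raises x', and an element with the
    image of g j has its string lengths, hence equals it. For surjectivity, descend from f (g j) =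
    g' j along a raising path of the target. *)
Lemma strict_bij (f : B -> B') (j : 'I_n) : strict f -> bijective f.
Proof.
move=> fS; have f_inj : injective f.
  case: (gB) => conn uniq _ _ _.
  move=> x; elim: (conn j x) => {x} [|i x y _ Exy _ IH] x' Ef.
    apply/esym/uniq => i; rewrite -(strict_keps rB rB' fS) -Ef.
    by rewrite (strict_keps rB rB' fS); case: gB => _ _ -> _ _; case: v; lia.
  have /= := (fS i x).1; rewrite Exy Ef -(fS i x').1.
  case E: (ke i x') => [y'|] //= [/IH Ey]; move: E Exy; rewrite Ey.
  by move=> /(reg_ef rB) + /(reg_ef rB) => -> [].
have f_surj y : exists x, f x == y.
  case: gB' => /(_ j y) conn _ _ _ _.
  elim: conn => {y} [|i y z _ Eyz _ [x /eqP fx]].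
    by exists (g j); rewrite strict_ground.
  have := (fS i x).2; rewrite fx; move/(reg_ef rB'): Eyz => ->.
  by case: (kf i x) => //= x' [<-]; exists x'.
pose h y := xchoose (f_surj y).
have hK : cancel h f by move=> y; apply/eqP/(xchooseP (f_surj y)).
by exists h => // x; apply: f_inj; rewrite hK.
Qed.

End Grounded.

Lemma strict_combinatorial_R n (B1 B2 : crystal n) v g sh v' g' sh'
    (R : tensor B1 B2 -> tensor B2 B1) (j : 'I_n) :
  regular (tensor B1 B2) -> regular (tensor B2 B1) ->
  @grounded n (tensor B1 B2) v g sh -> @grounded n (tensor B2 B1) v' g' sh' ->
  strict R -> @combinatorial_R n B1 B2 =1 R.
Proof.
move=> r r' gr gr' RS.
have isR : is_combinatorial_R R.
  by split; [apply: (strict_bij r r' gr gr' j RS) | exact: RS].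
have [_ RS'] := epsilon_spec (inhabits (fun b : tensor B1 B2 => (b.2, b.1) : tensor B2 B1))
          (@is_combinatorial_R n B1 B2) (ex_intro _ R isR).
exact: (strict_uniq r r' gr gr' j RS' RS).
Qed.

(** * Single columns *)

Lemma ordS_neq n (i : 'I_n) : 1 < n -> ordS i != i.
Proof.
move=> n1; rewrite -val_eqE /=; have lt_i := ltn_ord i.
have [lt_Si|] := ltnP i.+1 n; first by rewrite modn_small //; lia.
by move=> le_n; rewrite (_ : i.+1 = n) ?modnn; lia.
Qed.

Lemma ord_predP n (i : 'I_n) : exists j, i = ordS j.
Proof. by exists (ord_pred i); rewrite ord_predK. Qed.

Section Bits.

Variable n : nat.
Implicit Types b c : bstring n.

Lemma card_bits b : #|[set j | b j]| = \sum_j b j.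
Proof. by rewrite -sum1dep_card big_mkcond; apply: eq_bigr => j _; case: (b j). Qed.

Lemma sum_ordS (F : 'I_n -> nat) : \sum_j F (ordS j) = \sum_j F j.
Proof. by rewrite [RHS](reindex_inj (@ordS_inj n)). Qed.

Lemma sum_ord_pred (F : 'I_n -> nat) : \sum_j F (ord_pred j) = \sum_j F j.
Proof. by rewrite [RHS](reindex_inj (@ord_pred_inj n)). Qed.

Lemma leq_sum_eq (F F' : 'I_n -> nat) :
  (forall j, F j <= F' j) -> \sum_j F' j <= \sum_j F j -> F =1 F'.
Proof.
move=> le_F le_sum j.
have [_ [/esym]] := leqif_sum (fun (i : 'I_n) (_ : true) => leqif_eq (le_F i)).
rewrite eqn_leq leq_sum ?andTb => [|i _]; last exact: le_F.
by rewrite le_sum => /forall_inP/(_ j isT)/eqP.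
Qed.

(** Relational form of f_i on raw strings: it reads backwards as e_i and avoids the [insub] of
    [column_f]. *)
Definition hop1 (i : 'I_n) b c : Prop :=
  [/\ b i, ~~ b (ordS i), ~~ c i, c (ordS i)
    & forall j, j != i -> j != ordS i -> b j = c j].

Lemma hop1_inj i b b' c : hop1 i b c -> hop1 i b' c -> b = b'.
Proof.
case=> bi bSi _ _ bE [b'i b'Si _ _ b'E]; apply/ffunP => j.
case: (eqVneq j i) => [->|ji]; first by rewrite bi b'i.
case: (eqVneq j (ordS i)) => [->|jSi].
  by rewrite (negbTE bSi) (negbTE b'Si).
by rewrite bE // b'E.
Qed.

Lemma hop1_fun i b c c' : hop1 i b c -> hop1 i b c' -> c = c'.
Proof.
case=> _ _ ci cSi cE [_ _ c'i c'Si c'E]; apply/ffunP => j.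
case: (eqVneq j i) => [->|ji]; first by rewrite (negbTE ci) (negbTE c'i).
case: (eqVneq j (ordS i)) => [->|jSi]; first by rewrite cSi c'Si.
by rewrite -cE // -c'E.
Qed.

Hypothesis n1 : 1 < n.

(** With F = 1 this preserves the number of letters; with F = [cdist j] it makes the total distance
    a potential for raising. *)
Lemma sum_hop1 i (F : 'I_n -> nat) b c : hop1 i b c ->
  \sum_j F j * c j + F i = \sum_j F j * b j + F (ordS i).
Proof.
case=> bi bSi ci cSi E.
rewrite (bigD1 i) //= (bigD1 (ordS i)) ?ordS_neq //= cSi (negbTE ci).
rewrite [in RHS](bigD1 i) //= [in RHS](bigD1 (ordS i)) ?ordS_neq //= bi (negbTE bSi).
rewrite !muln0 !muln1 !add0n.
rewrite (eq_bigr (fun j => F j * b j)); first lia.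
by move=> j /andP[ji jSi]; rewrite E.
Qed.

Lemma card_hop1 i b c : hop1 i b c -> #|[set j | c j]| = #|[set j | b j]|.
Proof.
move=> /(sum_hop1 (fun=> 1)); rewrite !card_bits => /eqP.
rewrite eqn_add2r => /eqP; under eq_bigr do rewrite mul1n.
by under [in RHS]eq_bigr do rewrite mul1n.
Qed.

End Bits.

Section Column.

Variables n r : nat.
Hypothesis n1 : 1 < n.

Lemma column_kf i (b c : column n r) :
  kf i b = Some c <-> hop1 i (val b) (val c).
Proof.
rewrite /= /column_f; set c0 := [ffun j => _].
have hop_c0 : val b i && ~~ val b (ordS i) -> hop1 i (val b) c0.
  move=> /andP[bi bSi]; split; rewrite ?ffunE ?eqxx //.
    by rewrite (negbTE (ordS_neq _ n1)).
  by move=> j /negbTE ji /negbTE jSi; rewrite ffunE ji jSi.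
case: ifP => [/hop_c0 Hc0|Hb]; last by split=> // -[bi bSi]; rewrite bi bSi in Hb.
rewrite insubT /=; first by rewrite (card_hop1 n1 Hc0) (eqP (valP b)).
by move=> H; split=> [[<-]|/(hop1_fun Hc0) E] //; congr Some; apply: val_inj.
Qed.

Lemma column_ke i (b c : column n r) :
  ke i b = Some c <-> hop1 i (val c) (val b).
Proof.
rewrite /= /column_e; case: pickP => [d /eqP/column_kf Hd|Hno].
  split=> [[<-] //|/(hop1_inj Hd) E]; congr Some; exact: val_inj.
by split=> // /column_kf /= Hc; have := Hno c; rewrite Hc eqxx.
Qed.

Lemma column_kfP i (b : column n r) :
  (kf i b == None) = ~~ (val b i && ~~ val b (ordS i)).
Proof.
case E: (kf i b) => [c|].
  by move/column_kf: E => [-> ->].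
apply/esym/idP/negP => Hb; move: E; rewrite /= /column_f Hb insubT //=.
set c0 := [ffun j => _].
suff Hc0 : hop1 i (val b) c0 by rewrite (card_hop1 n1 Hc0) (eqP (valP b)).
move/andP: Hb => [bi bSi]; split; rewrite ?ffunE ?eqxx //.
  by rewrite (negbTE (ordS_neq _ n1)).
by move=> j /negbTE ji /negbTE jSi; rewrite ffunE ji jSi.
Qed.

Lemma column_keP i (b : column n r) :
  (ke i b == None) = ~~ (~~ val b i && val b (ordS i)).
Proof.
case E: (ke i b) => [c|].
  by move/column_ke: E => [_ _ -> ->].
apply/esym/idP/negP => /andP[bi bSi].
pose c0 : bstring n := [ffun j => if j == ordS i then false
                        else if j == i then true else val b j].
have Hc0 : hop1 i c0 (val b).
  split; rewrite ?ffunE ?eqxx //.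
    by rewrite eq_sym (negbTE (ordS_neq _ n1)).
  by move=> j /negbTE ji /negbTE jSi; rewrite ffunE ji jSi.
have cc : #|[set j | c0 j]| == r by rewrite -(card_hop1 n1 Hc0) (eqP (valP b)).
have := (column_ke i b (Sub c0 cc)).2; rewrite E => /(_ _) H.
by have := H Hc0.
Qed.

Lemma column_regular_all :
  [/\ regular (column n r),
      forall i (b : column n r), keps i b = ~~ val b i && val b (ordS i)
    & forall i (b : column n r), kphi i b = val b i && ~~ val b (ordS i)].
Proof.
apply: regular_intro.
- by move=> i x y; rewrite column_ke column_kf.
- by move=> i x; rewrite column_keP eqb0.
- by move=> i x; rewrite column_kfP eqb0.
- by move=> i x y /column_ke[-> /negbTE-> /negbTE-> ->].
Qed.

Lemma column_regular : regular (column n r).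
Proof. by case: column_regular_all. Qed.

Lemma column_keps i (b : column n r) : keps i b = ~~ val b i && val b (ordS i).
Proof. by case: column_regular_all. Qed.

Lemma column_kphi i (b : column n r) : kphi i b = val b i && ~~ val b (ordS i).
Proof. by case: column_regular_all. Qed.

End Column.

Lemma val_ordS n (i : 'I_n) : ordS i = (if i.+1 == n then 0 else i.+1) :> nat.
Proof.
rewrite /=; have lt_i := ltn_ord i; case: eqP => [->|ne]; first exact: modnn.
by rewrite modn_small //; lia.
Qed.

Section CyclicDistance.

Variable n : nat.
Implicit Types j p : 'I_n.

(* The number of steps from j + 1 up to p, around the circle. *)
Definition cdist j p : nat := if j < p then p - j.+1 else p + n - j.+1.

Lemma cdist_lt j p : cdist j p < n.
Proof. by rewrite /cdist; have ? := ltn_ord p; have ? := ltn_ord j; case: (ltnP j p); lia. Qed.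

Lemma cdist_ordS j p : p != j -> cdist j (ordS p) = (cdist j p).+1.
Proof.
move=> ne_pj; have {ne_pj} ne_pj : p <> j :> nat by move=> /val_inj; apply/eqP.
rewrite /cdist val_ordS; have ? := ltn_ord p; have ? := ltn_ord j.
by case: eqP => ?; case: (ltnP j p) => ?; case: (ltnP j) => ?; lia.
Qed.

Lemma cdist_ordS_id j : cdist j (ordS j) = 0.
Proof.
rewrite /cdist val_ordS; have ? := ltn_ord j.
by case: eqP => ?; case: (ltnP j) => ?; lia.
Qed.

Lemma cdist_id j : cdist j j = n.-1.
Proof. by rewrite /cdist ltnn; have ? := ltn_ord j; rewrite addnC; lia. Qed.

Lemma cdist_inj j : injective (cdist j).
Proof.
move=> p q; rewrite /cdist => E; apply: ord_inj; move: E.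
have ? := ltn_ord p; have ? := ltn_ord q; have ? := ltn_ord j.
by case: (ltnP j p) => ?; case: (ltnP j q) => ?; lia.
Qed.

Lemma cdist_surj j m : m < n -> exists p, cdist j p = m.
Proof.
move=> lt_m; pose D p := Ordinal (cdist_lt j p).
have D_inj : injective D by move=> p q /(congr1 val)/cdist_inj.
exists (invF D_inj (Ordinal lt_m)).
by have /(congr1 val) := f_invF D_inj (Ordinal lt_m).
Qed.

Lemma card_ord_lt r : r <= n -> #|[set p : 'I_n | p < r]| = r.
Proof.
by move=> le_r; rewrite -sum1dep_card -(big_ord_widen _ (fun=> 1)) // sum1_card card_ord.
Qed.

Lemma card_cdist j r : r <= n -> #|[set p | cdist j p < r]| = r.
Proof.
move=> le_r; pose D p := Ordinal (cdist_lt j p).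
have D_inj : injective D by move=> p q /(congr1 val)/cdist_inj.
rewrite (_ : [set p | _] = D @^-1: [set q : 'I_n | q < r]).
  rewrite on_card_preimset; last by exact: onW_bij (injF_bij D_inj).
  exact: card_ord_lt.
by apply/setP => p; rewrite !inE.
Qed.

End CyclicDistance.

(** * The minimal elements of a single column *)

Section ColumnGround.

Variables n r : nat.
Hypotheses (n1 : 1 < n) (le_r : r <= n).

Lemma ground_bits_card (j : 'I_n) :
  #|[set p | [ffun p => cdist j p < r] p]| == r.
Proof.
by rewrite -[X in _ == X](card_cdist j le_r); apply/eqP/eq_card => p; rewrite !inE ffunE.
Qed.

(** The letters fill the r consecutive positions j + 1, ..., j + r of the circle. *)
Definition column_ground (j : 'I_n) : column n r :=
  Sub [ffun p => cdist j p < r] (ground_bits_card j).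

(** For 0 < r < n this is j + r, the last letter of [column_ground j] and the only one that can
    move. *)
Definition column_shift (j : 'I_n) : 'I_n :=
  if 0 < r < n then odflt j [pick p | cdist j p == r.-1] else j.

(** For i different from j, eps_i(c) = 0 says that a letter at i + 1 forces one at i. So the letters
    form an interval that starts at j + 1. *)
Lemma column_ground_uniq j (c : column n r) :
  (forall i, keps i c <= (i == j)) -> c = column_ground j.
Proof.
move=> Hc; have down m p p' : val c p -> cdist j p' + m = cdist j p -> val c p'.
  elim: m p => [|m IH] p cp; first by rewrite addn0 => /cdist_inj->.
  have [q Eq] := ord_predP p; subst p.
  have [->|ne_q] := eqVneq q j; first by rewrite cdist_ordS_id addnS.
  rewrite cdist_ordS // addnS => -[]; apply: IH.
  by have := Hc q; rewrite column_keps // cp (negbTE ne_q); case: (val c q).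
apply: val_inj; apply/ffunP.
have sub_c : [set p | val c p] \subset [set p | cdist j p < r].
  apply/subsetP => p; rewrite !inE => cp.
  rewrite -[X in _ < X](eqP (valP c)) -[X in X <= _](@card_cdist _ j) ?cdist_lt //.
  apply/subset_leq_card/subsetP => p'; rewrite !inE ltnS => le_p'.
  by apply: (down (cdist j p - cdist j p') p) => //; lia.
have /eqP/setP eq_c : [set p | val c p] == [set p | cdist j p < r].
  by rewrite eqEcard sub_c card_cdist // (eqP (valP c)) leqnn.
by move=> p; have := eq_c p; rewrite !inE ffunE.
Qed.

Lemma column_grounded :
  grounded (0 < r < n) column_ground column_shift.
Proof.
split.
(* Induction on the total distance of the letters from j + 1. In a column eps_j is at most 1, so an
   allowed e_i has i different from j and lowers this distance by one. *)
- move=> j x; move En: (\sum_p cdist j p * val x p) => m.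
  elim: m {-2}m (leqnn m) x En => [|N IH] m lt_m x En.
    rewrite (_ : x = column_ground j); first exact: raises_refl.
    apply: column_ground_uniq => i; rewrite column_keps //.
    case: (val x i) => //=; case xS: (val x _) => //=; rewrite lt0b.
    case: eqP => // /eqP ne_ij; move: En; rewrite (bigD1 (ordS i)) //= xS.
    by rewrite cdist_ordS //; lia.
  case: (boolP [forall i, keps i x <= (i == j)]) => [/forallP Hx|].
    by rewrite -(column_ground_uniq Hx); apply: raises_refl.
  case/forallPn => i; rewrite -ltnNge => lt_i.
  have ne_ij : i != j.
    by apply: contraL lt_i => /eqP->; rewrite eqxx column_keps // -leqNgt leq_b1.
  case E: (ke i x) => [y|]; last first.
    by move: (reg_e0 (column_regular r n1) i x) lt_i; rewrite E eqxx => /esym/eqP->.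
  apply: (raises_step lt_i E); apply: (IH _ _ y erefl).
  move/(column_ke n1)/(sum_hop1 n1 (cdist j)): E; rewrite cdist_ordS //.
  rewrite En => H.
  have {}H : m + cdist j i = (\sum_p cdist j p * val y p) + (cdist j i).+1 by [].
  by move: H; set s := bigop _ _ _; lia.
- by move=> j x; apply: column_ground_uniq.
- move=> i j; rewrite column_keps // !ffunE.
  have [->|ne_ij] := eqVneq i j; first by rewrite cdist_id cdist_ordS_id; lia.
  by rewrite cdist_ordS //; lia.
- move=> i j; rewrite column_kphi // !ffunE /column_shift.
  case: ifP => Hr; last first.
    have [->|ne_ij] := eqVneq i j; first by rewrite cdist_id cdist_ordS_id; lia.
    by have := cdist_lt j (ordS i); rewrite cdist_ordS //; lia.
  case: pickP => [p /eqP Ep|none]; last first.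
    have [|p Ep] := @cdist_surj n j r.-1; first by lia.
    by have := none p; rewrite Ep eqxx.
  rewrite /= -(inj_eq (@cdist_inj _ j)) Ep.
  have [->|ne_ij] := eqVneq i j; first by rewrite cdist_id cdist_ordS_id; lia.
  by rewrite cdist_ordS //; lia.
- by move=> /negbTE Hr j; rewrite /column_shift Hr.
Qed.

End ColumnGround.

(** * The combinatorial R-matrix of two columns *)

Section Carrier.

Variable n : nat.
Implicit Types (c d : bstring n) (G : 'I_n -> nat).

(* A carrier walks down the circle: at each position it picks up the letter of
   d and drops a letter onto that of c.  G p is its load between p + 1 and p. *)
Definition load c d G (p : 'I_n) : nat := G (ordS p) + d (ordS p) - c (ordS p).

Definition carrier c d G : bool := [forall p, G p == load c d G p].

(** The letters of c that find nothing to be matched with; the R-matrix moves exactly these to the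
    other factor. *)
Definition overflow c d G (p : 'I_n) : bool := [&& c p, ~~ d p & G p == 0].

Lemma carrierP c d G : reflect (forall p, G p = load c d G p) (carrier c d G).
Proof. exact: 'forall_eqP. Qed.

(** The truncated subtraction in [load] loses one exactly at an overflow; summed around the circle,
    the loads cancel. *)
Lemma sum_overflow c d G : carrier c d G ->
  \sum_p c p = \sum_p d p + \sum_p overflow c d G p.
Proof.
move/carrierP => HG.
have E p : G p + c (ordS p) = G (ordS p) + (d (ordS p) + overflow c d G (ordS p)).
  by rewrite HG /load /overflow; case: (c _); case: (d _) => /=; lia.
have: \sum_p (G p + c (ordS p)) =
      \sum_p (G (ordS p) + (d (ordS p) + overflow c d G (ordS p))).
  by apply: eq_bigr.
rewrite big_split /= [RHS]big_split /= (sum_ordS (fun p => c p : nat)).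
rewrite (sum_ordS (fun p => d p + overflow c d G p : nat)) (sum_ordS G) big_split /=.
by move/addnI.
Qed.

(** Carriers need not be unique, but [load] is monotone, so the minimum of two is again a carrier. A
    larger load can only remove overflows, while their number is fixed by [sum_overflow]. *)
Lemma overflow_uniq c d G G' : carrier c d G -> carrier c d G' ->
  overflow c d G =1 overflow c d G'.
Proof.
move=> HG HG'; pose M p := minn (G p) (G' p).
have HM : carrier c d M.
  apply/carrierP => p; rewrite /M /load.
  move/carrierP: HG => ->; move/carrierP: HG' => ->; rewrite /load.
  by case: (leqP (G (ordS p)) (G' (ordS p))); lia.
suff eqM H : carrier c d H -> (forall p, M p <= H p) ->
    overflow c d H =1 overflow c d M.
  by move=> p; rewrite !eqM // => q; rewrite /M; lia.
move=> HH leM p.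
suff: overflow c d H p = overflow c d M p :> nat.
  by case: (overflow _ _ _ _); case: (overflow _ _ _ _).
apply: (leq_sum_eq (F := fun p => overflow c d H p : nat)
                   (F' := fun p => overflow c d M p : nat)).
  move=> q; have := leM q; rewrite /overflow; case: (c q); case: (d q) => //=; lia.
by have := sum_overflow HH; have := sum_overflow HM; lia.
Qed.

(** Applying the monotone map [load] to a supersolution gives a smaller supersolution; the sum drops
    until a fixed point is reached. *)
Lemma carrier_descent c d G :
  (forall p, load c d G p <= G p) -> exists H : {ffun 'I_n -> nat}, carrier c d H.
Proof.
move En: (\sum_p G p) => N; elim: N {-2}N (leqnn N) G En => [|N IH] m le_m G En superG.
  exists (finfun G); apply/carrierP => p; apply/eqP.
  have G0 q : G q = 0 by move: En; rewrite (bigD1 q) //=; lia.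
  by have := superG p; rewrite /load !ffunE !G0; lia.
have [/carrierP HG|/forallPn[p neq]] := boolP (carrier c d G).
  by exists (finfun G); apply/carrierP => p; rewrite /load !ffunE HG.
apply: (IH _ _ (load c d G) erefl) => [|q].
  rewrite -ltnS (leq_trans _ le_m) // -En.
  rewrite (bigD1 p) //= [ltnRHS](bigD1 p) //= -addSn leq_add //.
    by rewrite ltn_neqAle superG eq_sym neq.
  exact: leq_sum.
rewrite /load; have := superG (ordS q); rewrite /load; lia.
Qed.

Lemma carrier_ex c d : \sum_p d p <= \sum_p c p ->
  exists H : {ffun 'I_n -> nat}, carrier c d H.
Proof.
pose S (b : bstring n) m := \sum_(j < n | j < m) b j.
have S_succ b (p : 'I_n) : S b p.+1 = S b p + b p.
  rewrite /S (bigD1 p) //= addnC; congr addn; apply: eq_bigl => j.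
  by rewrite ltnS -val_eqE /=; lia.
have S_le b m : S b m <= n.
  rewrite -[leqRHS]card_ord -sum1_card /S big_mkcond.
  by apply: leq_sum => j _; case: ifP => // _; case: (b j).
have S_all b : S b n = \sum_p b p by apply: eq_bigl => j; rewrite ltn_ord.
have S0 b : S b 0 = 0 by rewrite /S big_pred0.
rewrite -!S_all => le_dc.
(* Partial sums solve the load equation except at the wrap from n - 1 to 0, where the hypothesis on
   the totals gives the inequality. The shift by n prevents truncation. *)
apply: (@carrier_descent c d (fun p => n + S c p.+1 - S d p.+1)) => p.
have := S_le d (ordS p).+1; have := ltn_ord p.
rewrite /load !(S_succ _ (ordS p)) val_ordS; case: eqP => [->|_]; last lia.
by rewrite !S0; lia.
Qed.

End Carrier.

Section TwoColumns.

Variables n r s : nat.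
Hypotheses (n1 : 1 < n) (le_sr : s <= r).

Lemma column_carrier_ex (c : column n r) (d : column n s) :
  exists H : {ffun 'I_n -> nat}, carrier (val c) (val d) H.
Proof. by apply: carrier_ex; rewrite -!card_bits (eqP (valP c)) (eqP (valP d)). Qed.

Definition column_overflow (c : column n r) (d : column n s) : 'I_n -> bool :=
  overflow (val c) (val d) (xchoose (column_carrier_ex c d)).

Lemma column_overflowE c d G : carrier (val c) (val d) G ->
  column_overflow c d =1 overflow (val c) (val d) G.
Proof. by move=> HG; apply: overflow_uniq HG; apply: (xchooseP (column_carrier_ex c d)). Qed.

Lemma sum_column_overflow (c : column n r) (d : column n s) :
  s + \sum_p column_overflow c d p = r.
Proof.
have := sum_overflow (xchooseP (column_carrier_ex c d)).
by rewrite -!card_bits (eqP (valP c)) (eqP (valP d)) => ->.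
Qed.

Lemma columnR_card1 (c : column n r) (d : column n s) :
  #|[set p | [ffun p => val c p && ~~ column_overflow c d p] p]| == s.
Proof.
rewrite card_bits -(eqn_add2r (\sum_p column_overflow c d p)).
rewrite sum_column_overflow -[X in _ == X](eqP (valP c)) card_bits -big_split /=.
apply/eqP/eq_bigr => p _; rewrite ffunE /column_overflow /overflow.
by case: (val c p); case: (val d p) => //=; case: eqP.
Qed.

Lemma columnR_card2 (c : column n r) (d : column n s) :
  #|[set p | [ffun p => val d p || column_overflow c d p] p]| == r.
Proof.
rewrite card_bits -[X in _ == X](sum_column_overflow c d).
rewrite -[X in _ == X + _](eqP (valP d)) card_bits -big_split /=.
apply/eqP/eq_bigr => p _; rewrite ffunE /column_overflow /overflow.
by case: (val c p); case: (val d p) => //=; case: eqP.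
Qed.

Definition columnR (x : tensor (column n r) (column n s)) :
    tensor (column n s) (column n r) :=
  (Sub [ffun p => val x.1 p && ~~ column_overflow x.1 x.2 p] (columnR_card1 x.1 x.2),
   Sub [ffun p => val x.2 p || column_overflow x.1 x.2 p] (columnR_card2 x.1 x.2)).

Lemma columnRE1 c d G p : carrier (val c) (val d) G ->
  val (columnR (c, d)).1 p = val c p && ~~ overflow (val c) (val d) G p.
Proof. by move=> HG; rewrite ffunE (column_overflowE HG). Qed.

Lemma columnRE2 c d G p : carrier (val c) (val d) G ->
  val (columnR (c, d)).2 p = val d p || overflow (val c) (val d) G p.
Proof. by move=> HG; rewrite ffunE (column_overflowE HG). Qed.

End TwoColumns.

(* What f_i can do to the letters of c (x) d at positions i and S = i + 1. *)
Definition local_f (ci cS di dS ci' cS' di' dS' : bool) : bool :=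
  [|| [&& ci, ~~ cS, ~~ ci', cS', di == di', dS == dS' & ~~ (di && ~~ dS)]
    | [&& di, ~~ dS, ~~ di', dS', ci == ci', cS == cS' & ci || ~~ cS]].

Lemma local_fP ci cS di dS ci' cS' di' dS' :
  local_f ci cS di dS ci' cS' di' dS' ->
  [/\ ci = true, cS = false, ci' = false, cS' = true &
      [/\ di' = di, dS' = dS & ~~ (di && ~~ dS)]] \/
  [/\ di = true, dS = false, di' = false, dS' = true &
      [/\ ci' = ci, cS' = cS & ci || ~~ cS]].
Proof.
case/orP=> /and5P[-> /negbTE-> /negbTE-> -> /and3P[/eqP-> /eqP-> ->]].
  by left.
by right.
Qed.

(** With m the load arriving at i + 1, f_i does not change the load leaving i. So a carrier has to
    be corrected only between i + 1 and i. *)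
Lemma local_load (m : nat) (ci cS di dS ci' cS' di' dS' : bool) :
  local_f ci cS di dS ci' cS' di' dS' ->
  m + dS' - cS' + di' - ci' = m + dS - cS + di - ci.
Proof.
case/local_fP => [[-> -> -> -> [-> -> ]]|[-> -> -> -> [-> ->]]].
  by case: di; case: dS; lia.
by case: ci; case: cS; lia.
Qed.

(** A finite check, since all loads m of at least 2 behave alike. *)
Lemma local_columnR (m : nat) (ci cS di dS ci' cS' di' dS' : bool) :
  let u (c d : bool) g := [&& c, ~~ d & g == 0] in
  let g := m + dS - cS in let g' := m + dS' - cS' in
  local_f ci cS di dS ci' cS' di' dS' ->
  local_f (ci && ~~ u ci di g) (cS && ~~ u cS dS m)
          (di || u ci di g) (dS || u cS dS m)
          (ci' && ~~ u ci' di' g') (cS' && ~~ u cS' dS' m)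
          (di' || u ci' di' g') (dS' || u cS' dS' m).
Proof.
move=> u g g'; rewrite {}/u {}/g {}/g'.
case/local_fP => [[-> -> -> -> [-> -> ]]|[-> -> -> -> [-> ->]]].
  by case: di; case: dS => // _; case: m => [|[|m]];
    rewrite ?addn0 ?addn1 ?subn0 ?subn1.
by case: ci; case: cS => // _; case: m => [|[|m]];
    rewrite ?addn0 ?addn1 ?subn0 ?subn1.
Qed.

Section TwoColumnsStrict.

Variables n r s : nat.
Hypotheses (n1 : 1 < n) (le_sr : s <= r).

Local Notation R := (@columnR n r s le_sr).

Let rr := column_regular r n1.
Let rs := column_regular s n1.

Lemma columnR_strings i x : keps i (R x) = keps i x /\ kphi i (R x) = kphi i x.
Proof.
case: x => c d; have [G HG] := column_carrier_ex le_sr c d.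
rewrite (tensor_keps rs rr) (tensor_kphi rs rr) (tensor_keps rr rs) (tensor_kphi rr rs).
rewrite !column_keps // !column_kphi // !(columnRE1 _ _ HG) !(columnRE2 _ _ HG).
move/carrierP: HG => /(_ i); rewrite /load /overflow => ->.
case: (G (ordS i)) => [|[|m]]; case: (val c i); case: (val c (ordS i));
  by case: (val d i); case: (val d (ordS i)); rewrite /= ?addSn ?subSS ?subn0.
Qed.

Lemma columnR_f i x y : kf i x = Some y -> kf i (R x) = Some (R y).
Proof.
case: x y => [c d] [c' d'] Hxy; have [G HG] := column_carrier_ex le_sr c d.
have SN : ordS i != i := ordS_neq i n1.
have cd' j : j != i -> j != ordS i -> val c j = val c' j /\ val d j = val d' j.
  move=> ji jSi; move/tensor_f_Some: Hxy.
  by case=> [[_ [/(column_kf n1)[_ _ _ _ H] /= <-]]|[_ [/(column_kf n1)[_ _ _ _ H] /= <-]]];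
    rewrite H.
(* The corrected carrier for the pair after f_i. *)
pose G' p := if p == i then G (ordS i) + val d' (ordS i) - val c' (ordS i) else G p.
have G'S : G' (ordS i) = G (ordS i) by rewrite /G' (negbTE SN).
have Gi : G i = G (ordS i) + val d (ordS i) - val c (ordS i).
  by move/carrierP: HG => /(_ i) ->.
have G'i : G' i = G (ordS i) + val d' (ordS i) - val c' (ordS i).
  by rewrite /G' eqxx.
have local_c : local_f (val c i) (val c (ordS i)) (val d i) (val d (ordS i))
    (val c' i) (val c' (ordS i)) (val d' i) (val d' (ordS i)).
  rewrite /local_f.
  move/tensor_f_Some: Hxy; rewrite !column_keps // !column_kphi //.
  by case=> [[le [/(column_kf n1)[e1 /negbTE e2 /negbTE e3 e4 _] e5]]|
             [le [/(column_kf n1)[e1 /negbTE e2 /negbTE e3 e4 _] e5]]];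
    move: le; rewrite /= in e1 e2 e3 e4 e5 *;
    rewrite -?e5 e1 e2 e3 e4 !eqxx /=;
    case: (sval c i); case: (sval c (ordS i)); case: (sval d i); case: (sval d (ordS i)).
have HG' : carrier (val c') (val d') G'.
  apply/carrierP => p; rewrite /load.
  have [->|p_i] := eqVneq p i; first by rewrite G'i G'S.
  rewrite {1}/G' (negbTE p_i); move/carrierP: HG => /(_ p) ->; rewrite /load.
  have [->|Sp_i] := eqVneq (ordS p) i.
    by rewrite Gi G'i (local_load _ local_c).
  have Sp_Si : ordS p != ordS i by rewrite (inj_eq (@ordS_inj n)).
  have [-> ->] := cd' _ Sp_i Sp_Si.
  by rewrite /G' (negbTE Sp_i).
have far1 j : j != i -> j != ordS i -> val (R (c, d)).1 j = val (R (c', d')).1 j.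
  move=> ji jSi; rewrite (columnRE1 _ _ HG) (columnRE1 _ _ HG') /overflow.
  by have [-> ->] := cd' _ ji jSi; rewrite /G' (negbTE ji).
have far2 j : j != i -> j != ordS i -> val (R (c, d)).2 j = val (R (c', d')).2 j.
  move=> ji jSi; rewrite (columnRE2 _ _ HG) (columnRE2 _ _ HG') /overflow.
  by have [-> ->] := cd' _ ji jSi; rewrite /G' (negbTE ji).
have eq_near t (u u' : column n t) : val u i = val u' i ->
    val u (ordS i) = val u' (ordS i) ->
    (forall j, j != i -> j != ordS i -> val u j = val u' j) -> u = u'.
  move=> ui uSi uj; apply/val_inj/ffunP => j.
  have [->//|ji] := eqVneq j i; have [->//|jSi] := eqVneq j (ordS i).
  exact: uj.
apply/tensor_f_Some; rewrite !column_keps // !column_kphi // !column_kf //.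
pose a p := val (R (c, d)).1 p; pose b p := val (R (c, d)).2 p.
pose a' p := val (R (c', d')).1 p; pose b' p := val (R (c', d')).2 p.
have : local_f (a i) (a (ordS i)) (b i) (b (ordS i))
               (a' i) (a' (ordS i)) (b' i) (b' (ordS i)).
  rewrite /a /b /a' /b' !(columnRE1 _ _ HG) !(columnRE2 _ _ HG).
  rewrite !(columnRE1 _ _ HG') !(columnRE2 _ _ HG') /overflow G'i Gi G'S.
  exact: local_columnR.
case/orP => /and5P[A1 A2 A3 A4 /and3P[/eqP A5 /eqP A6 A7]].
  left; split; first by rewrite -/(b i) -/(b (ordS i)) (negbTE A7).
  by split; [split | apply: eq_near].
right; split; last by split; [split | apply: eq_near].
rewrite -/(a i) -/(a (ordS i)) -/(b i) -/(b (ordS i)) A1 A2.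
by move: A7; case: (a i); case: (a (ordS i)).
Qed.

Lemma columnR_strict : strict R.
Proof.
move=> i x; have [epsR phiR] := columnR_strings i x; split.
  case E: (ke i x) => [y|]; rewrite [LHS]/=.
    symmetry; apply: (reg_ef (tensor_regular rs rr) i (R x) (R y)).2.
    exact/columnR_f/(reg_ef (tensor_regular rr rs)).
  apply/esym/eqP; rewrite (reg_e0 (tensor_regular rs rr)) epsR.
  by rewrite -(reg_e0 (tensor_regular rr rs)) E.
case E: (kf i x) => [y|]; rewrite [LHS]/=; first by rewrite (columnR_f E).
apply/esym/eqP; rewrite (reg_f0 (tensor_regular rs rr)) phiR.
by rewrite -(reg_f0 (tensor_regular rr rs)) E.
Qed.

End TwoColumnsStrict.

(** * The R-matrix of several columns *)

(** The letters s of c move up by one position. Since c' p is a boolean, the additive equation also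
    excludes collisions: an arriving letter must find p empty or just vacated. *)
Definition hops n (c s c' : bstring n) : bool :=
  [forall p, (s p ==> c p) && (c' p + s p == c p + s (ord_pred p))].

Lemma hopsP n (c s c' : bstring n) :
  reflect (forall p, (s p -> c p) /\ c' p + s p = c p + s (ord_pred p))
          (hops c s c').
Proof.
apply: (iffP forallP) => H p; have := H p.
  by case/andP => /implyP Hs /eqP.
by case=> Hs ->; rewrite eqxx andbT; apply/implyP.
Qed.

Lemma hops_fun n (c s c1 c2 : bstring n) : hops c s c1 -> hops c s c2 -> c1 = c2.
Proof.
move=> /hopsP H1 /hopsP H2; apply/ffunP => p.
have [_ E1] := H1 p; have [_ E2] := H2 p.
by have: c1 p = c2 p :> nat; [lia | case: (c1 p); case: (c2 p)].
Qed.

Lemma hops_card n (c s c' : bstring n) : hops c s c' ->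
  #|[set p | c' p]| = #|[set p | c p]|.
Proof.
move=> /hopsP H; rewrite !card_bits; apply/eqP.
rewrite -(eqn_add2r (\sum_p s p)) -big_split /=.
rewrite (eq_bigr (fun p => c p + s (ord_pred p))) => [|p _]; last by case: (H p).
by rewrite big_split /= (sum_ord_pred (fun p => s p : nat)).
Qed.

Lemma columnR_rotate n r s (n1 : 1 < n) (le_sr : s <= r)
    (c c' : column n r) (b : column n s) :
  columnR le_sr (c, rotate b) = (b, c') <-> hops (val c) (val b) (val c').
Proof.
split=> [E|/hopsP H].
  have [G HG] := column_carrier_ex le_sr c (rotate b).
  apply/hopsP => p.
  have := columnRE1 le_sr p HG; have := columnRE2 le_sr p HG; rewrite E /=.
  rewrite /overflow !ffunE => -> ->.
  by case: (sval c p); case: (sval b (ord_pred p)) => //=; case: (G p == 0).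
(* The string b is its own carrier, never holding more than one letter: the load arriving at p is
   dropped onto c p and replaced by b (p - 1). The overflows are then the letters of c that stay in
   place. *)
have HG : carrier (val c) (val (rotate b)) (fun p => val b p).
  apply/carrierP => p; rewrite /load /= ffunE ordSK.
  have [Hc] := H p; have [] := H (ordS p); rewrite ordSK /=.
  case: (sval b (ordS p)); case: (sval b p);
  case: (sval c (ordS p)); case: (sval c' (ordS p)) => //=; lia.
apply: (congr2 pair); apply/val_inj/ffunP => p.
  rewrite (columnRE1 le_sr p HG) /overflow /= ffunE.
  have [Hc] := H p; move: Hc; rewrite /=.
  case: (sval b p); case: (sval b (ord_pred p)); case: (sval c p); case: (sval c' p) => //=; lia.
rewrite (columnRE2 le_sr p HG) /overflow /= ffunE.
have [Hc] := H p; move: Hc; rewrite /=.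
case: (sval b p); case: (sval b (ord_pred p)); case: (sval c p); case: (sval c' p) => //=; lia.
Qed.

Section Columns.

Variable n : nat.
Hypothesis n1 : 1 < n.

Lemma columns_regular rs : regular (columns n rs).
Proof.
elim: rs => [|r rs IH]; first by case: (trivial_regular_all n).
by apply: tensor_regular => //; apply: column_regular.
Qed.

Lemma columns_grounded rs : all (fun r => r <= n) rs ->
  exists v g sh, @grounded n (columns n rs) v g sh.
Proof.
elim: rs => [_|r rs IH /= /andP[le_r /IH[v [g [sh gr]]]]].
  exists false, (fun=> tt), id.
  have [_ e0 f0] := trivial_regular_all n.
  split; [by move=> j []; apply: raises_refl | by move=> j [] | | | by []].
    by move=> i j; rewrite e0.
  by move=> i j; rewrite f0.
do 3!eexists; apply: grounded_tensor (column_grounded n1 le_r) gr.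
  exact: column_regular.
exact: columns_regular.
Qed.

Fixpoint chain r (rs : seq nat) : column n r -> columns n rs -> column n r -> bool :=
  match rs with
  | [::] => fun c _ c' => c == c'
  | s :: rs' => fun c b c' =>
      [exists c1 : column n r, hops (val c) (val b.1) (val c1) && chain c1 b.2 c']
  end.

(** The left column is carried past one factor at a time. Strictness comes from the two-column case
    and associativity, and each passage contributes one link of the chain. *)
Lemma columnsR_ex r rs : all (fun s => s <= r) rs ->
  exists R : tensor (column n r) (columns n rs) -> tensor (columns n rs) (column n r),
    strict R /\
    forall c b c', R (c, Omega b) = (b, c') <-> chain c b c'.
Proof.
elim: rs => [_|s rs IH /= /andP[le_sr /IH[R [RS HR]]]].
  exists (fun x => (tt, x.1)); split; first exact/strict_trivialC/column_regular.
  by move=> c [] c' /=; split=> [[->]|/eqP->]; rewrite ?eqxx.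
have regs := column_regular s n1; have regr := column_regular r n1.
have regrs := columns_regular rs.
have HT := @columnR_rotate n r s n1 le_sr; have TS := columnR_strict n1 le_sr.
move: (columnR le_sr) HT TS => T HT TS.
exists (fun x => let y := T (x.1, x.2.1) in
                 let z := R (y.2, x.2.2) in ((y.1, z.1), z.2)).
split.
  have S1 := strict_assoc regr regs regrs.
  have S2 := strict_tensorl (B2 := columns n rs) (tensor_regular regr regs)
    (tensor_regular regs regr) TS.
  have S3 := strict_assoc' regs regr regrs.
  have S4 := strict_tensorr (B1 := column n s) (tensor_regular regr regrs)
    (tensor_regular regrs regr) RS.
  have S5 := strict_assoc regs regrs regr.
  exact: strict_comp S1 (strict_comp S2 (strict_comp S3 (strict_comp S4 S5))).
move=> c [b D] c' /=; split.
  case E: (T (c, rotate b)) => [d c1] /=.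
  case E1: (R (c1, Omega D)) => [D' c2] /= [? ? ?]; subst d D' c2.
  apply/existsP; exists c1; apply/andP; split.
    exact/HT.
  exact/HR.
case/existsP => c1 /andP[/HT -> /HR /= ->].
by [].
Qed.

Lemma combinatorial_R_chain r rs (c c' : column n r) (b : columns n rs) :
  r <= n -> all (fun s => s <= r) rs ->
  (@combinatorial_R n (column n r) (columns n rs) (c, Omega b) == (b, c')) =
  chain c b c'.
Proof.
move=> le_r le_rs; have [R [RS HR]] := columnsR_ex le_rs.
have regr := column_regular r n1; have regrs := columns_regular rs.
have [|v [g [sh gr]]] := @columns_grounded rs.
  by apply: sub_all le_rs => s /leq_trans; apply.
have gc := column_grounded n1 le_r.
have j : 'I_n by apply: Ordinal n1.
have -> : @combinatorial_R n (column n r) (columns n rs) =1 R.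
  apply: (strict_combinatorial_R (v := _) (g := _) (sh := _) j _ _ _ _ RS).
  - exact: tensor_regular.
  - exact: tensor_regular.
  - exact: grounded_tensor gc gr.
  - exact: grounded_tensor gr gc.
apply/eqP/idP; first by move/HR.
by move/HR.
Qed.

End Columns.

(* One row of the lattice, with vertical dimers b below and b' above it and
   horizontal dimers H. *)
Definition step n (b H b' : bstring n) : bool :=
  [forall j, (H j ==> ~~ b (ordS j)) && (b' j + H j == b j + H (ord_pred j))].

Lemma stepP n (b H b' : bstring n) :
  reflect (forall j, (H j -> ~~ b (ordS j)) /\ b' j + H j = b j + H (ord_pred j))
          (step b H b').
Proof.
apply: (iffP forallP) => S j; have := S j.
  by case/andP => /implyP SH /eqP.
by case=> SH ->; rewrite eqxx andbT; apply/implyP.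
Qed.

Lemma step_fun n (b H b1 b2 : bstring n) : step b H b1 -> step b H b2 -> b1 = b2.
Proof.
move=> /stepP S1 /stepP S2; apply/ffunP => j.
have [_ E1] := S1 j; have [_ E2] := S2 j.
by have: b1 j = b2 j :> nat; [lia | case: (b1 j); case: (b2 j)].
Qed.

Lemma step_card n (b H b' : bstring n) : step b H b' ->
  #|[set p | b' p]| = #|[set p | b p]|.
Proof.
move=> /stepP S; rewrite !card_bits; apply/eqP.
rewrite -(eqn_add2r (\sum_p H p)) -big_split /=.
rewrite (eq_bigr (fun p => b p + H (ord_pred p))) => [|p _]; last by case: (S p).
by rewrite big_split /= (sum_ord_pred (fun p => H p : nat)).
Qed.

Fixpoint paths n (al : seq nat) (b b' : bstring n) : nat :=
  if al is a :: al' then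
    \sum_(H : bstring n | #|[set j | H j]| == a)
      \sum_(b1 : bstring n | step b H b1) paths al' b1 b'
  else b == b'.

(** * From hopping letters to rows of dimers *)

Section Flip.

Variable n : nat.
Implicit Types b c s : bstring n.

(* On strings, conjugation of partitions. *)
Definition flip b : bstring n := [ffun j => ~~ b (rev_ord j)].

(** Index j stands for the edge between j and j + 1, whose lower end after reversal is the image of
    j + 1. *)
Definition flip_edges s : bstring n := [ffun j => s (rev_ord (ordS j))].

Lemma rev_ordS (j : 'I_n) : rev_ord (ordS j) = ord_pred (rev_ord j).
Proof.
apply: ord_inj; change (n - (ordS j).+1 = (n - j.+1 + n).-1 %% n); rewrite val_ordS.
have lt_j := ltn_ord j; case: eqP => [E|ne].
  by rewrite (_ : n - j.+1 + n = n) ?modn_small; lia.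
rewrite (_ : (n - j.+1 + n).-1 = (n - j.+2) + n); last lia.
by rewrite modnDr modn_small; lia.
Qed.

Lemma flipK : involutive flip.
Proof. by move=> b; apply/ffunP => j; rewrite !ffunE rev_ordK negbK. Qed.

Lemma flip_edgesK : involutive flip_edges.
Proof. by move=> s; apply/ffunP => j; rewrite !ffunE rev_ordS rev_ordK ordSK. Qed.

Lemma card_flip_edges s : #|[set j | flip_edges s j]| = #|[set j | s j]|.
Proof.
rewrite !card_bits; have [f fK Kf] : bijective (fun j : 'I_n => rev_ord (ordS j)).
  by apply/injF_bij => i j /rev_ord_inj/ordS_inj.
rewrite [RHS](reindex (fun j => rev_ord (ordS j))); last first.
  by apply: onW_bij; exists f.
by apply: eq_bigr => j _; rewrite ffunE.
Qed.

(** Letters of c moving up are zeros of the complement moving up, and reversal makes them move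
    down. *)
Lemma hops_step c s c' : hops c s c' = step (flip c) (flip_edges s) (flip c').
Proof.
apply/hopsP/stepP => H j.
  have [Hs _] := H (rev_ord (ordS j)); have [_ E] := H (rev_ord j).
  rewrite !ffunE negbK ord_predK rev_ordS; rewrite rev_ordS in Hs.
  by split=> //; move: E; case: (c _); case: (c' _); case: (s _); case: (s _).
have [Hs _] := H (ord_pred (rev_ord j)); have [_ E] := H (rev_ord j).
rewrite !ffunE !ord_predK !rev_ordK in Hs; rewrite !ffunE !ord_predK rev_ordS !rev_ordK in E.
split=> [sj|]; first by have := Hs sj; rewrite negbK.
by move: E; case: (c _); case: (c' _); case: (s _); case: (s _).
Qed.

End Flip.

Lemma exists_unique_sum (T : finType) (P Q : pred T) :
  (forall x y, P x -> P y -> x = y) ->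
  [exists x, P x && Q x] = \sum_(x | P x) Q x :> nat.
Proof.
move=> P1; have [x0 Px0|P0] := pickP P; last first.
  by rewrite big_pred0 //; apply/eqP; rewrite eqb0; apply/existsPn => x; rewrite P0.
rewrite (big_pred1 x0) => [|x]; last first.
  by apply/idP/eqP => [Px|->//]; apply: P1.
congr nat_of_bool; apply/existsP/idP => [[x /andP[Px]]|Qx]; last first.
  by exists x0; rewrite Px0.
by rewrite (P1 _ _ Px Px0).
Qed.

Lemma big_column n r (F : bstring n -> nat) (P : pred (bstring n)) :
  \sum_(b : column n r | P (val b)) F (val b) =
  \sum_(b : bstring n | (#|[set j | b j]| == r) && P b) F b.
Proof.
by symmetry; apply: (big_sub_cond (fun b : bstring n => #|[set j | b j]| == r) P F).
Qed.

Lemma card_chain n r rs (c c' : column n r) :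
  #|[set b : columns n rs | chain c b c']| =
  paths rs (flip (val c)) (flip (val c')).
Proof.
elim: rs c => [|s rs IH] c.
  rewrite /= (inj_eq (can_inj (@flipK n))) (inj_eq val_inj).
  case: eqP => _.
    by rewrite (_ : [set _ | _] = setT) ?cardsT ?card_unit //; apply/setP => b; rewrite !inE.
  by rewrite (_ : [set _ | _] = set0) ?cards0 //; apply/setP => b; rewrite !inE.
rewrite -sum1dep_card big_mkcond /=.
pose f (b : column n s) (D : columns n rs) : nat :=
  [exists c1 : column n r, hops (val c) (val b) (val c1) && chain c1 D c'].
transitivity (\sum_(b : column n s) \sum_(D : columns n rs) f b D).
  rewrite (pair_bigA _ f) /=; apply: eq_bigr => -[b D] _.
  by rewrite /f /=; case: [exists c1, _].
pose g b := \sum_(c1 | hops (val c) b c1) paths rs (flip c1) (flip (val c')).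
transitivity (\sum_(b : column n s) g (val b)).
  apply: eq_bigr => b _; rewrite /f.
  rewrite (eq_bigr (fun D => \sum_(c1 : column n r | hops (val c) (val b) (val c1))
                               chain c1 D c')); last first.
    move=> D _; apply: exists_unique_sum => c1 c2 h1 h2.
    exact/val_inj/(hops_fun h1 h2).
  rewrite exchange_big /=.
  rewrite (eq_bigr (fun c1 => paths rs (flip (val c1)) (flip (val c')))); last first.
    move=> c1 _; rewrite -IH -sum1dep_card [RHS]big_mkcond.
    by apply: eq_bigr => D _; case: chain.
  rewrite (big_column r (fun c1 => paths rs (flip c1) (flip (val c')))
             (fun c1 => hops (val c) (val b) c1)).
  apply: eq_bigl => c1; case: (boolP (hops _ _ c1)) => [h|]; last by rewrite andbF.
  by rewrite (hops_card h) (valP c).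
rewrite (big_column s g xpredT) (reindex_inj (can_inj (@flip_edgesK n))) /=.
apply: eq_big => [H|H _]; first by rewrite andbT card_flip_edges.
rewrite /g (reindex_inj (can_inj (@flipK n))) /=.
by apply: eq_big => [b|b _]; rewrite ?hops_step ?flipK ?flip_edgesK.
Qed.

(** * Partitions and binary strings *)

Lemma pt_le k n (mu : part k n) i : pt mu i <= n - k.
Proof. by have := ltn_ord (val mu i); rewrite ltnS. Qed.

Lemma pt_anti k n (mu : part k n) (i j : 'I_k) : i <= j -> pt mu j <= pt mu i.
Proof. by move: (valP mu) => /forallP/(_ i)/forallP/(_ j)/implyP. Qed.

Section Positions.

Variables k n : nat.
Hypothesis hkn : k <= n.
Implicit Types mu nu : part k n.

Lemma pos_bound mu (i : 'I_k) : pt mu (rev_ord i) + i < n.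
Proof. by have := pt_le mu (rev_ord i); have := ltn_ord i; lia. Qed.

(* The position of the i-th one-letter. *)
Definition pos mu (i : 'I_k) : 'I_n := Ordinal (pos_bound mu i).

Lemma pos_incr mu (i j : 'I_k) : i < j -> pos mu i < pos mu j.
Proof.
move=> ltij; rewrite /=; have := @pt_anti _ _ mu (rev_ord j) (rev_ord i).
by rewrite /=; have := ltn_ord j; lia.
Qed.

Lemma pbitsP mu j : reflect (exists i, j = pos mu i) (pbits mu j).
Proof.
rewrite ffunE; apply: (iffP existsP) => -[i E]; exists i.
  by apply/ord_inj/eqP.
by rewrite E.
Qed.

Lemma sorted_positions (f : 'I_k -> 'I_n) :
  (forall i j : 'I_k, i < j -> f i < f j) ->
  sorted ltn [seq (f i : nat) | i <- enum 'I_k].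
Proof.
move=> f_incr; rewrite sorted_map sorted_pairwise; last first.
  by move=> x y z /=; apply: ltn_trans.
apply: sub_pairwise (_ : pairwise (relpre val ltn) (enum 'I_k)).
  by move=> x y /=; apply: f_incr.
rewrite -pairwise_map val_enum_ord -sorted_pairwise ?iota_ltn_sorted //.
exact: ltn_trans.
Qed.

Lemma incr_uniq (f g : 'I_k -> 'I_n) :
  (forall i j : 'I_k, i < j -> f i < f j) ->
  (forall i j : 'I_k, i < j -> g i < g j) ->
  (forall p, (exists i, p = f i) <-> (exists i, p = g i)) -> f =1 g.
Proof.
move=> f_incr g_incr fg i; apply: ord_inj.
have: [seq (f i : nat) | i <- enum 'I_k] = [seq (g i : nat) | i <- enum 'I_k].
  apply: (irr_sorted_eq ltn_trans ltnn); try exact: sorted_positions.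
  move=> p; apply/mapP/mapP => -[j _ ->].
    by have [j' ->] := (fg (f j)).1 (ex_intro _ j erefl); exists j'; rewrite ?mem_enum.
  by have [j' ->] := (fg (g j)).2 (ex_intro _ j erefl); exists j'; rewrite ?mem_enum.
by move/eq_in_map/(_ i); rewrite mem_enum => /(_ isT).
Qed.

Lemma pos_uniq mu (f : 'I_k -> 'I_n) :
  (forall i j : 'I_k, i < j -> f i < f j) ->
  (forall i, pbits mu (f i)) -> f =1 pos mu.
Proof.
move=> f_incr f_mu; apply: incr_uniq => // [i j|]; first exact: pos_incr.
have f_inj : injective f.
  move=> i j E; apply: val_inj; case: (ltngtP i j) => // /f_incr; by rewrite E ltnn.
have eq_im : f @: setT = [set j | pbits mu j].
  apply/eqP; rewrite eqEcard (eqP (card_pbits hkn mu)) card_imset // cardsT card_ord leqnn andbT.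
  by apply/subsetP => _ /imsetP[i _ ->]; rewrite inE.
move=> p; split=> [[i ->]|[i ->]]; first exact/pbitsP.
have : pos mu i \in f @: setT by rewrite eq_im inE; apply/pbitsP; exists i.
by case/imsetP => j _ ->; exists j.
Qed.

Lemma pbits_inj : injective (@pbits k n).
Proof.
move=> mu nu E; have posE : pos mu =1 pos nu.
  apply: pos_uniq => [i j|i]; first exact: pos_incr.
  by rewrite -E; apply/pbitsP; exists i.
apply/val_inj/ffunP => i; apply: ord_inj; rewrite -/(pt mu i) -/(pt nu i).
by have /(congr1 val) /= := posE (rev_ord i); rewrite rev_ordK => /addIn.
Qed.

Lemma sorted_ltn_gap (s : seq nat) i j : sorted ltn s -> i <= j < size s ->
  nth 0 s i + (j - i) <= nth 0 s j.
Proof.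
move=> s_sorted /andP[]; elim: j => [|j IH]; first by rewrite leqn0 => /eqP->; lia.
rewrite leq_eqVlt => /predU1P[->|le_ij] lt_j; first lia.
have := IH le_ij (ltnW lt_j).
have := sorted_ltn_nth ltn_trans 0 s_sorted j j.+1.
rewrite !inE lt_j (ltnW lt_j) ltnSn => /(_ isT isT isT); lia.
Qed.

Lemma pbits_surj (b : bstring n) : #|[set j | b j]| = k -> exists mu, pbits mu = b.
Proof.
move=> bk; pose s := [seq val j | j <- enum [set j | b j]].
have s_size : size s = k by rewrite size_map -cardE bk.
have s_sorted : sorted ltn s.
  rewrite /s; apply: (subseq_sorted ltn_trans (s2 := map val (enum 'I_n))).
    by apply: map_subseq; rewrite {1}enumT; apply: filter_subseq.
  by rewrite val_enum_ord iota_ltn_sorted.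
(* Subtracting its index from each position gives the parts; this gap yields both their monotonicity
   and the bound n - k. *)
have gap i j : i <= j < k -> nth 0 s i + (j - i) <= nth 0 s j.
  by rewrite -s_size; apply: sorted_ltn_gap.
have s_lt i : i < k -> nth 0 s i < n.
  rewrite -s_size => lt_i; have /mapP[j _ ->] := mem_nth 0 lt_i.
  exact: ltn_ord.
have s_ge i : i < k -> i <= nth 0 s i.
  by move=> lt_i; have := gap 0 i; rewrite lt_i subn0 => /(_ isT); lia.
have m_lt (i : 'I_k) : nth 0 s (rev_ord i) - rev_ord i < (n - k).+1.
  have := gap (rev_ord i) k.-1; have := s_lt k.-1; have := ltn_ord i; rewrite /=; lia.
have m_sorted : [forall i : 'I_k, forall j : 'I_k, (i <= j) ==>
    ([ffun i => Ordinal (m_lt i)] j <= [ffun i => Ordinal (m_lt i)] i)].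
  apply/forallP => i; apply/forallP => j; apply/implyP => le_ij; rewrite !ffunE /=.
  by have := gap (k - j.+1) (k - i.+1); have := ltn_ord j; have := s_ge (k - j.+1); lia.
pose mu : part k n := Sub [ffun i => Ordinal (m_lt i)] m_sorted.
have ptE i : pt mu (rev_ord i) + i = nth 0 s i.
  rewrite /pt /= ffunE /= (_ : k - (k - i.+1).+1 = i); last by have := ltn_ord i; lia.
  by rewrite subnK // s_ge.
exists mu; apply/ffunP => j; apply/pbitsP/idP => [[i Ej]|bj].
  have : nth 0 s i \in s by rewrite mem_nth ?s_size.
  case/mapP => j'; rewrite mem_enum inE => bj' Ei.
  by rewrite (_ : j = j') //; apply: ord_inj; rewrite Ej /= ptE.
have js : val j \in s by apply: map_f; rewrite mem_enum inE.
have lt_i : index (val j) s < k by rewrite -s_size index_mem.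
by exists (Ordinal lt_i); apply: ord_inj; rewrite /= ptE nth_index.
Qed.

(** Both strings have n - k letters, so it is enough that no letter of the conjugate lies opposite a
    letter of mu. *)
Lemma pbits_conj mu : pbits (conj_part hkn mu) = flip (pbits mu).
Proof.
set mu' := conj_part hkn mu.
have disj j : pbits mu' j -> ~~ pbits mu (rev_ord j).
  rewrite ffunE => /existsP[i' /eqP Ej]; apply/pbitsP => -[i /(congr1 val) /= Ei].
  have lt_i := ltn_ord i; have lt_i' := ltn_ord i'; have lt_j := ltn_ord j.
  have ptE : pt mu' (rev_ord i') = #|[set a | rev_ord i' < pt mu a]|.
    by rewrite /pt /= ffunE.
  (* Is the box in row [rev_ord i] and column [rev_ord i'] in the diagram? If so the two positions
     add up to at least n, otherwise to at most n - 2; opposite positions add up to n - 1. *)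
  have [lt_v|le_v] := ltnP (rev_ord i') (pt mu (rev_ord i)).
    have : (rev_ord i).+1 <= pt mu' (rev_ord i').
      rewrite ptE -[leqLHS](card_ord_lt (ltn_ord (rev_ord i))).
      apply/subset_leq_card/subsetP => a; rewrite !inE ltnS => le_a.
      exact: leq_trans lt_v (pt_anti _ le_a).
    by move: lt_v; rewrite /= in Ei Ej *; lia.
  have : pt mu' (rev_ord i') <= rev_ord i.
    rewrite ptE -[leqRHS](card_ord_lt (ltnW (ltn_ord (rev_ord i)))).
    apply/subset_leq_card/subsetP => a; rewrite !inE => lt_a.
    rewrite ltnNge; apply: contraL lt_a => /(pt_anti mu).
    by rewrite -leqNgt => /leq_trans; apply.
  by move: le_v; rewrite /= in Ei Ej *; lia.
have rev_bij : bijective (@rev_ord n) by exists (@rev_ord n); apply: rev_ordK.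
apply/ffunP => j; apply/eqP; rewrite -(inj_eq (_ : injective nat_of_bool)); last by case; case.
apply/eqP.
apply: (leq_sum_eq (F := fun j => pbits mu' j : nat) (F' := fun j => flip (pbits mu) j : nat)).
  by move=> p; rewrite [flip _ _]ffunE; have := disj p; case: (pbits mu' p) => // ->.
rewrite -(leq_add2r k) -(card_bits (pbits mu')).
rewrite (eqP (card_pbits (leq_subr k n) mu')) subnK //.
suff: \sum_j flip (pbits mu) j + \sum_j pbits mu j <= n.
  by rewrite -[X in _ + X]card_bits (eqP (card_pbits hkn mu)).
rewrite (reindex_inj rev_ord_inj) -big_split /= -[leqRHS]card_ord -sum1_card.
by apply: leq_sum => p _; rewrite ffunE rev_ordK; case: (pbits mu p).
Qed.

End Positions.

(** * Dimer configurations *)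

Section Dimers.

Variable n : nat.
Implicit Types (b H : bstring n) (w : seq (bstring n * bstring n)).

(* w lists the horizontal dimers of each row with the vertical dimers above it. *)
Fixpoint rows_ok (al : seq nat) b w b' : bool :=
  match al, w with
  | [::], [::] => b == b'
  | a :: al', (H, b1) :: w' =>
      [&& #|[set j | H j]| == a, step b H b1 & rows_ok al' b1 w' b']
  | _, _ => false
  end.

Definition row_bits b w t : bstring n := nth b (b :: unzip2 w) t.

Definition row_edges w t : bstring n := nth [ffun=> false] (unzip1 w) t.

Lemma rows_okP al b w b' : size w = size al ->
  reflect ((forall t, t < size al -> #|[set j | row_edges w t j]| = nth 0 al t /\
              step (row_bits b w t) (row_edges w t) (row_bits b w t.+1))
           /\ row_bits b w (size al) = b')
          (rows_ok al b w b').
Proof.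
elim: al b w => [|a al IH] b [|[H b1] w] //= => [_|[Ew]].
  by apply: (iffP eqP) => [->|[]].
have bitsE t : t <= size al -> row_bits b ((H, b1) :: w) t.+1 = row_bits b1 w t.
  by move=> le_t; rewrite /row_bits /= (set_nth_default b1) //= size_map Ew.
apply: (iffP and3P) => [[/eqP EH st /(IH _ _ Ew)[Hrow Hend]]|[Hrow Hend]].
  split; last by rewrite bitsE.
  case=> [_|t]; first by rewrite bitsE.
  by rewrite ltnS => lt_t; have := Hrow t lt_t; rewrite !bitsE // ltnW.
have [/= <- st] := Hrow 0 isT; rewrite bitsE // in st.
split=> //; apply/(IH _ _ Ew); split; last by rewrite -bitsE.
by move=> t lt_t; have := Hrow t.+1 lt_t; rewrite !bitsE // ltnW.
Qed.

Lemma big_tuple_cons (T : finType) m (F : seq T -> nat) :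
  \sum_(w : m.+1.-tuple T) F w = \sum_(x : T) \sum_(w : m.-tuple T) F (x :: w).
Proof.
rewrite pair_bigA /= (reindex (fun p : T * m.-tuple T => [tuple of p.1 :: p.2])) //.
exists (fun w : m.+1.-tuple T => (thead w, [tuple of behead w])).
  by move=> [x w] _ /=; congr pair; apply: val_inj.
by move=> w _; rewrite [RHS]tuple_eta; apply: val_inj.
Qed.

Lemma pathsE al b b' :
  paths al b b' = #|[set w : (size al).-tuple (bstring n * bstring n) | rows_ok al b w b']|.
Proof.
elim: al b => [|a al IH] b; rewrite -sum1dep_card big_mkcond /=.
  rewrite (eq_bigr (fun=> b == b' : nat)); last first.
    by move=> w _; rewrite tuple0 /=; case: eqP.
  by rewrite sum_nat_const card_tuple expn0 mul1n.
rewrite (big_tuple_cons _ (fun w => if rows_ok (a :: al) b w b' then 1 else 0)).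
pose f H b1 := \sum_(w : (size al).-tuple (bstring n * bstring n))
  (if rows_ok (a :: al) b ((H, b1) :: w) b' then 1 else 0).
transitivity (\sum_H \sum_b1 f H b1); last first.
  by rewrite (pair_bigA _ f) /=; apply: eq_bigr => -[H b1] _.
rewrite big_mkcond; apply: eq_bigr => H _; rewrite /f.
case: ifP => Ha; last by rewrite big1 // => b1 _; rewrite big1 // => w _ /=; rewrite Ha.
rewrite big_mkcond; apply: eq_bigr => b1 _; case: ifP => st; last first.
  by rewrite big1 // => w _ /=; rewrite Ha st.
by rewrite IH -sum1dep_card big_mkcond; apply: eq_bigr => w _ /=; rewrite Ha st.
Qed.

Variable k : nat.
Implicit Types (M : {set edge k n}) (mu nu : part k n).

Lemma card_set_seq (T : finType) (M : {set T}) (P : pred T) (s : seq T) :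
  uniq s -> P =i s -> #|[set e in M | P e]| = \sum_(e <- s) (e \in M).
Proof.
move=> s_uniq Ps; rewrite -sum1dep_card big_uniq //=.
rewrite (eq_bigl (fun e => (e \in s) && (e \in M))) => [|e]; last by rewrite -Ps andbC.
by rewrite big_mkcondr; apply: eq_bigr => e _; case: ifP.
Qed.

Lemma card_at_D M (t : 'I_k) (j : 'I_n) :
  #|[set e in M | at_D t j e]| =
  (EdgeDU t j \in M) + ((EdgeH t (ord_pred j) \in M) + (EdgeV (widen_ord (leqnSn k) t) j \in M)).
Proof.
rewrite (@card_set_seq _ _ _
  [:: EdgeDU t j; EdgeH t (ord_pred j); EdgeV (widen_ord (leqnSn k) t) j]).
- by rewrite !big_cons big_nil addn0.
- by [].
case=> [s i|s i|s i]; rewrite !inE -topredE /=.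
- by apply/andP/orP => [[/eqP-> /eqP->]|[/eqP[-> ->]|/eqP]] //; left.
- apply/andP/orP => [[/eqP-> /eqP<-]|[/eqP[-> ->]|/eqP]] //.
    by left; rewrite ordSK.
  by rewrite ord_predK.
apply/andP/eqP => [[/eqP Es /eqP->]|[-> ->]] //.
by congr EdgeV; apply: ord_inj.
Qed.

Lemma card_at_U M (t : 'I_k) (j : 'I_n) :
  #|[set e in M | at_U t j e]| =
  (EdgeDU t j \in M) + ((EdgeH t j \in M) + (EdgeV (lift ord0 t) j \in M)).
Proof.
rewrite (@card_set_seq _ _ _ [:: EdgeDU t j; EdgeH t j; EdgeV (lift ord0 t) j]).
- by rewrite !big_cons big_nil addn0.
- by [].
case=> [s i|s i|s i]; rewrite !inE -topredE /=.
- by apply/andP/orP => [[/eqP-> /eqP->]|[/eqP[-> ->]|/eqP]] //; left.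
- by apply/andP/orP => [[/eqP-> /eqP->]|[/eqP[-> ->]|/eqP]] //; left.
apply/andP/eqP => [[/eqP Es /eqP->]|[-> ->]] //.
by congr EdgeV; apply: ord_inj.
Qed.

Definition bits_of M (s : 'I_k.+1) : bstring n := [ffun j => EdgeV s j \in M].
Definition edges_of M (t : 'I_k) : bstring n := [ffun j => EdgeH t j \in M].

(** Every vertex has three edges, so the edge from D to U is determined by the other two at D.
    Eliminating it between D_j and U_j gives the equation of [step], and the vertex D_{j+1} gives
    its side condition. *)
Lemma perfect_matchingP M :
  reflect (forall t, step (bits_of M (widen_ord (leqnSn k) t)) (edges_of M t)
                          (bits_of M (lift ord0 t)) /\
                     forall j, (EdgeDU t j \in M) =
                        ~~ (bits_of M (widen_ord (leqnSn k) t) j || edges_of M t (ord_pred j)))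
          (perfect_matching M).
Proof.
apply: (iffP forallP) => PM t.
  have {}PM j : (EdgeDU t j \in M) + ((EdgeH t (ord_pred j) \in M) +
        (EdgeV (widen_ord (leqnSn k) t) j \in M)) = 1 /\
      (EdgeDU t j \in M) + ((EdgeH t j \in M) + (EdgeV (lift ord0 t) j \in M)) = 1.
    by have /forallP/(_ j)/andP[] := PM t; rewrite card_at_D card_at_U => /eqP ? /eqP.
  split=> [|j]; last first.
    rewrite !ffunE; have [+ _] := PM j.
    by case: (EdgeDU t j \in M); case: (EdgeH _ _ \in M); case: (EdgeV _ _ \in M).
  apply/stepP => j; rewrite !ffunE; have [E1 E2] := PM j; have [E3 _] := PM (ordS j).
  rewrite ordSK in E3; split; last first.
    by apply: (@addnI (EdgeDU t j \in M)); rewrite [_ + (_ \in M)]addnC E2 [_ + (_ \in M)]addnC E1.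
  by move: E3; case: (EdgeH _ _ \in M); case: (EdgeV _ _ \in M); case: (_ \in M).
have [/stepP st DU] := PM t; apply/forallP => j; rewrite card_at_D card_at_U DU !ffunE.
have [_] := st j; have [] := st (ord_pred j); rewrite !ffunE ord_predK.
case: (EdgeH t (ord_pred j) \in M); case: (EdgeH t j \in M);
case: (EdgeV (lift ord0 t) j \in M); case: (EdgeV (widen_ord _ _) j \in M) => //=.
all: by move=> /(_ isT).
Qed.

Definition matching_of b w : {set edge k n} :=
  [set e : edge k n | match e with
            | EdgeDU t j => ~~ (row_bits b w t j || row_edges w t (ord_pred j))
            | EdgeH t j => row_edges w t j
            | EdgeV s j => row_bits b w s j
            end].

End Dimers.

(** * Dimer configurations as paths of strings *)

Section GammaRow.

Variables k n : nat.
Implicit Types (M : {set edge k n}) (mu nu : part k n) (b : bstring n).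
Implicit Types w : seq (bstring n * bstring n).

Lemma bits_of_matching b w s : bits_of (matching_of k b w) s = row_bits b w s.
Proof. by apply/ffunP => j; rewrite ffunE inE. Qed.

Lemma edges_of_matching b w t : edges_of (matching_of k b w) t = row_edges w t.
Proof. by apply/ffunP => j; rewrite ffunE inE. Qed.

Lemma matching_of_inj b (w w' : seq (bstring n * bstring n)) :
  size w = k -> size w' = k -> matching_of k b w = matching_of k b w' -> w = w'.
Proof.
move=> Ew Ew' EM; apply: (@eq_from_nth _ ([ffun=> false], b)); first by rewrite Ew'.
move=> t; rewrite Ew => lt_t.
have nthE (v : seq (bstring n * bstring n)) : size v = k ->
    nth ([ffun=> false], b) v t = (row_edges v t, row_bits b v t.+1).
  move=> Ev; rewrite /row_edges /row_bits /= !(nth_map ([ffun=> false], b)) ?Ev //.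
  by case: nth.
rewrite !nthE // -(edges_of_matching b w (Ordinal lt_t)) EM edges_of_matching.
have := bits_of_matching b w (lift ord0 (Ordinal lt_t)).
by rewrite EM bits_of_matching /= /bump leq0n => <-.
Qed.

Lemma matching_rows M b : bits_of M ord0 = b ->
  let w := [seq (edges_of M t, bits_of M (lift ord0 t)) | t : 'I_k] in
  (forall t : 'I_k, row_edges w t = edges_of M t) /\
  (forall s : 'I_k.+1, row_bits b w s = bits_of M s).
Proof.
move=> M0 w; have nthE (t : 'I_k) : nth ([ffun=> false], b) w t =
    (edges_of M t, bits_of M (lift ord0 t)).
  by rewrite (nth_map t) ?size_enum_ord // nth_ord_enum.
have Ew : size w = k by rewrite size_map size_enum_ord.
split=> [t|s].
  by rewrite /row_edges (nth_map ([ffun=> false], b)) ?Ew // nthE.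
rewrite /row_bits; case: (unliftP ord0 s) => [t ->|->] //=.
rewrite add0n (nth_map ([ffun=> false], b)) ?Ew; last exact: (ltn_ord t).
by rewrite nthE.
Qed.

Lemma card_Gamma_row (al : 'I_k -> nat) mu nu :
  #|Gamma_row al mu nu| = paths [seq al i | i : 'I_k] (pbits mu) (pbits nu).
Proof.
rewrite pathsE; set s := image _ _; set b := pbits mu.
have sk : size s = k by rewrite size_map size_enum_ord.
have nth_s (t : 'I_k) : nth 0 s t = al t.
  by rewrite (nth_map t) ?size_enum_ord // nth_ord_enum.
rewrite -(card_in_imset (f := fun w : (size s).-tuple _ => matching_of k b w)); last first.
  by move=> w w' _ _ /matching_of_inj E; apply/val_inj/E; rewrite size_tuple.
apply: eq_card => M; apply/idP/imsetP => [|[w]].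
  rewrite !inE => /andP[/and3P[/perfect_matchingP PM /forallP Hmu /forallP Hnu] /forallP Hal].
  have M0 : bits_of M ord0 = b by apply/ffunP => j; rewrite ffunE; apply/eqP.
  have [edgesE bitsE] := matching_rows M0; set w := image _ _ in edgesE bitsE.
  have Ew : size w == size s by rewrite !size_map.
  exists (Tuple Ew); rewrite ?inE /=.
    apply/rows_okP; first exact/eqP.
    split=> [t lt_t|]; last first.
      by rewrite sk -[k]/(val (@ord_max k)) bitsE; apply/ffunP => j; rewrite ffunE; apply/eqP.
    have lt_tk : t < k by rewrite -sk.
    have [PMt _] := PM (Ordinal lt_tk).
    have e1 : row_edges w t = _ := edgesE (Ordinal lt_tk).
    have e2 : row_bits b w t = _ := bitsE (widen_ord (leqnSn k) (Ordinal lt_tk)).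
    have e3 : row_bits b w t.+1 = _ := bitsE (lift ord0 (Ordinal lt_tk)).
    have e4 : nth 0 s t = _ := nth_s (Ordinal lt_tk).
    rewrite e1 e2 e3 e4; split=> //.
    by rewrite -(eqP (Hal _)); apply: eq_card => j; rewrite !inE ffunE.
  apply/setP => -[t j|t j|t j]; rewrite !inE.
  - have [_ ->] := PM t; rewrite -bitsE -edgesE //.
  - by rewrite edgesE ffunE.
  - by rewrite bitsE ffunE.
rewrite inE => /rows_okP; rewrite size_tuple => /(_ erefl) [Hrow Hend] ->.
rewrite !inE; apply/andP; split; last first.
  apply/forallP => t; rewrite -nth_s; have [|<- _] := Hrow t; first by rewrite sk.
  by apply/eqP/eq_card => j; rewrite !inE.
apply/and3P; split.
- apply/perfect_matchingP => t; rewrite !bits_of_matching edges_of_matching.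
  split=> [|j]; last by rewrite inE.
  by have [|_] := Hrow t; first by rewrite sk.
- by apply/forallP => j; rewrite inE.
- by apply/forallP => j; rewrite inE /= -[X in row_bits _ _ X]sk Hend.
Qed.

End GammaRow.

(** * Determinants *)

Section LinearAlgebra.

Import GRing.Theory.
Local Open Scope ring_scope.

Variable A : comNzRingType.

Definition companion n (c : 'I_n -> A) : 'M[A]_n :=
  \matrix_(i, j) if j == 0%N :> nat then c i else (i.+1 == j)%:R.

(* The row vector (1, t, t^2, ...) is sent by 1 - t C to a multiple of the
   first basis vector; multiply by the adjugate. *)
Lemma det_companion n (c : 'I_n -> A) (t : A) :
  \det (1%:M - t *: companion c) = 1 - \sum_l c l * t ^+ l.+1.
Proof.
case: n c => [|n] c; first by rewrite det_mx00 big_ord0 subr0.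
set M := 1%:M - _; pose w : 'rV[A]_n.+1 := \row_j t ^+ j.
have wM : w *m M = (1 - \sum_l c l * t ^+ l.+1) *: delta_mx 0 0.
  apply/rowP => j; rewrite mulmxBr mulmx1 -scalemxAr !mxE eqxx /=.
  case: (unliftP ord0 j) => [j' ->|->]; last first.
    rewrite expr0 mulr1 mulr_sumr; congr (_ - _); apply: eq_bigr => l _.
    by rewrite !mxE /= exprS; ring.
  rewrite mulr0 (bigD1 (widen_ord (leqnSn n) j')) //= !mxE /= /bump leq0n add1n eqxx mulr1.
  rewrite big1 ?addr0 -?exprS ?subrr // => l ne_l; rewrite !mxE /=.
  rewrite /bump leq0n add1n eqSS; case: eqP => [E|]; last by rewrite mulr0.
  by case/eqP: ne_l; apply: ord_inj.
have cof : (\adj M) 0 0 = 1.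
  rewrite !mxE /cofactor /= expr0 mul1r -det_tr det_trig; last first.
    apply/is_trig_mxP => i j lt_ij; rewrite !mxE /= /bump !leq0n !add1n eqSS.
    have -> : (lift ord0 j == lift ord0 i) = false.
      by rewrite (inj_eq lift_inj) -val_eqE /=; lia.
    by rewrite (_ : (j.+1 == i) = false) ?mulr0 ?subr0 //; lia.
  rewrite big1 // => i _; rewrite !mxE /= eqxx /bump !leq0n !add1n eqSS.
  by rewrite (_ : (i.+1 == i) = false) ?mulr0 ?subr0 //; lia.
have := congr1 (mulmxr (\adj M)) wM; rewrite /= -mulmxA mul_mx_adj.
rewrite mul_mx_scalar => /rowP/(_ 0).
rewrite -scalemxAl -rowE !mxE expr0 mulr1 => ->; rewrite -/(cofactor M 0 0).
by move: cof; rewrite mxE => ->; rewrite mulr1.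
Qed.

Lemma det_row_sum n (F : 'I_n -> bool -> 'I_n -> A) :
  \det (\matrix_(i, j) (F i false j + F i true j)) =
  \sum_(f : {ffun 'I_n -> bool}) \det (\matrix_(i, j) F i (f i) j).
Proof.
rewrite /determinant exchange_big /=; apply: eq_bigr => s _.
rewrite -mulr_sumr; congr (_ * _).
transitivity (\prod_i \sum_b F i b (s i)).
  by apply: eq_bigr => i _; rewrite mxE big_bool /= addrC.
rewrite bigA_distr_bigA; apply: eq_bigr => f _.
by apply: eq_bigr => i _; rewrite mxE.
Qed.

Lemma det_row_scale n (a : 'I_n -> A) (M : 'M[A]_n) :
  \det (\matrix_(i, j) (a i * M i j)) = (\prod_i a i) * \det M.
Proof.
rewrite -[X in _ = X * _]mulr1 /determinant mulr1 mulr_sumr; apply: eq_bigr => s _.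
rewrite mulrCA -big_split /=; congr (_ * _).
by apply: eq_bigr => i _; rewrite mxE.
Qed.

Definition unit_rows m n (z : 'I_m -> 'I_n) : 'M[A]_(m, n) :=
  \matrix_(i, j) (z i == j)%:R.

(** Pairs that violate decreasing order: zeros are enumerated downwards, so this vanishes before any
    of them hops. *)
Definition rev_inversions m n (z : 'I_m -> 'I_n) : nat :=
  (\sum_(j < m) \sum_(i < m | i < j) (z i < z j))%N.

(** Expand along the first row. Deleting column z_0 renumbers the later z_i that lie beyond it, and
    [rev_inversions] counts these corrections. *)
Lemma det_unit_rows m k (z : 'I_m -> 'I_(m + k)) (o : 'I_k -> 'I_(m + k))
    (Y : 'M[A]_(k, m + k)) :
  injective z -> (forall i j : 'I_k, (i < j)%N -> (o i < o j)%N) ->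
  (forall i j, z i != o j) ->
  \det (col_mx (unit_rows z) Y) =
  (-1) ^+ (\sum_j z j + rev_inversions z)%N * \det (\matrix_(i, j) Y i (o j)).
Proof.
elim: m z o Y => [|m IH] z o Y z_inj o_incr zo.
  rewrite /rev_inversions !big_ord0 mul1r; congr (\det _); apply/matrixP => i j.
  have o_id : o =1 id.
    apply: (@incr_uniq k k) => // p; split=> [_|_]; first by exists p.
    have o_inj : injective o.
      by move=> a b E; apply: val_inj; case: (ltngtP a b) => // /o_incr; rewrite E ltnn.
    by exists (invF o_inj p); rewrite f_invF.
  by rewrite [RHS]mxE o_id mxE; case: splitP => [[]//|i' Ei]; congr (Y _ _); apply: ord_inj.
set z0 := z ord0.
have z'P i : {j | z (lift ord0 i) = lift z0 j}.
  by case: (unliftP z0 (z (lift ord0 i))) => [j ->|/z_inj]; [exists j|].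
have o'P i : {j | o i = lift z0 j}.
  case: (unliftP z0 (o i)) => [j ->|E]; first by exists j.
  by have := zo ord0 i; rewrite E eqxx.
pose z' i := sval (z'P i); pose o' i := sval (o'P i).
have zE i : z (lift ord0 i) = lift z0 (z' i) := svalP (z'P i).
have oE i : o i = lift z0 (o' i) := svalP (o'P i).
have lift_lt (i j : 'I_(m + k)) : (lift z0 i < lift z0 j)%N = (i < j)%N.
  by rewrite /= !ltnNge leq_bump2.
rewrite (expand_det_row _ (ord0 : 'I_(m.+1 + k))) (bigD1 z0) //= big1 => [|j ne_j]; last first.
  rewrite (_ : col_mx _ _ _ _ = 0) ?mul0r //.
  rewrite (_ : ord0 = lshift k ord0); last exact: val_inj.
  by rewrite col_mxEu mxE eq_sym (negbTE ne_j).
rewrite (_ : col_mx _ _ _ _ = 1); last first.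
  rewrite (_ : ord0 = lshift k ord0); last exact: val_inj.
  by rewrite col_mxEu mxE eqxx.
rewrite addr0 mul1r /cofactor add0n.
have -> : row' (ord0 : 'I_(m.+1 + k)) (col' z0 (col_mx (unit_rows z) Y)) =
          col_mx (unit_rows z') (col' z0 Y) :> 'M_(m + k).
  apply/matrixP => i j; rewrite !mxE; case: (splitP i) => [i' Ei|i' Ei].
    rewrite (_ : lift _ _ = lshift k (lift ord0 i')); last first.
      by apply: val_inj; rewrite /= Ei.
    by rewrite (unsplitK (inl _)) !mxE zE (inj_eq lift_inj).
  rewrite (_ : lift _ _ = rshift m.+1 i'); last by apply: val_inj; rewrite /= Ei.
  by rewrite (unsplitK (inr _)) !mxE.
rewrite (IH _ o').
- rewrite mulrA -exprD; congr (_ * _); last first.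
    by congr (\det _); apply/matrixP => i j; rewrite !mxE oE.
  pose B := (\sum_(i < m) (z0 < z (lift ord0 i)))%N.
  have E1 : (\sum_(i < m) z (lift ord0 i) = \sum_(i < m) z' i + B)%N.
    rewrite -big_split /=; apply: eq_bigr => i _; rewrite zE /= /bump.
    case: (leqP z0 (z' i)) => h; first by rewrite add1n ltnS h addn1.
    by rewrite add0n ltnNge (ltnW h) addn0.
  have E2 : (rev_inversions z = B + rev_inversions z')%N.
    rewrite /rev_inversions big_ord_recl big_pred0 // add0n -big_split /=.
    apply: eq_bigr => j _; rewrite big_mkcond big_ord_recl /=; congr addn.
    rewrite [RHS]big_mkcond; apply: eq_bigr => i _.
    by rewrite !zE lift_lt /= /bump !leq0n !add1n ltnS.
  rewrite big_ord_recl E1 E2 -signr_odd -[RHS]signr_odd -/z0.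
  congr (_ ^+ nat_of_bool _).
  by rewrite !oddD; case: (odd z0); case: (odd B); case: (odd _); case: (odd _).
- by move=> i j E; apply: (@lift_inj _ ord0); apply: z_inj; rewrite !zE E.
- by move=> i j lt_ij; rewrite -lift_lt -!oE o_incr.
- by move=> i j; rewrite -(inj_eq (@lift_inj _ z0)) -zE -oE.
Qed.

End LinearAlgebra.

(** * The quantum Pieri rule *)

Lemma val_ord_pred n (i : 'I_n) : ord_pred i = (if i == 0 :> nat then n.-1 else i.-1) :> nat.
Proof.
have lt_i := ltn_ord i; change ((i + n).-1 %% n = (if i == 0 :> nat then n.-1 else i.-1)).
case: eqP => [->|ne]; first by rewrite add0n modn_small; lia.
by rewrite (_ : (i + n).-1 = i.-1 + n) ?modnDr ?modn_small; lia.
Qed.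

Section Hopping.

Variables m k : nat.
Local Notation n := (m + k).
Variables (b H : bstring n) (z : 'I_m -> 'I_n).
Hypothesis z_desc : forall i j : 'I_m, i < j -> z j < z i.
Hypothesis z_zeros : forall p, reflect (exists j, p = z j) (~~ b p).
Hypothesis H_supp : forall p, H p -> ~~ b (ordS p).

Definition hopped (j : 'I_m) : 'I_n :=
  if H (ord_pred (z j)) then ord_pred (z j) else z j.

Lemma desc_inj : injective z.
Proof.
by move=> i j E; apply: val_inj; case: (ltngtP i j) => // /z_desc; rewrite E ltnn.
Qed.

Lemma bz j : b (z j) = false.
Proof. by apply/negbTE/z_zeros; exists j. Qed.

Lemma hopped_out b' j : step b H b' -> b' (hopped j) = false.
Proof.
move/stepP => st; rewrite /hopped; case: ifP => Hj.
  have [_] := st (ord_pred (z j)); rewrite Hj.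
  have := @H_supp (ord_pred (ord_pred (z j))); rewrite ord_predK.
  by case: (b' _); case: (b _); case: (H _) => // /(_ isT).
have [_] := st (z j); rewrite Hj bz; by case: (b' _); case: (H _).
Qed.

Lemma hopped_inj b' : step b H b' -> injective hopped.
Proof.
move/stepP => st; have clash i j : H (ord_pred (z i)) -> H (ord_pred (z j)) = false ->
    ord_pred (z i) <> z j.
  move=> Hi Hj E; have [_] := st (z j); rewrite -E in Hj *.
  by rewrite Hj E bz -E Hi; case: (b' _).
move=> i j; rewrite /hopped; case: ifP => Hi; case: ifP => Hj.
- by move/ord_pred_inj/desc_inj.
- by move/clash => /(_ Hi Hj).
- by move/esym/clash => /(_ Hj Hi).
- exact: desc_inj.
Qed.

(** The equation of [step] can only fail when a zero at p stays while the zero at p + 1 hops onto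
    it. *)
Lemma hopped_clash : (forall b', ~~ step b H b') ->
  exists i j, i != j /\ hopped i = hopped j.
Proof.
move=> no_step.
have [/forallP ok|/forallPn[p]] :=
    boolP [forall p, H p <= b p + H (ord_pred p)].
  pose b' : bstring n := [ffun p => b p + H (ord_pred p) - H p == 1].
  case/negP: (no_step b'); apply/stepP => p; split; first exact: H_supp.
  have := @H_supp (ord_pred p); rewrite ord_predK ffunE; have := ok p.
  by case: (b p); case: (H (ord_pred p)); case: (H p) => //= _ /(_ isT).
rewrite -ltnNge => lt_p.
have [Hp bp Hpp] : [/\ H p, ~~ b p & H (ord_pred p) = false].
  by move: lt_p; case: (H p); case: (b p); case: (H _).
have /z_zeros[i Ei] := bp; have /z_zeros[j Ej] := H_supp Hp.
exists i, j; rewrite /hopped -Ei -Ej ordSK Hp Hpp; split=> //.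
by apply/eqP => ij; rewrite ij -Ej in Ei; move: Hpp; rewrite Ei ordSK Hp.
Qed.

Lemma card_hops : \sum_p H p = \sum_(j < m) H (ord_pred (z j)).
Proof.
rewrite (reindex_inj (@ord_pred_inj n)) /= (bigID (fun p => ~~ b p)) /=.
rewrite [X in _ + X]big1 ?addn0 => [|p]; last first.
  by rewrite negbK => bp; case E: (H _) => //; have := H_supp E; rewrite ord_predK bp.
rewrite -(big_imset (fun p => H (ord_pred p) : nat) (in2W desc_inj)) /=.
apply: eq_bigl => p; apply/z_zeros/imsetP => [[j ->]|[j _ ->]]; first by exists j.
by exists j.
Qed.

Lemma last_zero_ord (j : 'I_m) : z j = 0 :> nat -> j = m.-1 :> nat.
Proof.
move=> zj; have lt_j := ltn_ord j; apply/eqP; rewrite eqn_leq; apply/andP; split; first lia.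
rewrite leqNgt; apply/negP => lt_j'.
have lt_m : m.-1 < m by lia.
by have := z_desc (i := j) (j := Ordinal lt_m) lt_j'; rewrite zj.
Qed.

Lemma pred_zero (p0 : 'I_n) j : p0 = n.-1 :> nat -> z j = 0 :> nat ->
  ord_pred (z j) = p0.
Proof. by move=> p0E zj; apply: ord_inj; rewrite val_ord_pred zj eqxx p0E. Qed.

(** Edge n - 1 closes the circle: it is used exactly when a zero at position 0 hops to n - 1. *)
Lemma sum_wrap (p0 : 'I_n) : p0 = n.-1 :> nat ->
  \sum_(j < m) ((z j == 0 :> nat) && H p0) = H p0.
Proof.
move=> p0E; case E: (H p0); last by rewrite big1 // => j _; rewrite andbF.
have /z_zeros[j Ej] := H_supp E.
have zj : z j = 0 :> nat by rewrite -Ej val_ordS p0E; case: eqP => //; have := ltn_ord p0; lia.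
rewrite (bigD1 j) //= zj big1 // => i ne_i; case: eqP => // zi.
by case/eqP: ne_i; apply: desc_inj; apply: ord_inj; rewrite zi zj.
Qed.

(** An ordinary hop lowers the sum of positions by one, which the number of hops compensates. The
    wrapping zero gains n on top of that and, being last in the enumeration, ends up above the m - 1
    others. *)
Lemma odd_hopped b' (p0 : 'I_n) : step b H b' -> p0 = n.-1 :> nat ->
  odd (\sum_j hopped j + rev_inversions hopped + \sum_p H p) =
  odd (\sum_j z j) (+) (H p0 && odd (n + m.-1)).
Proof.
move=> st p0E; have h_inj := hopped_inj st; have wrapE := sum_wrap p0E.
have p0P j := pred_zero (j := j) p0E.
have hopE j : hopped j + H (ord_pred (z j)) = z j + ((z j == 0 :> nat) && H p0) * n.
  rewrite /hopped; have := ltn_ord (z j); case: (eqVneq (z j : nat) 0) => [zj|nz].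
    by rewrite (p0P _ zj) zj; case: (H p0) => /=; rewrite ?p0E; lia.
  by case: (H _); rewrite ?val_ord_pred ?(negbTE nz) /=; lia.
have sumE : \sum_j hopped j + \sum_p H p = \sum_j z j + H p0 * n.
  rewrite card_hops -big_split /= (eq_bigr _ (fun j _ => hopE j)) big_split /=.
  by rewrite -big_distrl /= wrapE.
have invE : rev_inversions hopped = H p0 * m.-1.
  rewrite /rev_inversions.
  have invij (i j : 'I_m) : i < j -> (hopped i < hopped j) = (z j == 0 :> nat) && H p0.
    move=> lt_ij; have lt_z := z_desc lt_ij.
    have ne_h : hopped i != hopped j.
      by apply/eqP => /h_inj E; rewrite E ltnn in lt_ij.
    have {}ne_h : hopped i <> hopped j :> nat by move=> /ord_inj; apply/eqP.
    have := hopE i; have := hopE j; have := ltn_ord (hopped i).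
    case: (eqVneq (z i : nat) 0) => [zi|nzi]; first lia.
    case: (eqVneq (z j : nat) 0) => [zj|nzj] /=; last first.
      by case: (H _); case: (H _); lia.
    rewrite (p0P _ zj); case: (H p0) => /=; case: (H _) => /=; lia.
  rewrite (eq_bigr (fun j : 'I_m => ((z j == 0 :> nat) && H p0) * m.-1)).
    by rewrite -big_distrl /= wrapE.
  move=> j _; rewrite (eq_bigr (fun=> (z j == 0 :> nat) && H p0 : nat)); last first.
    by move=> i lt_ij; rewrite invij.
  rewrite sum_nat_cond_const (card_ord_lt (ltnW (ltn_ord j))).
  by case: eqP => [/last_zero_ord->|]; rewrite ?muln0 //= mulnC.
rewrite -addnA [X in odd (_ + X)]addnC addnA sumE invE.
rewrite !oddD !oddM; case: (H p0) => /=; rewrite ?addbF //.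
by rewrite oddD -!addbA.
Qed.

End Hopping.

Lemma zeros_enum m k (mu : part k (m + k)) :
  exists z : 'I_m -> 'I_(m + k), (forall i j : 'I_m, i < j -> z j < z i) /\
    forall p, ~~ pbits mu p <-> exists j, p = z j.
Proof.
have hk := leq_addl m k; have hm := leq_addr k m.
have [|mu' Emu'] := @pbits_surj m (m + k) hm (flip (pbits mu)).
  by rewrite -(pbits_conj hk) (eqP (card_pbits (leq_subr k _) _)) addnK.
exists (fun j => rev_ord (pos hm mu' j)); split=> [i j /(pos_incr hm mu')|p].
  by have := ltn_ord (pos hm mu' j); rewrite /=; lia.
have -> : ~~ pbits mu p = pbits mu' (rev_ord p) by rewrite Emu' [flip _ _]ffunE rev_ordK.
split=> [/(pbitsP hm)[j E]|[j E]].
  by exists j; rewrite -E rev_ordK.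
by apply/(pbitsP hm); exists j; rewrite E rev_ordK.
Qed.

Section Pieri.

Import GRing.Theory.
Local Open Scope ring_scope.

Variables (A : comNzRingType) (m k : nat) (h e : nat -> A) (t q : A).
Local Notation n := (m + k)%N.

Definition hdiff (i a : nat) : A := if (a <= i)%N then h (i - a) else 0.

Definition hdet (o : 'I_k -> 'I_n) : A := \det (\matrix_(i, j) hdiff (o j) i).

Hypothesis k_gt0 : (0 < k)%N.
Hypothesis h_rec : forall i, h i.+1 = \sum_(l < k) (-1) ^+ l * e l.+1 * hdiff i l.
Hypothesis h_van : forall s, (m < s < m + k)%N -> h s = 0.
Let w : A := (-1) ^+ k.+1 * q.
Hypothesis h_n : h n = w * h 0.

(** [companion c] shifts the index of h in the k columns, and [companion cP], the twisted cyclic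
    shift, does so in the n positions; [wgt] is the factor a zero picks up when it wraps. *)
Let c (l : 'I_k) : A := (-1) ^+ l * e l.+1.
Let cP (l : 'I_n) : A := if l.+1 == n then w else 0.
Let Y : 'M[A]_(k, n) := \matrix_(a, i) hdiff i a.
Let wgt (p : 'I_n) : A := if p == 0%N :> nat then w else 1.

Lemma hdiff_companion i (a : 'I_k) :
  \sum_(l < k) hdiff i l * companion c l a = hdiff i.+1 a.
Proof.
have [a0|a_gt0] := posnP a.
  rewrite {2}/hdiff a0 subn0 h_rec; apply: eq_bigr => l _.
  by rewrite mxE a0 eqxx mulrC.
have lt_a : (a.-1 < k)%N by have := ltn_ord a; lia.
rewrite (bigD1 (Ordinal lt_a)) //= big1 ?addr0 => [|l ne_l]; last first.
  rewrite mxE; case: eqP => [|_]; first lia.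
  case: eqP => [E|]; last by rewrite mulr0.
  by case/eqP: ne_l; apply: ord_inj; rewrite /= -E.
rewrite mxE /= prednK // eqxx; case: eqP => [|_]; first lia.
rewrite mulr1 /hdiff (_ : (a <= i.+1)%N = (a.-1 <= i)%N); last lia.
by rewrite (_ : (i.+1 - a = i - a.-1)%N) //; lia.
Qed.

(** All relations of the ring enter at i = n - 1: h_n = w h_0 for a = 0, and h_{n-a} = 0 for 0 < a <
    k. *)
Lemma hdiff_shift (i : 'I_n) (a : 'I_k) :
  \sum_(p < n) hdiff p a * companion cP i p = hdiff i.+1 a.
Proof.
have n_gt0 : (0 < n)%N by have := ltn_ord i; lia.
rewrite (bigD1 (Ordinal n_gt0)) //= mxE /= /cP.
have [E|ne] := eqVneq i.+1 n.
  rewrite big1 ?addr0 => [|p ne_p]; last first.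
    rewrite mxE; case: eqP => [p0|_]; first by case/eqP: ne_p; apply: ord_inj.
    by case: eqP => [Ep|]; [have := ltn_ord p; lia | rewrite mulr0].
  rewrite E /hdiff leqn0; case: eqP => [->|a0]; first by rewrite leq0n !subn0 h_n mulrC.
  by rewrite mul0r h_van ?if_same //; have := ltn_ord a; lia.
have lt_i : (i.+1 < n)%N by have := ltn_ord i; lia.
rewrite mulr0 add0r (bigD1 (Ordinal lt_i)) //= big1 ?addr0 => [|p /andP[p0 ne_p]]; last first.
  rewrite mxE; case: eqP => [p0'|_]; first by case/eqP: p0; apply: ord_inj.
  by case: eqP => [Ep|]; [case/eqP: ne_p; apply: ord_inj | rewrite mulr0].
by rewrite mxE /= eqxx mulr1.
Qed.

Section Rows.

Variable z : 'I_m -> 'I_n.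

Let U' : 'M[A]_(m, n) :=
  \matrix_(i, j) ((z i == j)%:R - t * wgt (z i) * (ord_pred (z i) == j)%:R).

Lemma shift_rows :
  col_mx (unit_rows A z) Y *m (1%:M - t *: companion cP)^T =
  block_mx 1%:M 0 0 (1%:M - t *: companion c)^T *m col_mx U' Y.
Proof.
rewrite mul_block_col mul_col_mx !mul1mx !mul0mx addr0 add0r; congr col_mx.
  apply/matrixP => i j; rewrite mxE (bigD1 (z i)) //= big1 ?addr0 => [|p ne_p]; last first.
    by rewrite mxE eq_sym (negbTE ne_p) mul0r.
  rewrite !mxE eqxx mul1r eq_sym; congr (_ - _); rewrite -mulrA; congr (_ * _).
  have -> : (ord_pred (z i) == j) = (ord_pred (z i) == j :> nat) by [].
  rewrite /wgt /cP val_ord_pred.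
  have := ltn_ord (z i).
  case: eqP => [_|nz] lt_z.
    rewrite (_ : (_ == j :> nat) = (j.+1 == n)); last by lia.
    by case: eqP; rewrite ?mulr1 ?mulr0.
  by rewrite mul1r (_ : (_ == j :> nat) = (j.+1 == z i)) //; lia.
have trE N (M : 'M[A]_N) : (1%:M - t *: M)^T = 1%:M - t *: M^T.
  by apply/matrixP => i j; rewrite !mxE eq_sym.
rewrite !trE mulmxBr mulmxBl mulmx1 mul1mx.
congr (_ - _); rewrite -scalemxAr -scalemxAl; congr (_ *: _).
apply/matrixP => a i; rewrite !mxE.
under eq_bigr => p _ do rewrite mxE [_^T _ _]mxE.
under [RHS]eq_bigr => l _ do rewrite mxE [Y _ _]mxE mulrC.
by rewrite hdiff_shift hdiff_companion.
Qed.

Lemma det_shift_rows :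
  \det (col_mx (unit_rows A z) Y) * (1 - w * t ^+ n) =
  (1 - \sum_l c l * t ^+ l.+1) * \det (col_mx U' Y).
Proof.
have n_gt0 : (0 < n)%N by lia.
have := congr1 determinant shift_rows.
rewrite !det_mulmx det_ublock det1 mul1r !det_tr !det_companion => <-.
congr (_ * (_ - _)).
have lt_n : (n.-1 < n)%N by lia.
rewrite (bigD1 (Ordinal lt_n)) //= /cP prednK // eqxx big1 ?addr0 // => l ne_l.
case: eqP => [E|]; last by rewrite mul0r.
by case/eqP: ne_l; apply: ord_inj; rewrite /= ; lia.
Qed.

Lemma det_hop_expansion (b : bstring n) (o : 'I_k -> 'I_n) :
  injective z -> injective o -> (forall i j, z i != o j) ->
  (forall j, b (o j)) -> (forall p, b p -> exists j, p = o j) ->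
  \det (col_mx U' Y) =
  \sum_(H : bstring n | [forall p, H p ==> ~~ b (ordS p)])
     (\prod_i (if H (ord_pred (z i)) then - (t * wgt (z i)) else 1)) *
     \det (col_mx (unit_rows A (hopped H z)) Y).
Proof.
move=> z_inj o_inj zo bo ob.
pose F i (x : bool) j : A := match split i with
  | inl s => if x then - (t * wgt (z s)) * (ord_pred (z s) == j)%:R else (z s == j)%:R
  | inr a => if x then 0 else Y a j
  end.
have -> : col_mx U' Y = \matrix_(i, j) (F i false j + F i true j).
  apply/matrixP => i j; rewrite [RHS]mxE /F mxE; case: splitP => i' _.
    by rewrite mxE mulNr.
  by rewrite addr0.
rewrite det_row_sum.
(* Each row is attached to the edge below a position: unit rows to the zeros, rows of h to the
   letters. The choices of summands become edge sets H, and those with an edge below a letter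
   contribute 0. *)
pose iota (i : 'I_n) : 'I_n :=
  match split i with inl s => ord_pred (z s) | inr a => ord_pred (o a) end.
have iota_inj : injective iota.
  move=> i i'; rewrite /iota -{2}(splitK i) -{2}(splitK i').
  case: (split i) => s; case: (split i') => s' /ord_pred_inj.
  - by move/z_inj->.
  - by move/eqP; rewrite (negbTE (zo _ _)).
  - by move/esym/eqP; rewrite (negbTE (zo _ _)).
  - by move/o_inj->.
have reidx : {on [pred f : {ffun 'I_n -> bool} | true],
    bijective (fun H : bstring n => [ffun i => H (iota i)])}.
  apply: onW_bij; exists (fun f : {ffun 'I_n -> bool} => [ffun p => f (invF iota_inj p)]).
    by move=> H; apply/ffunP => p; rewrite !ffunE f_invF.
  by move=> f; apply/ffunP => p; rewrite !ffunE invF_f.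
rewrite (reindex _ reidx) /= (bigID (fun H : bstring n => [forall p, H p ==> ~~ b (ordS p)])) /=.
rewrite [X in _ + X]big1 ?addr0 => [|H /forallPn[p]]; last first.
  rewrite negb_imply negbK => /andP[Hp /ob[a Ea]].
  rewrite (expand_det_row _ (rshift m a)) big1 // => j _.
  rewrite mxE ffunE /F /iota (unsplitK (inr a)) -Ea ordSK Hp mul0r //.
apply: eq_bigr => H /forallP H_supp.
pose a (i : 'I_n) : A := match split i with
  | inl s => if H (ord_pred (z s)) then - (t * wgt (z s)) else 1
  | inr _ => 1
  end.
transitivity (\det (\matrix_(i, j) (a i * col_mx (unit_rows A (hopped H z)) Y i j))).
  congr (\det _); apply/matrixP => i j; rewrite !mxE ffunE /F /iota /a.
  case: (split i) => s; last first.
    have := H_supp (ord_pred (o s)); rewrite ord_predK bo implybF => /negbTE->.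
    by rewrite mul1r.
  by rewrite mxE /hopped; case: ifP => _ //; rewrite mul1r.
rewrite det_row_scale big_split_ord /=; congr (_ * _).
rewrite [X in _ * X]big1 ?mulr1 => [|s _]; last by rewrite /a (unsplitK (inr s)).
by apply: eq_bigr => s _; rewrite /a (unsplitK (inl s)).
Qed.

End Rows.

Lemma hdet_pieri (mu : part k n) (p0 : 'I_n) : p0 = n.-1 :> nat ->
  let hk := leq_addl m k in
  hdet (pos hk mu) * (1 - w * t ^+ n) =
  (1 - \sum_l c l * t ^+ l.+1) *
    \sum_(H : bstring n) \sum_(nu : part k n | step (pbits mu) H (pbits nu))
      t ^+ (\sum_p H p)%N * q ^+ H p0 * hdet (pos hk nu).
Proof.
move=> p0E hk; have [z [z_desc z_zerosP]] := zeros_enum mu.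
have z_zeros p := iffP idP (z_zerosP p).1 (z_zerosP p).2.
have z_inj := desc_inj z_desc.
have zo i j : z i != pos hk mu j.
  apply/eqP => E; have := (z_zerosP (z i)).2 (ex_intro _ i erefl).
  by rewrite E => /negP; apply; apply/pbitsP; exists j.
have inv0 : rev_inversions z = 0%N.
  rewrite /rev_inversions big1 // => j _; rewrite big1 // => i /z_desc lt_z.
  by rewrite ltnNge ltnW.
have o_inj : injective (pos hk mu).
  move=> i j E; apply: val_inj; case: (ltngtP i j) => // /(pos_incr hk mu); by rewrite E ltnn.
have hdetE nu (z1 : 'I_m -> 'I_n) : injective z1 -> (forall i j, z1 i != pos hk nu j) ->
    \det (col_mx (unit_rows A z1) Y) =
    (-1) ^+ (\sum_j z1 j + rev_inversions z1)%N * hdet (pos hk nu).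
  move=> z1_inj z1o; rewrite (det_unit_rows _ z1_inj (pos_incr hk nu) z1o).
  by congr (_ * \det _); apply/matrixP => i j; rewrite !mxE.
have := det_shift_rows z; rewrite (hdetE mu z z_inj zo) inv0 addn0.
rewrite (det_hop_expansion z_inj o_inj zo (b := pbits mu)); first last.
- by move=> p /pbitsP.
- by move=> j; apply/pbitsP; exists j.
move=> E; apply: (@can_inj _ _ _ _ (signrMK (\sum_j z j)%N)).
rewrite [LHS]mulrA E [RHS]mulrCA; congr (_ * _).
rewrite big_mkcond mulr_sumr; apply: eq_bigr => H _.
case: ifP => [/forallP H_supp0|nsupp]; last first.
  rewrite [X in _ = _ * X]big_pred0 ?mulr0 // => nu; apply/negP => /stepP st.
  case/negP: nsupp; apply/forallP => p; apply/implyP; exact: (st p).1.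
have H_supp p : H p -> ~~ pbits mu (ordS p) by apply/implyP/H_supp0.
have [nu st|no_nu] := pickP (fun nu : part k n => step (pbits mu) H (pbits nu)); last first.
  have no_step b' : ~~ step (pbits mu) H b'.
    apply/negP => st; have [|nu Enu] := @pbits_surj _ _ hk b'.
      by rewrite (step_card st) (eqP (card_pbits hk mu)).
    by have := no_nu nu; rewrite Enu st.
  rewrite [X in _ = _ * X]big_pred0 // mulr0.
  (* Colliding zeros give two equal rows. *)
  have [i [j [ne_ij Eij]]] := hopped_clash z_zeros H_supp no_step.
  rewrite (determinant_alternate (i1 := lshift k i) (i2 := lshift k j)) ?mulr0 //.
  by move=> p; rewrite !col_mxEu !mxE Eij.
rewrite [X in _ = _ * X](big_pred1 nu) => [|nu']; last first.
  apply/idP/eqP => [st'|->//]; apply: (pbits_inj hk); exact: step_fun st' st.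
have h_inj := hopped_inj z_desc z_zeros st.
have h_out i j : hopped H z i != pos hk nu j.
  apply/eqP => Eij; have := hopped_out z_zeros H_supp i st.
  by rewrite Eij => /negP; apply; apply/pbitsP; exists j.
rewrite (hdetE nu _ h_inj h_out).
rewrite !mulrA; congr (_ * _).
have -> : \prod_i (if H (ord_pred (z i)) then - (t * wgt (z i)) else 1) =
    (-1) ^+ (\sum_p H p)%N * t ^+ (\sum_p H p)%N * w ^+ H p0.
  rewrite -exprMn mulN1r (card_hops z_desc z_zeros H_supp).
  rewrite -(sum_wrap z_desc z_zeros H_supp p0E) -!prodrXr -big_split /=.
  apply: eq_bigr => i _; rewrite /wgt; case: eqP => [zi|_] /=.
    by rewrite (pred_zero p0E zi); case: (H p0); rewrite /= ?expr1 ?expr0 ?mulNr ?mulr1.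
  by case: (H _); rewrite /= ?expr1 ?expr0 ?mulr1.
rewrite /w exprMn -exprM.
have := odd_hopped z_desc z_zeros H_supp st p0E.
move: (\sum_p H p)%N (\sum_j hopped H z j + _)%N (\sum_j z j)%N => s N Z oddE.
transitivity ((-1) ^+ (s + k.+1 * H p0 + N)%N * (t ^+ s * q ^+ H p0)).
  by rewrite !exprD; ring.
rewrite -[in RHS]mulrA; congr (_ * _); rewrite -signr_odd -[RHS]signr_odd.
congr (_ ^+ nat_of_bool _).
case E0: (H p0) oddE; rewrite /= ?addbF => oddE; last first.
  by rewrite muln0 addn0 addnC oddE.
(* A wrapping zero exists, so m > 0. Its sign has exponent n + m - 1, and the k + 1 in w completes
   this to 2n: the quantum terms are positive. *)
have /z_zeros[[j lt_j] _] := H_supp _ E0.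
rewrite muln1 addnAC oddD [(s + N)%N]addnC oddE -addbA -oddD.
rewrite (_ : (_ + _ + k.+1)%N = (m + k).*2); last lia.
by rewrite odd_double addbF.
Qed.

End Pieri.

Section QuantumPieri.

Import GRing.Theory.
Local Open Scope ring_scope.

Variables (R : comNzRingType) (m k : nat) (h e : nat -> R) (q : R).
Local Notation n := (m + k)%N.

Hypothesis k_gt0 : (0 < k)%N.
Hypothesis h_rec : forall i, h i.+1 = \sum_(l < k) (-1) ^+ l * e l.+1 * hdiff h i l.
Hypothesis h_van : forall s, (m < s < m + k)%N -> h s = 0.
Hypothesis h0 : h 0 = 1.
Hypothesis h_n : h n = (-1) ^+ k.+1 * q.

Lemma hdiff_polyC i a : hdiff (fun s => (h s)%:P) i a = (hdiff h i a)%:P.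
Proof. by rewrite /hdiff; case: ifP; rewrite ?polyC0. Qed.

Lemma hdet_polyC (o : 'I_k -> 'I_n) : hdet (fun s => (h s)%:P) o = (hdet h o)%:P.
Proof.
rewrite /hdet -det_map_mx; congr (\det _).
by apply/matrixP => i j; rewrite !mxE hdiff_polyC.
Qed.

(** Multiply [hdet_pieri] over R[t] by the series of the h_s and compare coefficients of t^a. Since
    k > 0 gives a < n, the term in t^n is not seen. *)
Lemma quantum_pieri (mu : part k n) (p0 : 'I_n) a : p0 = n.-1 :> nat -> (a <= m)%N ->
  let hk := leq_addl m k in
  h a * hdet h (pos hk mu) =
  \sum_(H : bstring n | #|[set p | H p]| == a)
    \sum_(nu : part k n | step (pbits mu) H (pbits nu)) q ^+ H p0 * hdet h (pos hk nu).
Proof.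
move=> p0E le_a hk; have lt_a : (a < n)%N by lia.
have signC (x : R) s : (-1) ^+ s * x%:P = ((-1) ^+ s * x)%:P.
  by rewrite rmorphM rmorphXn rmorphN1.
have p1 i : (h i.+1)%:P = \sum_(l < k) (-1) ^+ l * (e l.+1)%:P *
    hdiff (fun s => (h s)%:P) i l :> {poly R}.
  rewrite h_rec rmorph_sum; apply: eq_bigr => l _.
  by rewrite hdiff_polyC !rmorphM rmorphXn rmorphN1.
have p2 s : (m < s < m + k)%N -> (h s)%:P = 0 :> {poly R}.
  by move/h_van->; rewrite polyC0.
have p3 : (h n)%:P = (-1) ^+ k.+1 * q%:P * (h 0)%:P :> {poly R}.
  by rewrite h_n h0 mulr1 rmorphM rmorphXn rmorphN1.
have := hdet_pieri (h := fun s => (h s)%:P) (e := fun s => (e s)%:P)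
  'X k_gt0 p1 p2 p3 mu p0E.
rewrite /= -/hk hdet_polyC.
set E := 1 - \sum_l _; set T := \sum_(H : bstring n) _ => main.
pose Hs : {poly R} := \poly_(s < n) h s.
(* The truncated series inverts E modulo t^n, by the recurrence for h. *)
have EH i : (i < n)%N -> (E * Hs)`_i = (i == 0)%:R.
  move=> lt_i; rewrite mulrBl mul1r coefB coef_poly lt_i mulr_suml coef_sum.
  have coefE (l : 'I_k) : ((-1) ^+ l * (e l.+1)%:P * 'X^(l.+1) * Hs)`_i =
      if (l < i)%N then (-1) ^+ l * e l.+1 * h (i - l.+1) else 0.
    rewrite signC -mulrA coefCM coefXnM ltnS leqNgt.
    case: ltnP => [lt_l|]; last by rewrite mulr0.
    by rewrite coef_poly (_ : (i - l.+1 < n)%N); last lia.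
  rewrite (eq_bigr _ (fun l _ => coefE l)).
  case: i lt_i {coefE} => [|i] lt_i; first by rewrite big1 ?subr0.
  rewrite h_rec -sumrB big1 // => l _; rewrite /hdiff ltnS subSS.
  by case: ifP; rewrite ?mulr0 subrr.
have := congr1 (fun P => (P * Hs)`_a) main.
rewrite -[_ * Hs]mulrA mulrBl mul1r mulrBr coefB coefCM coef_poly lt_a.
rewrite (_ : (_ * (_ * Hs))`_a = 0); last first.
  rewrite signC -mulrA !coefCM coefXnM lt_a !mulr0 //.
rewrite subr0 mulrC => ->; rewrite mulrAC coefM (bigD1 ord0) //= EH; last lia.
rewrite mul1r subn0 big1 ?addr0 => [|i ne_i]; last first.
  rewrite EH; last by have := ltn_ord i; lia.
  by case: eqP => [i0|]; [case/eqP: ne_i; apply: ord_inj | rewrite mul0r].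
rewrite /T coef_sum [RHS]big_mkcond; apply: eq_bigr => H _.
rewrite coef_sum card_bits; case: ifP => Ha; last first.
  rewrite big1 // => nu _; rewrite hdet_polyC -polyC_exp -mulrA -polyCM mulrC coefCM coefXn.
  by rewrite eq_sym Ha mulr0.
apply: eq_bigr => nu _; rewrite hdet_polyC -polyC_exp -mulrA -polyCM mulrC coefCM coefXn.
by rewrite eq_sym Ha mulr1.
Qed.

End QuantumPieri.

Lemma det_rev_ord (R : comNzRingType) k (M : 'M[R]_k) :
  (\det (\matrix_(i, j) M (rev_ord i) (rev_ord j)) = \det M)%R.
Proof.
pose s : {perm 'I_k} := perm (@rev_ord_inj k).
have -> : (\matrix_(i, j) M (rev_ord i) (rev_ord j) = row_perm s (col_perm s M))%R.
  by apply/matrixP => i j; rewrite !mxE !permE.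
rewrite row_permE col_permE !det_mulmx !det_perm odd_permV.
by rewrite GRing.mulrCA -GRing.expr2 GRing.sqrr_sign GRing.mulr1.
Qed.

(** * Recurrence for the h_r, and Schubert classes as determinants *)

Section HessenbergRecurrence.

Import GRing.Theory.
Local Open Scope ring_scope.

Variables (A : comNzRingType) (E : int -> A).
Hypotheses (E0 : E 0 = 1) (E_neg : forall s, E (Negz s) = 0).

Let hdt (r : nat) : A := \det (\matrix_(i < r, j < r) E (1 - i%:Z + j%:Z)).

(* The vector with entries (-1)^j h_{r-j} is sent to a multiple of the first
   basis vector; multiply by the adjugate. *)
Lemma hessenberg_rec r : hdt r.+1 = \sum_(l < r.+1) (-1) ^+ l * E l.+1%:Z * hdt (r - l).
Proof.
elim/ltn_ind: r => r IH; set X := RHS.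
set M := \matrix_(i < r.+1, j < r.+1) E (1 - i%:Z + j%:Z).
pose w : 'cV[A]_r.+1 := \col_j ((-1) ^+ j * hdt (r - j)).
have Mw : M *m w = X *: delta_mx 0 0.
  apply/colP => i; rewrite !mxE; case: (unliftP ord0 i) => [i' ->|->]; last first.
    rewrite eqxx mulr1; apply: eq_bigr => j _; rewrite !mxE /= mulrA [E _ * _]mulrC.
    by congr (_ * E _ * _); lia.
  have [p lt_p Ep] : exists2 p, (p < r)%N & lift ord0 i' = p.+1 :> nat.
    by exists i'; [exact: ltn_ord|].
  rewrite /= mulr0.
  pose F j := E (1 - p.+1%:Z + j%:Z) * ((-1) ^+ j * hdt (r - j)).
  transitivity (\sum_(j < r.+1) F j).
    by apply: eq_bigr => j _; rewrite !mxE [X in 1 - Posz X]Ep.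
  rewrite -(big_mkord xpredT) (big_cat_nat (n := p)) //=; last by lia.
  rewrite big_nat big1 ?add0r => [|j /andP[_ lt_j]]; last first.
    rewrite /F (_ : 1 - _ + _ = Negz (p - j).-1); first by rewrite E_neg mul0r.
    by rewrite NegzE; lia.
  rewrite big_ltn; last by lia.
  rewrite {1}/F (_ : 1 - _ + p%:Z = 0) ?E0 ?mul1r; last by lia.
  have [s Es] : exists s, r = (p + s.+1)%N by exists (r - p.+1)%N; lia.
  have -> : (r - p)%N = s.+1 by lia.
  rewrite IH; last by lia.
  rewrite mulr_sumr -{1}[p.+1]add0n big_addn (_ : (r.+1 - p.+1)%N = s.+1); last by lia.
  rewrite big_mkord -big_split big1 //= => l _.
  rewrite /F (_ : 1 - _ + _ = l.+1%:Z); last by lia.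
  rewrite (_ : (r - (l + p.+1) = s - l)%N); last by lia.
  by rewrite addnS exprS exprD; ring.
have cof : (\adj M) ord_max 0 = (-1) ^+ r.
  rewrite mxE /cofactor add0n -det_tr det_trig; last first.
    apply/is_trig_mxP => i j lt_ij; rewrite !mxE /=.
    rewrite (_ : 1 - _ + _ = Negz (j - i).-1) ?E_neg //.
    have lt_i : (i < r)%N := ltn_ord i.
    rewrite NegzE /bump /= [(r <= i)%N]leqNgt lt_i; move: lt_ij.
    by move: (nat_of_ord i) (nat_of_ord j) => a b; lia.
  rewrite big1 ?mulr1 // => i _; rewrite !mxE /= (_ : 1 - _ + _ = 0) ?E0 //.
  have lt_i : (i < r)%N := ltn_ord i.
  by rewrite /bump /= [(r <= i)%N]leqNgt lt_i; move: (nat_of_ord i) => a; lia.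
have := congr1 (mulmx (\adj M)) Mw; rewrite mulmxA mul_adj_mx.
rewrite mul_scalar_mx -scalemxAr -colE => /colP/(_ ord_max).
rewrite [LHS]mxE [w _ _]mxE [RHS]mxE [col _ _ _ _]mxE cof /= subnn.
rewrite (_ : hdt 0 = 1) ?mulr1 => [Eq|]; last exact: det_mx00.
by apply: (can_inj (signrMK r)); rewrite /= mulrC Eq mulrC.
Qed.

End HessenbergRecurrence.

Section UniversalRing.

Import GRing.Theory.
Local Open Scope ring_scope.

Variables k n : nat.

Lemma esym_large j : (k < j)%N -> Defs.esym k j%:Z = 0.
Proof. by case: j => // j lt_j; rewrite /Defs.esym insubF //; apply/negbTE; rewrite -leqNgt. Qed.

Lemma hsym0 : hsym k 0 = 1.
Proof. exact: det_mx00. Qed.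

(** The expansion of the Hessenberg determinant has i + 1 terms. Terms with l > i vanish through
    [hdiff] and those with l >= k because e_{l+1} = 0, so k terms serve for every i. *)
Lemma hsym_rec i :
  hsym k i.+1%:Z = \sum_(l < k) (-1) ^+ l * Defs.esym k l.+1%:Z * hdiff (fun s => hsym k s%:Z) i l.
Proof.
have -> : hsym k i.+1%:Z = \sum_(l < i.+1) (-1) ^+ l * Defs.esym k l.+1%:Z * hsym k (i - l)%N%:Z.
  exact: (hessenberg_rec (E := Defs.esym k)).
pose F (l : nat) := (-1) ^+ l * Defs.esym k l.+1%:Z * hdiff (fun s => hsym k s%:Z) i l.
rewrite (eq_bigr (fun l : 'I_i.+1 => F l)); last first.
  by move=> l _; rewrite /F /hdiff -ltnS ltn_ord.
rewrite -(big_mkord xpredT F) -[RHS](big_mkord xpredT F).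
have F0 l : (i < l)%N || (k <= l)%N -> F l = 0.
  case/orP => [lt_l|le_l]; first by rewrite /F /hdiff leqNgt lt_l mulr0.
  by rewrite /F esym_large // mulr0 mul0r.
have [le_ki|lt_ik] := leqP k i.+1.
  rewrite (big_cat_nat (n := k)) //= [X in _ + X]big_nat [X in _ + X]big1 ?addr0 // => l.
  by case/andP=> le_l _; rewrite F0 ?le_l ?orbT.
rewrite [RHS](big_cat_nat (n := i.+1)) //=; last exact: ltnW.
rewrite [X in _ + X]big_nat [X in _ + X]big1 ?addr0 // => l /andP[le_l _].
by rewrite F0 ?le_l.
Qed.

(** Transposing and reversing both index sets turns mu_i - i + j into the position of a letter minus
    a row index. *)
Lemma schubert_hdet (hk : (k <= n)%N) (mu : part k n) :
  schubert mu = \det (\matrix_(i, j) hdiff (fun s => hsym k s%:Z) (pos hk mu j) i).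
Proof.
rewrite /schubert -det_tr -[LHS]det_rev_ord; congr (\det _).
apply/matrixP => i j; rewrite !mxE /hdiff.
have lt_i := ltn_ord i; have lt_j := ltn_ord j.
case: leqP => [le_i|lt].
  by congr (hsym k _); rewrite /= in le_i *; lia.
rewrite (_ : _ + _ = Negz (i - pos hk mu j).-1) //.
by rewrite NegzE /= in lt *; lia.
Qed.

End UniversalRing.

(** * The quotient ring *)

Section IdealQuotient.

Import GRing.Theory.
Local Open Scope ring_scope.
Local Open Scope quotient_scope.

Variables (R : comNzRingType) (I : R -> Prop).
Hypotheses (I0 : I 0) (I1 : ~ I 1).
Hypothesis Ilin : forall a u v, I u -> I v -> I (a * u + v).

(** The quotient construction takes a boolean ideal, so membership is made boolean classically. *)
Definition ideal_pred (x : R) : bool := excluded_middle_informative (I x).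

Lemma ideal_predP x : reflect (I x) (ideal_pred x).
Proof. by rewrite /ideal_pred; case: excluded_middle_informative => Ix; constructor. Qed.

Lemma ideal_pred_closed : idealr_closed (ideal_pred : {pred R}).
Proof.
split; first exact/ideal_predP.
  by apply/ideal_predP.
by move=> a u v /ideal_predP Iu /ideal_predP Iv; apply/ideal_predP/Ilin.
Qed.

HB.instance Definition _ := isIdealr.Build R ideal_pred ideal_pred_closed.

(** Turns congruences modulo the relations into equations in a ring, where the Pieri rule
    applies. *)
Lemma ideal_quotient_ex : exists (S : comNzRingType) (p : {rmorphism R -> S}),
  forall x, p x = 0 <-> I x.
Proof.
pose J : idealr R := ideal_pred.
pose S : comNzRingType := {ideal_quot J}.
pose p (x : R) : S := \pi_({ideal_quot J}) x.
have pB : GRing.zmod_morphism p by move=> x y; rewrite /p !piE.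
have pM : GRing.monoid_morphism p by split=> [|x y]; rewrite /p !piE.
pose p' := GRing.isZmodMorphism.Build R S p pB.
pose p'' := GRing.isMonoidMorphism.Build R S p pM.
pose P : {rmorphism R -> S} := HB.pack p p' p''.
exists S, P => x; rewrite -[P x]/(p x).
have E : ideal_pred (x - 0) = (x == 0 %[mod {ideal_quot J}]) := Quotient.idealrBE _ _ _.
rewrite subr0 in E; split=> [Px|/ideal_predP]; last first.
  by rewrite E => /eqP Ex; rewrite /p Ex !piE.
apply/ideal_predP; rewrite E; apply/eqP.
by rewrite -[LHS]/(p x) Px /p !piE.
Qed.

End IdealQuotient.

(** * Evaluation at the Bethe points *)

Section Eigenvectors.

Import GRing.Theory.
Local Open Scope ring_scope.

Variables (A : comNzRingType) (k : nat) (h c W : nat -> A) (x : A).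
Hypotheses (h0 : h 0 = 1) (W0 : W 0 = 1) (Wk : W k = 0).
Hypothesis h_rec : forall i, h i.+1 = \sum_(l < k) c l * hdiff h i l.
Hypothesis W_rec : forall l, (l < k)%N -> W l.+1 = x * W l - c l.

(** W is an eigenvector of [companion c] for the eigenvalue x, with first entry 1, and the companion
    matrix raises i by one. *)
Lemma hdiff_eigen i : \sum_(j < k) hdiff h i j * W j = x ^+ i.
Proof.
case: k Wk h_rec W_rec => [|k'] Wk' h_rec' W_rec'.
  by have := oner_neq0 A; rewrite -W0 Wk' eqxx.
elim: i => [|i IH].
  rewrite big_ord_recl big1 ?addr0 => [|j _]; last by rewrite mul0r.
  by rewrite /hdiff /= subn0 h0 W0 mulr1.
rewrite big_ord_recl W0 mulr1 {1}/hdiff /= subn0 h_rec' exprS -IH mulr_sumr.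
rewrite (eq_bigr (fun j : 'I_k' => hdiff h i j * W j.+1)) => [|j _]; last first.
  by rewrite /= /bump leq0n add1n /hdiff ltnS subSS.
have -> : \sum_(j < k') hdiff h i j * W j.+1 = \sum_(j < k'.+1) hdiff h i j * W j.+1.
  by rewrite big_ord_recr /= Wk' mulr0 addr0.
rewrite -big_split; apply: eq_bigr => l _ /=.
by rewrite W_rec' //; ring.
Qed.

End Eigenvectors.

Lemma qH_relationsE k n : 0 < k ->
  qH_relations k n = rcons [seq hsym k r%:Z | r <- iota (n - k).+1 k.-1]
                           (hsym k n%:Z + ('X : {poly int}) *: (-1) ^+ k)%R.
Proof. by case: k. Qed.

Section BethePoints.

Import GRing.Theory Num.Theory.
Local Open Scope ring_scope.

Variables (k n : nat).
Hypothesis hk : (k <= n)%N.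

Section Evaluation.

Variable x : 'I_k -> algC.
Hypothesis x_inj : injective x.
Hypothesis x_root : forall i, x i ^+ n = (-1) ^+ k.+1.

Let P : {poly algC} := \prod_i ('X - (x i)%:P).

Let pc (j : nat) : algC := P`_j.

(** By Vieta, the j-th elementary symmetric function of the x_i for j <= k. *)
Definition esymC (j : nat) : algC := (-1) ^+ j * pc (k - j)%N.

Definition ev_coef : {poly int} -> algC := horner_eval 1 \o map_poly intr.

HB.instance Definition _ := GRing.RMorphism.on ev_coef.

Definition ev : Defs.qpoly k -> algC := mmap ev_coef (fun i => esymC i.+1).

HB.instance Definition _ := GRing.RMorphism.on ev.

Lemma ev_coefX : ev_coef 'X = 1.
Proof. by rewrite /ev_coef /= map_polyX /horner_eval hornerX. Qed.

Lemma ev_coefC a : ev_coef a%:P = a%:~R.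
Proof. by rewrite /ev_coef /= map_polyC /horner_eval hornerC. Qed.

Lemma ev_esym j : ev (Defs.esym k j.+1%:Z) = if (j < k)%N then esymC j.+1 else 0.
Proof.
rewrite /Defs.esym; case: insubP => [i lt_j Ei|/negbTE->]; last exact: rmorph0.
by rewrite lt_j /ev mmapX mmap1U -Ei.
Qed.

Let hC (s : nat) : algC := ev (hsym k s%:Z).
Let c (l : nat) : algC := - pc (k - l.+1)%N.

Lemma hC0 : hC 0 = 1.
Proof. by rewrite /hC hsym0 rmorph1. Qed.

Lemma ev_hdiff i a : ev (hdiff (fun s => hsym k s%:Z) i a) = hdiff hC i a.
Proof. by rewrite /hdiff; case: ifP => // _; rewrite rmorph0. Qed.

Lemma hC_rec i : hC i.+1 = \sum_(l < k) c l * hdiff hC i l.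
Proof.
rewrite /hC hsym_rec rmorph_sum; apply: eq_bigr => l _.
rewrite !rmorphM rmorphXn rmorphN1 [_ (Defs.esym _ _)](ev_esym l) ltn_ord.
rewrite [_ (hdiff _ _ _)](ev_hdiff i l); congr (_ * _).
by rewrite /esymC exprS mulN1r mulNr mulrN mulrA -exprD addnn -signr_odd odd_double mul1r.
Qed.

(** The intermediate values of the Horner scheme for P at x_i; the last one, W i k, is P(x_i) =
    0. *)
Definition W (i : 'I_k) (l : nat) : algC := \sum_(s < l.+1) pc (k - l + s)%N * x i ^+ s.

Lemma size_P : size P = k.+1.
Proof. by rewrite size_prod_XsubC [index_enum _]unlock -enumT size_enum_ord. Qed.

Lemma P_lead : pc k = 1.
Proof.
have /eqP := monic_prod_XsubC (index_enum 'I_k) xpredT x.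
by rewrite /lead_coef size_P.
Qed.

Lemma W0 i : W i 0 = 1.
Proof. by rewrite /W big_ord1 subn0 addn0 P_lead mulr1. Qed.

Lemma W_rec i l : (l < k)%N -> W i l.+1 = x i * W i l - c l.
Proof.
move=> lt_l; rewrite /W big_ord_recl /= addn0 mulr1 /c opprK addrC; congr (_ + _).
rewrite mulr_sumr; apply: eq_bigr => s _; rewrite /= /bump leq0n add1n exprS.
by rewrite (_ : (k - l.+1 + s.+1 = k - l + s)%N); [ring | lia].
Qed.

Lemma W_top i : W i k = 0.
Proof.
transitivity P.[x i].
  by rewrite horner_coef size_P; apply: eq_bigr => s _; rewrite subnn add0n.
by rewrite /P horner_prod (bigD1 i) //= hornerXsubC subrr mul0r.
Qed.

Lemma hC_eigen i a : \sum_(j < k) hdiff hC a j * W i j = x i ^+ a.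
Proof. by apply: (hdiff_eigen hC0 (W0 i) (W_top i) hC_rec) => l; apply: W_rec. Qed.

Let Wm : 'M[algC]_k := \matrix_(j, i) W i j.

(** The bialternant formula in matrix form. The same [Wm] serves for all o, and o = id gives the
    Vandermonde matrix, whence its invertibility. *)
Lemma hdiff_Wm (o : 'I_k -> nat) :
  (\matrix_(j, i) hdiff hC (o j) i) *m Wm = \matrix_(j, l) x l ^+ o j.
Proof.
apply/matrixP => j l; rewrite !mxE -hC_eigen.
by apply: eq_bigr => i _; rewrite !mxE.
Qed.

Lemma Wm_unit : Wm \in unitmx.
Proof.
rewrite unitmxE; have := congr1 determinant (hdiff_Wm (fun j => j)).
rewrite det_mulmx (_ : \matrix_(j, l) (x l ^+ j) = Vandermonde k (\row_l x l)); last first.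
  by apply/matrixP => j l; rewrite !mxE.
rewrite det_Vandermonde => E; rewrite unitfE.
suff : \det (\matrix_(j < k, i < k) hdiff hC j i) * \det Wm != 0.
  by apply: contraNneq => ->; rewrite mulr0.
rewrite E; apply/prodf_neq0 => i _; apply/prodf_neq0 => j lt_ij.
rewrite !mxE subr_eq0 (inj_eq x_inj); apply: contraTneq lt_ij => ->.
by rewrite ltnn.
Qed.

(** Both sides agree on each eigenvector because x_i^n = (-1)^(k+1), and the eigenvectors form a
    basis. The case j = 0 is the relation for h_n, the others are the vanishing relations. *)
Lemma hC_period (j : 'I_k) : hdiff hC n j = (-1) ^+ k.+1 * hdiff hC 0 j.
Proof.
pose v : 'rV[algC]_k := \row_i (hdiff hC n i - (-1) ^+ k.+1 * hdiff hC 0 i).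
have vW : v *m Wm = 0.
  apply/rowP => i; rewrite !mxE.
  under eq_bigr => l _ do rewrite !mxE mulrBl -mulrA.
  by rewrite sumrB -mulr_sumr !hC_eigen expr0 mulr1 x_root subrr.
have /rowP/(_ j) : v = 0 by rewrite -[v](mulmxK Wm_unit) vW mul0mx.
by rewrite !mxE => /eqP; rewrite subr_eq0 => /eqP.
Qed.

Lemma ev_relations i : ev (qH_relations k n)`_i = 0.
Proof.
have [k0|k_gt0] := posnP k.
  rewrite (_ : qH_relations k n = [::]) ?nth_nil ?rmorph0 //.
  by move: (k) k0 => k' ->.
rewrite qH_relationsE // nth_rcons size_map size_iota.
have per (j : 'I_k) : hC (n - j) = (-1) ^+ k.+1 * hdiff hC 0 j.
  rewrite -hC_period /hdiff ifT //; have := ltn_ord j; lia.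
case: ltnP => [lt_i|_].
  rewrite (nth_map 0%N) ?size_iota // nth_iota //.
  have lt_j : (k.-1 - i < k)%N by lia.
  have := per (Ordinal lt_j); rewrite /= /hdiff leqNgt.
  rewrite (_ : (0 < k.-1 - i)%N) ?mulr0; last by lia.
  by rewrite (_ : (n - (k.-1 - i) = (n - k).+1 + i)%N); last by lia.
case: eqP => _; last exact: rmorph0.
rewrite rmorphD; have := per (Ordinal k_gt0).
rewrite /= subn0 /hdiff /= hC0 mulr1 /hC => ->.
rewrite /ev mmapZ rmorphXn rmorphN1 [_ 'X]ev_coefX mul1r.
by rewrite exprS mulN1r addNr.
Qed.

Lemma ev_eq_qH (p1 p2 : Defs.qpoly k) : eq_qH n p1 p2 -> ev p1 = ev p2.
Proof.
case=> d E; apply/eqP; rewrite -subr_eq0 -rmorphB E rmorph_sum big1 // => i _.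
by rewrite rmorphM [X in _ * X](ev_relations i) mulr0.
Qed.

Lemma ev_schubert (mu : part k n) :
  ev (schubert mu) * \det Wm = \det (\matrix_(l, j) x l ^+ pos hk mu j).
Proof.
rewrite (schubert_hdet hk) -det_tr -det_map_mx.
rewrite (_ : map_mx _ _ = \matrix_(j, i) hdiff hC (pos hk mu j) i); last first.
  by apply/matrixP => i j; rewrite !mxE; apply: ev_hdiff.
rewrite -det_mulmx (hdiff_Wm (fun j => pos hk mu j : nat)) -det_tr.
by congr (\det _); apply/matrixP => i j; rewrite !mxE.
Qed.

End Evaluation.

End BethePoints.

(** * Independence of the Schubert classes *)

Section Uniqueness.

Import GRing.Theory Num.Theory.
Local Open Scope ring_scope.

Variables (k n : nat).
Hypotheses (hk : (k <= n)%N) (n_gt0 : (0 < n)%N).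

Lemma bethe_points_ex : exists X : 'I_n -> algC,
  [/\ injective X, forall p, X p ^+ n = (-1) ^+ k.+1
    & forall a b, (a < n)%N -> (b < n)%N ->
        \sum_p X p ^+ a / X p ^+ b = (if a == b then n%:R else 0)].
Proof.
have [eta etaP] := C_prim_root_exists n_gt0.
pose y : algC := n.-root ((-1) ^+ k.+1).
have yn : y ^+ n = (-1) ^+ k.+1 by rewrite rootCK.
have eta_n : eta ^+ n = 1 by apply: prim_expr_order.
have eta0 : eta != 0.
  by apply/eqP => E; have := oner_neq0 algC; rewrite -eta_n E expr0n eqn0Ngt n_gt0 eqxx.
have y0 : y != 0.
  apply/eqP => E; have := signr_eq0 algC k.+1.
  by rewrite -yn E expr0n eqn0Ngt n_gt0 eqxx.
exists (fun p => y * eta ^+ p); split=> [p p' /(mulfI y0)/eqP|p|a b lt_a lt_b].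
- by rewrite (eq_prim_root_expr etaP) !modn_small // => /eqP/ord_inj.
- by rewrite exprMn yn -exprM mulnC exprM eta_n expr1n mulr1.
case: eqP => [<-|/eqP ne_ab].
  rewrite (eq_bigr (fun=> 1)) ?sumr_const ?card_ord // => p _.
  by rewrite divff // expf_neq0 // mulf_neq0 // expf_neq0.
pose u := eta ^+ a / eta ^+ b.
rewrite (eq_bigr (fun p : 'I_n => (y ^+ a / y ^+ b) * u ^+ p)) => [|p _]; last first.
  by rewrite !exprMn invfM -exprM -[eta ^+ p ^+ b]exprM !(mulnC p) !exprM exprVn; ring.
rewrite -mulr_sumr; apply/eqP; rewrite mulf_eq0; apply/orP; right.
have u_n : u ^+ n = 1.
  by rewrite exprMn exprVn -!exprM !(mulnC _ n) !exprM eta_n !expr1n divr1.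
have u1 : u != 1.
  apply: contra ne_ab => /eqP Eu; have : eta ^+ a == eta ^+ b.
    by rewrite -[eta ^+ b]mul1r -Eu /u divfK // expf_neq0.
  by rewrite (eq_prim_root_expr etaP) !modn_small.
have := subrX1 u n; rewrite u_n subrr => /esym/eqP.
by rewrite mulf_eq0 subr_eq0 (negbTE u1).
Qed.

(** Fourier inversion over all f, injective or not, so that the sum factors over l. Orthogonality
    leaves only permutations s carrying the positions of nu to those of mu; as positions increase,
    nu = mu and s = 1. *)
Lemma alternant_independent (X : 'I_n -> algC) (a : part k n -> algC) :
  (forall a b, (a < n)%N -> (b < n)%N ->
        \sum_p X p ^+ a / X p ^+ b = (if a == b then n%:R else 0)) ->
  (forall f : {ffun 'I_k -> 'I_n},
     \sum_nu a nu * \det (\matrix_(l, j) X (f l) ^+ pos hk nu j) = 0) ->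
  forall mu, a mu = 0.
Proof.
move=> X_orth alt0 mu.
pose T := \sum_(f : {ffun 'I_k -> 'I_n}) (\prod_l (X (f l) ^+ pos hk mu l)^-1) *
  (\sum_nu a nu * \det (\matrix_(l, j) X (f l) ^+ pos hk nu j)).
have T0 : T = 0 by rewrite /T big1 // => f _; rewrite alt0 mulr0.
suff : T = n%:R ^+ k * a mu.
  rewrite T0 => /esym/eqP; rewrite mulf_eq0 expf_eq0 pnatr_eq0 eqn0Ngt n_gt0 andbF.
  by move/eqP.
have -> : T = \sum_nu a nu * \sum_(s : 'S_k) (-1) ^+ s *
    \prod_l (if pos hk nu (s l) == pos hk mu l then n%:R else 0).
  rewrite /T; under eq_bigr => f _ do rewrite mulr_sumr.
  rewrite exchange_big; apply: eq_bigr => nu _ /=.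
  under eq_bigr => f _ do rewrite mulrCA.
  rewrite -mulr_sumr; congr (_ * _).
  rewrite /determinant; under eq_bigr => f _ do rewrite mulr_sumr.
  rewrite exchange_big; apply: eq_bigr => s _ /=.
  under eq_bigr => f _ do rewrite mulrCA.
  rewrite -mulr_sumr; congr (_ * _).
  transitivity (\prod_l \sum_p X p ^+ pos hk nu (s l) / X p ^+ pos hk mu l); last first.
    by apply: eq_bigr => l _; rewrite X_orth ?ltn_ord.
  rewrite bigA_distr_bigA; apply: eq_bigr => f _.
  rewrite -big_split; apply: eq_bigr => l _ /=.
  by rewrite mxE mulrC.
have pos_mono nu i j : (pos hk nu i < pos hk nu j)%N = (i < j)%N.
  case: (ltngtP i j) => [/(pos_incr hk nu)//|/(pos_incr hk nu)/ltnW|/ord_inj->].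
    by rewrite leqNgt => /negbTE.
  by rewrite ltnn.
rewrite (bigD1 mu) //= [X in _ + X]big1 ?addr0 => [|nu ne_nu]; last first.
  rewrite big1 ?mulr0 // => s _.
  have [/forallP Hs|/forallPn[l ne_l]] :=
      boolP [forall l, pos hk nu (s l) == pos hk mu l]; last first.
    by rewrite (bigD1 l) //= (negbTE ne_l) mul0r mulr0.
  case/eqP: ne_nu; apply: (pbits_inj hk); apply/ffunP => p.
  apply/(pbitsP hk)/(pbitsP hk) => -[i ->].
    by exists ((s^-1)%g i); apply: ord_inj; rewrite -(eqP (Hs _)) permKV.
  by exists (s i); apply: ord_inj; rewrite (eqP (Hs _)).
rewrite mulrC; congr (_ * _).
rewrite (bigD1 (1%g : 'S_k)) //= odd_perm1 expr0 mul1r [X in _ + X]big1 ?addr0 => [|s ne_s].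
  under eq_bigr => l _ do rewrite perm1 eqxx.
  by rewrite prodr_const card_ord.
have [/forallP Hs|/forallPn[l ne_l]] :=
    boolP [forall l, pos hk mu (s l) == pos hk mu l]; last first.
  by rewrite (bigD1 l) //= (negbTE ne_l) mul0r mulr0.
case/eqP: ne_s; apply/permP => l; rewrite perm1.
case: (ltngtP (s l) l) => [|lt|/ord_inj//].
  by rewrite -(pos_mono mu) (eqP (Hs l)) ltnn.
by move: lt; rewrite -(pos_mono mu) (eqP (Hs l)) ltnn.
Qed.

Lemma expansion_unique (K K' : part k n -> int) (d : part k n -> nat) :
  eq_qH n (\sum_nu ((K nu)%:P * 'X^(d nu) : {poly int}) *: schubert nu)
          (\sum_nu ((K' nu)%:P * 'X^(d nu) : {poly int}) *: schubert nu) ->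
  K =1 K'.
Proof.
move=> EK mu; apply/eqP; rewrite -subr_eq0 -(intr_eq0 algC); apply/eqP.
have [X [X_inj X_root X_orth]] := bethe_points_ex.
apply: (alternant_independent (a := fun nu => (K nu - K' nu)%:~R) X_orth) => f.
have [f_inj|/injectivePn[i [j ne_ij Eij]]] := boolP (injectiveb f); last first.
  rewrite big1 // => nu _; rewrite (determinant_alternate ne_ij) ?mulr0 // => l.
  by rewrite !mxE Eij.
have x_inj : injective (fun l => X (f l)) by move=> i j /X_inj; apply: (injectiveP _ f_inj).
have x_root i : X (f i) ^+ n = (-1) ^+ k.+1 by apply: X_root.
have := ev_eq_qH hk x_inj x_root EK.
have evE (L : part k n -> int) : ev (fun l => X (f l))
    (\sum_nu ((L nu)%:P * 'X^(d nu) : {poly int}) *: schubert nu) =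
    \sum_nu (L nu)%:~R * ev (fun l => X (f l)) (schubert nu).
  rewrite rmorph_sum; apply: eq_bigr => nu _; rewrite /= /ev mmapZ; congr (_ * _).
  by rewrite rmorphM rmorphXn [_ 'X]ev_coefX expr1n mulr1 [_ _%:P]ev_coefC.
rewrite !evE => /eqP; rewrite -subr_eq0 -sumrB => /eqP E.
have := congr1 (fun u => u * \det (\matrix_(j, i) W (fun l => X (f l)) i j)) E.
rewrite /= mul0r mulr_suml => {}E; rewrite -[RHS]E; apply: eq_bigr => nu _.
by rewrite -(ev_schubert hk) // mulrA; congr (_ * _); rewrite rmorphB /= mulrBl.
Qed.

End Uniqueness.

(** * Quantum Kostka numbers *)

Section Sizes.

Variables k n : nat.
Hypothesis hk : k <= n.
Implicit Types mu nu : part k n.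

Lemma weighted_bits mu : \sum_(p < n) p * pbits mu p = psize mu + \sum_(i < k) i.
Proof.
have pos_inj : injective (pos hk mu).
  by move=> i j E; apply: val_inj; case: (ltngtP i j) => // /(pos_incr hk mu); rewrite E ltnn.
transitivity (\sum_(i < k) pos hk mu i); last first.
  rewrite /psize [X in _ = X + _](reindex_inj rev_ord_inj) -big_split /=.
  by apply: eq_bigr => i _.
transitivity (\sum_(p in pos hk mu @: setT) p); last first.
  by rewrite big_imset /=; [apply: eq_bigl => i; rewrite inE | apply: in2W].
rewrite [RHS]big_mkcond /=.
apply: eq_bigr => p _; case: ifP => [/imsetP[i _ ->]|Hp].
  by rewrite (_ : pbits mu _) ?muln1 //; apply/(pbitsP hk); exists i.
case E: (pbits mu p); last by rewrite muln0.
by move/(pbitsP hk): E => [i Ei]; rewrite Ei imset_f ?inE in Hp.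
Qed.

(** A horizontal dimer moves a letter up by one, except that edge n - 1 moves it from n - 1 down to
    0. *)
Lemma step_psize mu nu (H : bstring n) (p0 : 'I_n) : p0 = n.-1 :> nat ->
  step (pbits mu) H (pbits nu) ->
  psize nu + n * H p0 = psize mu + \sum_p H p.
Proof.
move=> p0E /stepP st; have n_gt0 : 0 < n by have := ltn_ord p0; lia.
have E1 : \sum_(p < n) p * pbits nu p + \sum_(p < n) p * H p =
          \sum_(p < n) p * pbits mu p + \sum_(p < n) p * H (ord_pred p).
  rewrite -!big_split; apply: eq_bigr => p _ /=.
  by rewrite -!mulnDr; have [_ ->] := st p.
have E2 : \sum_(p < n) p * H (ord_pred p) + n * H p0 = \sum_(p < n) p * H p + \sum_p H p.
  rewrite -(sum_ordS (fun p => p * H (ord_pred p))).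
  pose s p := if p.+1 == n then 0 else p.+1.
  rewrite (eq_bigr (fun p : 'I_n => s p * H p)) => [|p _]; last by rewrite ordSK val_ordS.
  rewrite -big_split (bigD1 p0) // [in RHS](bigD1 p0) //= {1}/s p0E prednK // eqxx mul0n.
  rewrite (eq_bigr (fun p : 'I_n => p * H p + H p)) => [|p ne_p]; last first.
    rewrite /s ifN; first by rewrite mulSn addnC.
    by apply: contra ne_p => /eqP Ep; apply/eqP/ord_inj; lia.
  by case: (H p0); move: (\sum_(i | _) _) => u; lia.
by move: E1 E2; rewrite !weighted_bits; lia.
Qed.

Lemma sum_step_part (b H : bstring n) (F : bstring n -> nat) : #|[set p | b p]| = k ->
  \sum_(b1 | step b H b1) F b1 = \sum_(nu : part k n | step b H (pbits nu)) F (pbits nu).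
Proof.
move=> bk; have [nu st|no_nu] := pickP (fun nu : part k n => step b H (pbits nu)).
  rewrite (big_pred1 nu) => [|nu']; last first.
    by apply/idP/eqP => [st'|->//]; apply: (pbits_inj hk); apply: step_fun st' st.
  rewrite (big_pred1 (pbits nu)) // => b1.
  by apply/idP/eqP => [st'|->//]; apply: step_fun st' st.
rewrite !big_pred0 // => b1; apply/negP => st.
have [|nu Enu] := @pbits_surj _ _ hk b1; first by rewrite (step_card st).
by have := no_nu nu; rewrite Enu st.
Qed.

Lemma paths_cons a al mu (b' : bstring n) :
  paths (a :: al) (pbits mu) b' =
  \sum_(H : bstring n | #|[set j | H j]| == a)
    \sum_(nu : part k n | step (pbits mu) H (pbits nu)) paths al (pbits nu) b'.
Proof.
apply: eq_bigr => H _; apply: (sum_step_part H (fun b1 => paths al b1 b')).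
exact/eqP/card_pbits.
Qed.

(** Here d is the number of hops around the end, the exponent of q. *)
Lemma paths_psize al mu nu : 0 < n -> paths al (pbits mu) (pbits nu) != 0 ->
  exists d, psize nu + n * d = sumn al + psize mu.
Proof.
move=> n_gt0; have lt_p0 : n.-1 < n by lia.
elim: al mu => [|a al IH] mu.
  by rewrite /= eqb0 negbK => /eqP/(pbits_inj hk)->; exists 0; lia.
rewrite paths_cons sum_nat_eq0 => /forallPn[H]; rewrite negb_imply sum_nat_eq0.
case/andP=> /eqP Ha /forallPn[nu1]; rewrite negb_imply => /andP[st /IH[d Ed]].
exists (d + H (Ordinal lt_p0)).
have /(_ erefl st) := @step_psize mu nu1 H (Ordinal lt_p0).
by rewrite -card_bits Ha /= mulnDr; lia.
Qed.

End Sizes.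

Definition ideal_of k n (P : Defs.qpoly k) : Prop :=
  exists c : 'I_(size (qH_relations k n)) -> Defs.qpoly k,
    (P = \sum_i c i * (qH_relations k n)`_i)%R.

(** * The iterated quantum Pieri rule *)

Section Expansion.

Import GRing.Theory Num.Theory.
Local Open Scope ring_scope.

Variables m k : nat.
Local Notation n := (m + k)%N.
Hypothesis n_gt0 : (0 < n)%N.
Let hk : (k <= n)%N := leq_addl m k.

Lemma ideal_of0 : ideal_of n (0 : Defs.qpoly k).
Proof. by exists (fun=> 0); rewrite big1 // => i _; rewrite mul0r. Qed.

Lemma ideal_of_lin a u v : ideal_of n u -> ideal_of n v -> ideal_of n (a * u + v : Defs.qpoly k).
Proof.
case=> c -> [c' ->]; exists (fun i => a * c i + c' i).
rewrite mulr_sumr -big_split; apply: eq_bigr => i _ /=.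
by rewrite mulrDl mulrA.
Qed.

Lemma ideal_of_relation i : (i < size (qH_relations k n))%N ->
  ideal_of n (qH_relations k n)`_i.
Proof.
move=> lt_i; exists (fun j => (j == Ordinal lt_i)%:R).
rewrite (bigD1 (Ordinal lt_i)) //= eqxx mul1r big1 ?addr0 // => j /negbTE->.
by rewrite mul0r.
Qed.

(** Evaluation at k distinct Bethe points kills the ideal but not 1. *)
Lemma ideal_of1 : ~ ideal_of n (1 : Defs.qpoly k).
Proof.
move=> I1; have [X [X_inj X_root _]] := bethe_points_ex k n_gt0.
have x_inj : injective (fun l => X (widen_ord hk l)).
  by move=> i j /X_inj/(congr1 val) /= /ord_inj.
have := @ev_eq_qH k n hk _ x_inj (fun l => X_root _) 1 0.
rewrite /eq_qH subr0 rmorph1 rmorph0 => /(_ I1) /eqP.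
by rewrite oner_eq0.
Qed.

Lemma quantum_expansion (al : seq nat) (mu : part k n) :
  (0 < k)%N || (al == [::]) -> all (fun a => a <= m)%N al ->
  eq_qH n (schubert mu * \prod_(a <- al) hsym k a%:Z)
    (\sum_(nu : part k n)
       (((paths al (pbits mu) (pbits nu))%:Z)%:P *
          'X^((sumn al + psize mu - psize nu) %/ n)%N : {poly int}) *: schubert nu).
Proof.
move=> k_al al_le.
have [S [p p0E]] := ideal_quotient_ex ideal_of0 ideal_of1 ideal_of_lin.
pose q := p (('X : {poly int})%:MP).
have pZ (K d : nat) (u : Defs.qpoly k) :
    p (((K%:Z)%:P * 'X^d : {poly int}) *: u) = K%:R * q ^+ d * p u.
  rewrite -mul_mpolyC rmorphM mpolyCM rmorphM; congr (_ * _ * _).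
    by rewrite -[Posz K]natz !rmorph_nat.
  elim: d => [|d IHd]; first by rewrite !expr0 mpolyC1 rmorph1.
  by rewrite !exprS mpolyCM rmorphM IHd.
suff E : p (schubert mu * \prod_(a <- al) hsym k a%:Z) =
    \sum_(nu : part k n) (paths al (pbits mu) (pbits nu))%:R *
      q ^+ ((sumn al + psize mu - psize nu) %/ n) * p (schubert nu).
  rewrite -[eq_qH _ _ _]/(ideal_of n _) -(p0E _) rmorphB E rmorph_sum.
  by under [X in _ - X]eq_bigr => nu _ do rewrite pZ; rewrite subrr.
have lt_last : (n.-1 < n)%N by lia.
pose last := Ordinal lt_last.
elim: al mu k_al al_le => [|a al IH] mu.
  move=> _ _; rewrite big_nil mulr1 (bigD1 mu) //= eqxx mul1r.
  rewrite add0n subnn div0n expr0 mul1r big1 ?addr0 // => nu ne_nu.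
  by rewrite (inj_eq (pbits_inj hk)) eq_sym (negbTE ne_nu) !mul0r.
rewrite orbF => k_gt0; rewrite [all _ _]/= => /andP[le_a al_le].
have {}IH nu := IH nu (introT orP (or_introl k_gt0)) al_le.
have relE i : (i < size (qH_relations k n))%N -> p (qH_relations k n)`_i = 0.
  by move=> lt_i; apply/p0E/ideal_of_relation.
have size_rel : size (qH_relations k n) = k.
  by rewrite qH_relationsE // size_rcons size_map size_iota prednK.
pose h s := p (hsym k s%:Z); pose e s := p (Defs.esym k s%:Z).
have h_rec i : h i.+1 = \sum_(l < k) (-1) ^+ l * e l.+1 * hdiff h i l.
  rewrite /h hsym_rec rmorph_sum; apply: eq_bigr => l _.
  rewrite !rmorphM rmorphXn rmorphN1; congr (_ * _).
  by rewrite /hdiff; case: ifP => _ //; rewrite rmorph0.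
have h0 : h 0%N = 1 by rewrite /h hsym0 rmorph1.
have h_van s : (m < s < m + k)%N -> h s = 0.
  move=> /andP[lt_s lt_s']; have := relE (s - m.+1)%N.
  rewrite size_rel qH_relationsE // nth_rcons size_map size_iota addnK.
  rewrite (_ : (s - m.+1 < k.-1)%N); last lia.
  rewrite (nth_map 0%N) ?size_iota; last lia.
  rewrite nth_iota; last lia.
  by rewrite subnKC // => H; apply: H; lia.
have h_n : h n = (-1) ^+ k.+1 * q.
  have := relE k.-1; rewrite size_rel qH_relationsE // nth_rcons size_map size_iota.
  rewrite ltnn eqxx => /(_ _); rewrite prednK // leqnn => /(_ isT).
  rewrite rmorphD -mul_mpolyC rmorphM rmorphXn rmorphN1 => /eqP.
  by rewrite addr_eq0 => /eqP; rewrite /h /q => ->; rewrite exprS; ring.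
have hdetE nu : hdet h (pos hk nu) = p (schubert nu).
  rewrite (schubert_hdet hk) -det_map_mx; congr (\det _).
  by apply/matrixP => i j; rewrite !mxE /hdiff; case: ifP => // _; rewrite rmorph0.
have pieri := quantum_pieri k_gt0 h_rec h_van h0 h_n mu (p0 := last) erefl le_a.
rewrite big_cons mulrA rmorphM [p (_ * hsym k _)]rmorphM -/(h a) -hdetE [_ * h a]mulrC pieri.
rewrite mulr_suml; under [RHS]eq_bigr => nu _ do
  rewrite (paths_cons hk) natr_sum -mulrA mulr_suml.
rewrite [RHS]exchange_big; apply: eq_bigr => H /eqP Ha.
rewrite mulr_suml; under [RHS]eq_bigr => nu _ do rewrite natr_sum mulr_suml.
rewrite [RHS]exchange_big; apply: eq_bigr => nu1 st.
rewrite -mulrA hdetE -rmorphM IH mulr_sumr; apply: eq_bigr => nu _.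
(* The exponents of q are truncated quotients, and a path guarantees that they add up; without one
   the coefficient is 0. *)
have [->|ne0] := eqVneq (paths al (pbits nu1) (pbits nu)) 0%N; first by rewrite !mul0r mulr0.
have [d Ed] := paths_psize hk n_gt0 ne0.
have := step_psize hk (p0 := last) erefl st; rewrite -card_bits Ha => Est.
rewrite -Ed addKn mulKn //.
rewrite (_ : (sumn (a :: al) + psize mu - psize nu = n * (d + H last))%N); last first.
  by rewrite /= mulnDr; lia.
by rewrite mulKn // exprD; ring.
Qed.

End Expansion.

(** * Rearrangements of a partition *)

Section Counting.

Variable T : finType.

Lemma sum_count_mem (s : seq T) : \sum_x count_mem x s = size s.
Proof.
elim: s => [|y s IH] /=; first by rewrite big1.
rewrite big_split /= IH (bigD1 y) //= eqxx big1 // => x ne_x.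
by rewrite eq_sym (negbTE ne_x).
Qed.

(** Split off the first entry x: the factorials for the remaining multiset lose the factor
    [count_mem x s], and these factors add up to the length. *)
Lemma card_rearrangements m (s : seq T) : size s = m ->
  (\sum_(t : m.-tuple T) perm_eq t s) * \prod_x (count_mem x s)`! = m`!.
Proof.
elim: m s => [|m IH] s Es.
  rewrite (size0nil Es) [X in _ * X]big1 //= muln1.
  rewrite (eq_bigr (fun=> 1)) => [|t _]; last by rewrite tuple0.
  by rewrite sum_nat_const card_tuple expn0.
rewrite (big_tuple_cons _ (fun t => perm_eq t s : nat)) big_distrl /=.
rewrite factS -Es -sum_count_mem big_distrl; apply: eq_bigr => x _ /=.
have [xs|nxs] := boolP (x \in s); last first.
  rewrite (count_memPn nxs) mul0n big1 // => t _; apply/eqP; rewrite eqb0.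
  by apply: contra nxs => /perm_mem <-; rewrite mem_head.
rewrite -(IH (rem x s)); last by rewrite size_rem // Es.
rewrite mulnCA; congr (_ * _).
  by apply: eq_bigr => t _; rewrite (permPr (perm_to_rem xs)) perm_cons.
rewrite (bigD1 x) //= [in RHS](bigD1 x) //= mulnA; congr (_ * _).
  have : 0 < count_mem x s by rewrite -has_count has_pred1.
  by rewrite count_rem xs /= eqxx subn1; case: (count_mem x s) => // c _; rewrite factS.
apply: eq_bigr => y ne_y; rewrite count_rem xs /= [x == y]eq_sym (negbTE ne_y).
by rewrite subn0.
Qed.

Lemma big_ffun_tuple k (F : seq T -> nat) :
  \sum_(a : {ffun 'I_k -> T}) F [seq a i | i : 'I_k] = \sum_(t : k.-tuple T) F t.
Proof.
rewrite (reindex (fun t : k.-tuple T => [ffun i => tnth t i])) /=; last first.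
  exists (fun a : {ffun 'I_k -> T} => [tuple a i | i < k]) => [t _|a _].
    by apply: eq_from_tnth => i; rewrite tnth_mktuple ffunE.
  by apply/ffunP => i; rewrite ffunE tnth_mktuple.
apply: eq_bigr => t _; congr F; rewrite -[RHS]map_tnth_enum.
by apply: eq_map => i; rewrite ffunE.
Qed.

End Counting.

Section PartSeq.

Variables k n : nat.
Implicit Types la : part k n.

Definition part_seq la : seq nat := [seq pt la i | i : 'I_k].

Lemma nth_part_seq la (i : 'I_k) : nth 0 (part_seq la) i = pt la i.
Proof. by rewrite (nth_map i) ?size_enum_ord // nth_ord_enum. Qed.

Lemma size_part_seq la : size (part_seq la) = k.
Proof. by rewrite size_map size_enum_ord. Qed.

Lemma sumn_part_seq la : sumn (part_seq la) = psize la.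
Proof. by rewrite sumnE big_map big_enum. Qed.

Lemma part_seq_le la : all (fun a => a <= n - k) (part_seq la).
Proof. by apply/allP => _ /mapP[i _ ->]; apply: pt_le. Qed.

Lemma part_seq_inj : injective part_seq.
Proof.
move=> la la' E; apply/val_inj/ffunP => i; apply: ord_inj.
by rewrite -/(pt la i) -/(pt la' i) -!nth_part_seq E.
Qed.

Lemma part_seq_sorted la : sorted geq (part_seq la).
Proof.
apply/(sortedP 0) => i; rewrite size_part_seq => lt_i.
have lt_i' := ltnW lt_i.
rewrite -[i]/(val (Ordinal lt_i')) -[(val _).+1]/(val (Ordinal lt_i)) !nth_part_seq.
by apply: pt_anti; rewrite /= leqnSn.
Qed.

Lemma part_seq_ex (s : seq nat) : size s = k -> all (fun a => a <= n - k) s ->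
  exists la, perm_eq s (part_seq la).
Proof.
move=> Es s_le; pose s' := sort geq s.
have Es' : size s' = k by rewrite size_sort.
have s'_sorted : sorted geq s' by apply: sort_sorted => x y; apply: leq_total.
have lt_s' (i : 'I_k) : nth 0 s' i < (n - k).+1.
  have: all (fun a => a <= n - k) s' by rewrite all_sort.
  by move/allP => /(_ (nth 0 s' i)); rewrite ltnS; apply; rewrite mem_nth ?Es'.
have s'_anti : [forall i : 'I_k, forall j : 'I_k, (i <= j) ==>
    ([ffun i => Ordinal (lt_s' i)] j <= [ffun i => Ordinal (lt_s' i)] i)].
  apply/forallP => i; apply/forallP => j; apply/implyP => le_ij; rewrite !ffunE /=.
  have geq_tr : transitive geq by move=> x y z /= h1 h2; apply: leq_trans h2 h1.
  have := sorted_leq_nth geq_tr leqnn 0 s'_sorted i j.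
  by rewrite !inE Es' !ltn_ord le_ij => /(_ isT isT isT).
pose la : part k n := Sub [ffun i => Ordinal (lt_s' i)] s'_anti.
have E : part_seq la = s'.
  apply: (@eq_from_nth _ 0); rewrite size_part_seq ?Es' // => i lt_i.
  have -> : nth 0 (part_seq la) i = pt la (Ordinal lt_i) := nth_part_seq la (Ordinal lt_i).
  by rewrite /pt /= ffunE.
by exists la; rewrite E perm_sym perm_sort.
Qed.

Lemma part_seq_perm la la' : perm_eq (part_seq la) (part_seq la') -> la = la'.
Proof.
move=> E; apply/part_seq_inj/(sorted_eq _ _ (part_seq_sorted la) (part_seq_sorted la') E).
  by move=> x y z /= h1 h2; apply: leq_trans h2 h1.
by move=> x y /andP[/= h1 h2]; apply/eqP; rewrite eqn_leq h1 h2.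
Qed.

Lemma sum_perm_part (G : seq nat -> nat) :
  (forall s s', size s = k -> all (fun a => a <= n - k) s -> perm_eq s s' -> G s = G s') ->
  \sum_(a : {ffun 'I_k -> 'I_(n - k).+1}) G [seq (a i : nat) | i : 'I_k] =
  \sum_la G (part_seq la) *
    \sum_(a : {ffun 'I_k -> 'I_(n - k).+1}) perm_eq [seq (a i : nat) | i : 'I_k] (part_seq la).
Proof.
move=> G_perm; under [RHS]eq_bigr do rewrite big_distrr /=.
rewrite exchange_big; apply: eq_bigr => a _ /=.
have a_size : size [seq (a i : nat) | i : 'I_k] = k by rewrite size_map size_enum_ord.
have a_le : all (fun v => v <= n - k) [seq (a i : nat) | i : 'I_k].
  by apply/allP => _ /mapP[i _ ->]; rewrite -ltnS ltn_ord.
have [la Ela] := part_seq_ex a_size a_le.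
rewrite (bigD1 la) //= Ela muln1 (G_perm _ _ a_size a_le Ela) big1 ?addn0 // => la' ne_la.
case E: (perm_eq _ _); last by rewrite muln0.
case/eqP: ne_la; apply: part_seq_perm.
by rewrite -(permPl E).
Qed.

Lemma card_arrangements la :
  (\sum_(a : {ffun 'I_k -> 'I_(n - k).+1}) perm_eq [seq (a i : nat) | i : 'I_k] (part_seq la)) *
    (\prod_(0 <= v < (n - k).+1) (pmult la v)`!) = k`!.
Proof.
pose s := [seq val la i | i : 'I_k].
have Es : part_seq la = map val s by rewrite -map_comp.
have := @card_rearrangements _ k s; rewrite size_map size_enum_ord => /(_ erefl) <-.
congr (_ * _).
  rewrite -(big_ffun_tuple k (fun t => perm_eq t s : nat)); apply: eq_bigr => a _.
  rewrite Es (_ : [seq (a i : nat) | i : 'I_k] = map val [seq a i | i : 'I_k]).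
    congr nat_of_bool; apply/idP/idP; first exact: (perm_map_inj val_inj).
    exact: perm_map.
  by rewrite -map_comp.
rewrite big_mkord; apply: eq_bigr => v _; congr factorial.
by rewrite /pmult /s count_map -sum1_count big_enum_cond sum1dep_card.
Qed.

End PartSeq.

(** * Comparison of the three counts *)

Section Main.

Variables m k : nat.
Local Notation n := (m + k)%N.
Hypothesis n_gt1 : 1 < n.
Let hk : k <= n := leq_addl m k.
Let n_gt0 : 0 < n := ltnW n_gt1.
Implicit Types mu nu la : part k n.

Section Kostka.

Import GRing.Theory.
Local Open Scope ring_scope.

Lemma eq_qH_trans (p u v : Defs.qpoly k) : eq_qH n p u -> eq_qH n p v -> eq_qH n u v.
Proof.
move=> pu pv; have := ideal_of_lin (-1) pu pv.
by rewrite mulN1r opprB addrA subrK.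
Qed.

(** The product of the h_a does not depend on their order, and its expansion is unique. *)
Lemma paths_perm (s s' : seq nat) mu nu : perm_eq s s' -> (0 < k)%N || (s == [::]) ->
  all (fun a => a <= m)%N s -> paths s (pbits mu) (pbits nu) = paths s' (pbits mu) (pbits nu).
Proof.
move=> ss' k_s s_le; have s'_le : all (fun a => a <= m)%N s' by rewrite -(perm_all _ ss').
have k_s' : (0 < k)%N || (s' == [::]).
  by rewrite -size_eq0 -(perm_size ss') size_eq0.
have E := quantum_expansion n_gt0 mu k_s s_le.
have E' := quantum_expansion n_gt0 mu k_s' s'_le.
rewrite -(perm_big _ ss') -(perm_sumn ss') /= in E'.
by have [] := expansion_unique hk n_gt0 (eq_qH_trans E E') nu.
Qed.

Lemma part_seq_nil la : (0 < k)%N || (part_seq la == [::]).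
Proof. by rewrite -size_eq0 size_part_seq; case: posnP. Qed.

Lemma part_seq_le_m la : all (fun a => a <= m)%N (part_seq la).
Proof. by have := part_seq_le la; rewrite addnK. Qed.

Lemma qKostkaE mu nu la : qKostka nu mu la = (paths (part_seq la) (pbits mu) (pbits nu))%:Z.
Proof.
pose K nu := (paths (part_seq la) (pbits mu) (pbits nu))%:Z.
have prodE : \prod_(a <- part_seq la) hsym k a%:Z = \prod_(i < k) hsym k (pt la i)%:Z.
  by rewrite big_map big_enum.
have expK : is_quantum_expansion mu la K.
  split=> [nu' nok|]; last first.
    have := quantum_expansion n_gt0 mu (part_seq_nil la) (part_seq_le_m la).
    by rewrite sumn_part_seq prodE.
  apply/eqP; rewrite /K eqz_nat; apply: contraNT nok => /(paths_psize hk n_gt0)[d].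
  rewrite sumn_part_seq /qdeg_ok => <-.
  by rewrite leq_addr addKn dvdn_mulr.
have [_ E'] := epsilon_spec (inhabits (fun _ : part k n => 0)) _ (ex_intro _ K expK).
have [_ E] := expK.
exact: (expansion_unique hk n_gt0 (eq_qH_trans E' E) nu).
Qed.

End Kostka.

(** Every row starts from k vertical dimers, and a horizontal dimer at j excludes a vertical one at
    j + 1. So the bound in [Gamma] excludes no configuration. *)
Lemma row_edges_le M mu nu : M \in boundary_dimers mu nu ->
  forall t : 'I_k, #|[set j | EdgeH t j \in M]| <= m.
Proof.
rewrite inE => /and3P[/perfect_matchingP PM /forallP Hmu _].
have bits_k (s : 'I_k.+1) : #|[set j | bits_of M s j]| = k.
  case: s => s lt_s; elim: s lt_s => [|s IH] lt_s.
    rewrite -[RHS](eqP (card_pbits hk mu)); apply: eq_card => j; rewrite !inE ffunE.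
    by rewrite -(eqP (Hmu j)); congr (EdgeV _ _ \in M); apply: ord_inj.
  have [st _] := PM (Ordinal (lt_s : s < k)).
  rewrite -[RHS](IH (ltnW lt_s)); have := step_card st.
  rewrite (_ : lift _ _ = Ordinal lt_s); last exact: ord_inj.
  by rewrite (_ : widen_ord _ _ = Ordinal (ltnW lt_s)); last exact: ord_inj.
move=> t; have [/stepP st _] := PM t.
rewrite -(leq_add2r k) -[X in _ + X <= _](bits_k (widen_ord (leqnSn k) t)).
rewrite !card_bits; set b := bits_of M _ in st *.
rewrite (_ : #|_| = \sum_j edges_of M t j); last first.
  by rewrite -card_bits; apply: eq_card => j; rewrite !inE ffunE.
rewrite -(sum_ordS (fun j => b j : nat)) -big_split /= -[leqRHS]card_ord -sum1_card.
apply: leq_sum => j _; have [H _] := st j.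
by case: (edges_of M t j) H => [/(_ isT)|_]; [case: (b _) | case: (b _)].
Qed.

Lemma boundary_dimers_Gamma mu nu : boundary_dimers mu nu = Gamma mu nu.
Proof.
apply/setP => M; apply/idP/bigcupP => [HM|[a _]]; last by rewrite inE => /andP[].
have lt_H (t : 'I_k) : #|[set j | EdgeH t j \in M]| < (n - k).+1.
  by rewrite addnK ltnS; apply: row_edges_le HM t.
exists [ffun t => Ordinal (lt_H t)] => //; rewrite inE HM /=.
by apply/forallP => t; rewrite ffunE.
Qed.

Lemma card_Gamma mu nu :
  #|Gamma mu nu| = \sum_(a : {ffun 'I_k -> 'I_(n - k).+1}) #|Gamma_row (fun t => a t : nat) mu nu|.
Proof.
rewrite -sum1_card /Gamma partition_disjoint_bigcup.
  by apply: eq_bigr => a _; rewrite sum1_card.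
move=> a a' ne_a; rewrite -setI_eq0; apply/set0Pn => -[M].
rewrite !inE => /andP[/andP[_ /forallP Ha] /andP[_ /forallP Ha']].
case/eqP: ne_a; apply/ffunP => t; apply: ord_inj.
by rewrite -(eqP (Ha t)) -(eqP (Ha' t)).
Qed.

Section Formula.

Import GRing.Theory Num.Theory.

(** The part 0 has multiplicity k - l, with l the length of la, so its factorial turns k! into l!
    times a binomial coefficient. *)
Lemma arrangements_frac la :
  ((\sum_(a : {ffun 'I_k -> 'I_(n - k).+1}) perm_eq [seq (a i : nat) | i : 'I_k] (part_seq la))%:R =
   ((plen la)`!%:R / (\prod_(1 <= i < (n - k).+1) (pmult la i)`!)%N%:R) *
          'C(k, plen la)%:R :> rat)%R.
Proof.
have := card_arrangements la; rewrite big_ltn //.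
set N := \sum_a _; set D := \prod_(1 <= i < _) _.
have le_len : plen la <= k by rewrite /plen -[leqRHS]card_ord max_card.
have -> : pmult la 0 = k - plen la.
  rewrite -[X in X - _](card_ord k) -(cardsC [set i | 0 < pt la i]) addKn /pmult.
  by apply: eq_card => i; rewrite !inE -leqn0 leqNgt.
rewrite -(bin_fact le_len) => E.
have D_gt0 : 0 < D by apply: prodn_gt0 => i; apply: fact_gt0.
have {}E : N * D = 'C(k, plen la) * (plen la)`!.
  apply/eqP; rewrite -(eqn_pmul2r (fact_gt0 (k - plen la))) -!mulnA.
  by rewrite [D * _]mulnC E.
rewrite mulrAC; apply: (canRL (mulfK _)); first by rewrite pnatr_eq0 -lt0n.
by rewrite -!natrM E mulnC.
Qed.

Lemma Gamma_formula mu nu :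
  (#|Gamma mu nu|%:R =
        \sum_(la : part k n)
          (qKostka nu mu la)%:~R *
          ((plen la)`!%:R / (\prod_(1 <= i < (n - k).+1) (pmult la i)`!)%N%:R) *
          'C(k, plen la)%:R :> rat)%R.
Proof.
rewrite card_Gamma.
pose G s := paths s (pbits mu) (pbits nu).
rewrite (eq_bigr (fun a : {ffun 'I_k -> 'I_(n - k).+1} =>
                    G [seq (a i : nat) | i : 'I_k])) => [|a _]; last exact: card_Gamma_row.
rewrite sum_perm_part => [|s s' Es s_le ss']; last first.
  rewrite addnK in s_le; apply: paths_perm => //.
  by rewrite -size_eq0 Es; case: posnP.
rewrite natr_sum; apply: eq_bigr => la _.
by rewrite natrM arrangements_frac qKostkaE mulrA.
Qed.

End Formula.

Lemma card_Bset (mu nu la : part k n) :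
  #|Bset hk la mu nu| = paths (part_seq la) (pbits mu) (pbits nu).
Proof.
have -> : paths (part_seq la) (pbits mu) (pbits nu) =
  paths (part_seq la) (flip (val (conj_vertex hk mu))) (flip (val (conj_vertex hk nu))).
  by rewrite /= !pbits_conj !flipK.
rewrite -card_chain; apply: eq_card => b; rewrite !inE.
exact: (combinatorial_R_chain n_gt1 _ _ _ (leq_subr k n) (part_seq_le la)).
Qed.

End Main.

Import GRing.Theory.
Local Open Scope ring_scope.

Theorem theorem3 (n k : nat) (hn : (3 <= n)%N) (hkn : (k <= n)%N)
    (mu nu : part k n) :
  (forall la : part k n,
     qKostka nu mu la = #|Gamma_row (pt la) mu nu|%:Z /\
     #|Gamma_row (pt la) mu nu| = #|Bset hkn la mu nu|) /\
  [/\ #|boundary_dimers mu nu| = #|Gamma mu nu|,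
      #|Gamma mu nu| =
        (\sum_(a : {ffun 'I_k -> 'I_(n - k).+1}) #|Gamma_row (fun t => a t : nat) mu nu|)%N
    & #|Gamma mu nu|%:R =
        \sum_(la : part k n)
          (qKostka nu mu la)%:~R *
          ((plen la)`!%:R / (\prod_(1 <= i < (n - k).+1) (pmult la i)`!)%N%:R) *
          'C(k, plen la)%:R :> rat].
Proof.
(* The determinants are block matrices with m + k rows, one block for the zeros and one for the
   letters. *)
have [m En] : exists m, n = (m + k)%N by exists (n - k)%N; rewrite subnK.
subst n; have n_gt1 : (1 < m + k)%N := ltnW hn.
split=> [la|]; last first.
  split; [by rewrite boundary_dimers_Gamma | exact: card_Gamma | exact: Gamma_formula].
rewrite (bool_irrelevance hkn (leq_addl m k)) card_Bset // qKostkaE //.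
by rewrite card_Gamma_row.
Qed.
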